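(* Let $M$ be a $3$-connected matroid with a $3$-connected simple minor $N$ such that $k:=r(M)-r(N)\ge 2$. Then $M$ has a free family of cardinality $\lceil k/2\rceil+1$ each of whose members is either a singleton set $\{x\}$ with $x$ vertically $N$-contractible in $M$, or an $N$-filament of $M$.
   Context: For a $3$-connected matroid $M$ with an $N$-minor, an element $x$ (or a set $X$) is vertically $N$-contractible if $\mathrm{si}(M/x)$ (resp. $\mathrm{si}(M/X)$), the simplification, is a $3$-connected matroid with an $N$-minor. A line of $M$ is a rank-$2$ set of elements. For $n\ge 3$, a sequence $x_1,\dots,x_n,y_1,\dots,y_n$ of elements of $M$ is an $N$-carambole of $M$ if $L:=\{y_1,\dots,y_n\}$ is a vertically $N$-contractible line of $M$ with $n$ distinct elements and, for each $i\in\{1,\dots,n\}$, $(L-y_i)\cup x_i$ is a cocircuit of $M$; $L$ is then called the filament of the carambole, and a set that is the filament of some $N$-carambole of $M$ is called an $N$-filament of $M$. A family $\{X_1,\dots,X_n\}$ of subsets of $E(M)$ is free if $M|(X_1\cup\cdots\cup X_n)=M|X_1\oplus\cdots\oplus M|X_n$. *)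

(* Defs.v *)
From mathcomp Require Import all_boot.
Set Implicit Arguments. Unset Strict Implicit. Unset Printing Implicit Defensive.

Record matroid (T : finType) := Matroid { ground : {set T}; indep : pred {set T} }.

Section Matroids.
Variable T : finType.
Implicit Types (M : matroid T) (X Y I J C D S : {set T}).

Definition is_matroid M : Prop :=
  [/\ indep M set0,
      (forall I, indep M I -> I \subset ground M),
      (forall I J, indep M J -> I \subset J -> indep M I) &
      (forall I J, indep M I -> indep M J -> #|I| < #|J| ->
         exists2 x, x \in J :\: I & indep M (x |: I))].

Definition rank M X : nat := \max_(I : {set T} | indep M I && (I \subset X)) #|I|.
Definition rk M : nat := rank M (ground M).

Definition restrict M S : matroid T :=
  Matroid (ground M :&: S) (fun I => indep M I && (I \subset S)).
Definition delete M D : matroid T := restrict M (ground M :\: D).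
Definition contract M C : matroid T :=
  Matroid (ground M :\: C)
    (fun I => (I \subset ground M :\: C) && (rank M (I :|: C) == #|I| + rank M C)).

Definition loop M (e : T) : bool := (e \in ground M) && (rank M [set e] == 0).
Definition parallel M (e f : T) : bool :=
  [&& e \in ground M, f \in ground M, e != f, ~~ loop M e, ~~ loop M f
    & rank M [set e; f] == 1].
Definition simple M : bool :=
  [forall e, ~~ loop M e] && [forall e, forall f, ~~ parallel M e f].

(* canonical simplification: delete loops and keep, in each parallel class,
   the element of least enumeration rank *)
Definition simp_set M : {set T} :=
  [set e in ground M | ~~ loop M e &&
     [forall f, parallel M f e ==> (enum_rank e <= enum_rank f)]].
Definition si M : matroid T := restrict M (simp_set M).

Definition three_connected M : Prop :=
  forall X, X \subset ground M -> forall k, 1 <= k <= 2 ->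
    ~ [/\ k <= #|X|, k <= #|ground M :\: X|
        & rank M X + rank M (ground M :\: X) <= rk M + k - 1].

Definition cocircuit M C : bool :=
  [&& C \subset ground M, rank M (ground M :\: C) < rk M &
      [forall C' : {set T}, (C' \proper C) ==> (rank M (ground M :\: C') == rk M)]].

Definition line M X : bool := (X \subset ground M) && (rank M X == 2).

(* {X_i} free: M|(X_1 u ... u X_n) = M|X_1 (+) ... (+) M|X_n (members pairwise disjoint) *)
Definition free_family M (F : {set {set T}}) : Prop :=
  [/\ forall X, X \in F -> X \subset ground M,
      trivIset F &
      forall I, I \subset cover F ->
        indep M I = [forall X in F, indep M (I :&: X)]].
End Matroids.

Definition iso (T T' : finType) (M : matroid T) (N : matroid T') : Prop :=
  exists f : T -> T',
    [/\ {in ground M &, injective f}, f @: ground M = ground N &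
        forall I : {set T}, I \subset ground M -> indep M I = indep N (f @: I)].

Definition has_minor (T T' : finType) (M : matroid T) (N : matroid T') : Prop :=
  exists C D : {set T},
    [/\ C \subset ground M, D \subset ground M, [disjoint C & D]
      & iso (delete (contract M C) D) N].

Definition vert_contractible (T T' : finType) (M : matroid T) (N : matroid T')
    (X : {set T}) : Prop :=
  X \subset ground M /\ three_connected (si (contract M X)) /\ has_minor (si (contract M X)) N.

Definition carambole (T T' : finType) (M : matroid T) (N : matroid T')
    (n : nat) (x y : 'I_n -> T) : Prop :=
  [/\ 3 <= n, injective y,
      line M [set y i | i : 'I_n] /\
      vert_contractible M N [set y i | i : 'I_n],
      (forall i, x i \in ground M) &
      (forall i, cocircuit M (([set y j | j : 'I_n] :\ y i) :|: [set x i]))].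

Definition filament (T T' : finType) (M : matroid T) (N : matroid T')
    (L : {set T}) : Prop :=
  exists n (x y : 'I_n -> T), carambole M N x y /\ L = [set y i | i : 'I_n].

(* Main.v *)
(** Everything is phrased with rank functions; a set is good when it is
    vertically N-contractible, and k = r(M) - r(N). A good line is called thin
    when it has at least three points, at most one of them good, and every
    other point y comes with a good point z such that (L - y) + z is a
    cocircuit; a thin line without good points is an N-filament.
    A good point exists as soon as k >= 1, and the proof is by induction on k.

    If there is no thin line, contract a good point x, so that k drops by one.
    A free family of M/x lifts member by member to a free family of M that is
    also skew to x: if {x, y} is good then y lies in the closure of the good
    points of M, and if the plane G spanned by x and a filament of M/x had no
    good point but x, the spikes of that filament would contradict the
    separations at the points of G.

    If there is a thin line L and k >= 5, contract L, so that k drops by two.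
    A good plane through L lies in the closure of L and the good points, and if
    G is spanned by L and a filament of M/L, then either some good point of M
    is skew to the rest of the family or the points of G outside L form another
    filament of M. Adding L, or its good point, gives one more member. For
    k <= 4 three good points of rank three near a thin line are enough. *)

Require Import Defs.
From mathcomp Require Import all_boot zify.
From Stdlib Require Import Classical.
Set Implicit Arguments. Unset Strict Implicit. Unset Printing Implicit Defensive.

(** * Rank functions *)

(** Goodness fails either through connectivity or through the minor. For connectivity, a
    non-contractible point of a rank-3 cocircuit forces the span of that cocircuit onto two lines
    through it; most contradictions exhibit three collinear points off such a centre. For the minor,
    two subsets of corank one in the same side of a separation, meeting its guts in the same point
    only, are interchangeable. A good point is found on a side poor in N that is taken minimal: its
    inner points are all N-contractible, so each of them carries a separation of its own, which is
    uncrossed with the minimal one. Lifting does not transform the members of a contraction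
    directly. Let Q span the contracted set and all that has to stay skew. A good point outside the
    closure of Q is a new member; if there is none, the lifted set has to meet that closure in too
    large a rank, against skewness. The one escape is a filament over a thin line, which contains
    the trace of a new filament. Hence the many statements about a flat Q that contains all good
    points. *)

Record rfun (T : finType) := Rfun {
  rf :> {set T} -> nat;
  rf_card : forall X : {set T}, rf X <= #|X|;
  rf_mono : forall X Y : {set T}, X \subset Y -> rf X <= rf Y;
  rf_subm : forall X Y : {set T}, rf (X :|: Y) + rf (X :&: Y) <= rf X + rf Y }.

Definition ballb (f : bool -> bool) := f true && f false.

Lemma ballbP (f : bool -> bool) : ballb f -> forall b, f b.
Proof. by case/andP => ? ?; case. Qed.

Lemma eq_bimpl (a b : bool) : (a ==> b) && (b ==> a) -> a = b.
Proof. by case: a; case: b. Qed.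

Lemma bimpl_eq (a b : bool) : a = b -> (a ==> b) && (b ==> a).
Proof. by move=> ->; case: b. Qed.

(* Truth-table decision of a goal [forall b1 .. bn : bool, is_true E]. *)
Ltac bool_table :=
  repeat match goal with |- is_true _ -> _ => intro end;
  repeat match goal with
  | H : is_true (_ ==> _) |- _ => revert H; apply/implyP
  | H : is_true (_ && _) |- _ => revert H; apply/implyP
  | H : is_true (_ || _) |- _ => revert H; apply/implyP
  | H : is_true (~~ _) |- _ => revert H; apply/implyP
  | H : is_true (_ \in _) |- _ => revert H; apply/implyP
  | H : is_true (_ == _) |- _ => revert H; apply/implyP
  | H : is_true true |- _ => clear H
  | H : is_true false |- _ => discriminate H
  end;
  repeat match goal with
  | |- context[@in_mem ?T ?x ?A] =>
      let b := fresh "b" in set b := (@in_mem T x A); clearbody b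
  | |- context[@eq_op ?T ?x ?y] =>
      let b := fresh "b" in set b := (@eq_op T x y); clearbody b
  end;
  repeat match goal with
  | b : bool |- is_true _ => revert b; apply: ballbP
  end;
  first [vm_compute; reflexivity | fail 1 "sets failed"].

Ltac hyps_none e := idtac.

Ltac hyps_sub e :=
  repeat match goal with
  | H : is_true (?A \subset ?B) |- _ => move: (introT implyP (subsetP H e)); clear H
  end.

Ltac hyps_eq e :=
  repeat match goal with
  | H : @eq _ ?A ?B |- _ => move/setP/(_ e)/bimpl_eq: (H); clear H
  end.

Ltac hyps_mem e :=
  repeat match goal with
  | H : is_true (?x \in ?A) |- _ => generalize H; clear H
  | H : is_true (~~ (?x \in ?A)) |- _ => generalize H; clear H
  | H : is_true (~~ (?x == ?y)) |- _ => generalize H; clear H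
  end.

Ltac literals :=
  repeat match goal with
  | |- is_true (in_mem _ _) -> _ => let H := fresh in intro H; rewrite ?H; clear H
  | |- is_true (~~ in_mem _ _) -> _ =>
      let H := fresh in move/negbTE => H; rewrite ?H; clear H
  | |- is_true true -> _ => intros _
  | |- is_true (true || _) -> _ => intros _
  end.

Ltac sets_with tac :=
  let e := fresh "e" in
  match goal with
  | |- is_true (_ \subset _) => apply/subsetP => e
  | |- @eq _ _ _ => apply/setP => e; apply: eq_bimpl
  end;
  tac e;
  repeat match goal with H : is_true _ |- _ => clear H end;
  rewrite ?inE;
  repeat match goal with
  | |- context[e == ?y] =>
      case: (eqVneq e y) => [?|_]; [subst e|]; rewrite ?inE ?eqxx
  end;
  repeat match goal with
  | |- context[?x == ?y] =>
      first [case: (eqVneq x y) => [->|_] | case: (x == y)]; rewrite ?eqxx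
  end;
  literals;
  bool_table.

(* Decides inclusions and equalities between Boolean combinations of sets. *)
Ltac sets :=
  first
    [ sets_with hyps_none
    | sets_with ltac:(fun e => hyps_sub e)
    | sets_with ltac:(fun e => hyps_mem e)
    | sets_with ltac:(fun e => hyps_sub e; hyps_mem e)
    | sets_with ltac:(fun e => hyps_eq e)
    | sets_with ltac:(fun e => hyps_sub e; hyps_eq e)
    | sets_with ltac:(fun e => hyps_sub e; hyps_eq e; hyps_mem e) ].

(* Ranks are abstracted and set hypotheses cleared first: [lia] is slow on them. *)
Ltac rlia :=
  repeat match goal with
  | H : is_true (_ <= _) |- _ => revert H
  | H : is_true (~~ (_ <= _)) |- _ => revert H
  | H : @eq ?A ?a ?b |- _ => unify A nat; change (@eq nat a b) in H; revert H
  | H : is_true (_ <= _) \/ is_true (_ <= _) |- _ => revert H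
  end;
  repeat match goal with
  | |- context[rf ?r ?X] => let n := fresh "n" in set n := (rf r X); clearbody n
  end;
  repeat match goal with H : _ |- _ => clear H end;
  intros; lia.

Section Rank.
Variables (T : finType) (r : rfun T).
Implicit Types (X Y Z F G H I J K L P Q U V W : {set T}) (e x y z : T).

Fact cl_key : unit. Proof. exact: tt. Qed.
Definition rcl X : {set T} := locked_with cl_key [set e | r (e |: X) <= r X].
Local Notation cl := rcl.
Definition rflat F := cl F \subset F.
Local Notation flat := rflat.

Lemma submod X Y U I : U \subset X :|: Y -> I \subset X :&: Y ->
  r U + r I <= r X + r Y.
Proof.
move=> sU sI; apply: leq_trans (rf_subm r X Y).
by apply: leq_add; apply: rf_mono.
Qed.

Lemma subadd X Y U : U \subset X :|: Y -> r U <= r X + r Y.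
Proof. by move=> sU; have := submod sU (sub0set _); rlia. Qed.

Lemma rank0 : r set0 = 0.
Proof. by have := rf_card r set0; rewrite cards0; rlia. Qed.

Lemma rank1_le e : r [set e] <= 1.
Proof. by have := rf_card r [set e]; rewrite cards1. Qed.

Lemma rankU1_le e X : r (e |: X) <= (r X).+1.
Proof.
by have := @subadd [set e] X (e |: X) (subxx _); have := rank1_le e; rlia.
Qed.

Lemma leT X : r X <= r setT.
Proof. by apply: rf_mono; apply: subsetT. Qed.

Lemma in_cl e X : (e \in cl X) = (r (e |: X) <= r X).
Proof. by rewrite /rcl locked_withE in_set. Qed.

Lemma notin_cl e X : e \notin cl X -> r (e |: X) = (r X).+1.
Proof. by rewrite in_cl; have := rankU1_le e X; rlia. Qed.

Lemma sub_cl X : X \subset cl X.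
Proof.
by apply/subsetP => e eX; rewrite in_cl; apply: rf_mono; sets.
Qed.

Lemma cl_mono X Y : X \subset Y -> cl X \subset cl Y.
Proof.
move=> XY; apply/subsetP => e; rewrite !in_cl => h.
have h2 : r (e |: Y) + r X <= r (e |: X) + r Y by apply: submod; sets.
by rlia.
Qed.

Lemma rank_cl_sub X Y : Y \subset cl X -> r (X :|: Y) = r X.
Proof.
move=> sY.
elim: {Y}#|Y| {-2}Y (leqnn #|Y|) sY => [|n IH] Y.
  by rewrite leqn0 cards_eq0 => /eqP-> _; rewrite setU0.
move=> hn sY; case: (set_0Vmem Y) => [->|[e eY]]; first by rewrite setU0.
have c : #|Y :\ e| <= n by move: hn; rewrite (cardsD1 e Y) eY.
have sYe : Y :\ e \subset cl X by apply: subset_trans sY; sets.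
have h1 := IH _ c sYe.
have h2 : e \in cl X by apply: (subsetP sY).
rewrite in_cl in h2.
have h3 : r (X :|: Y) + r X <= r (e |: X) + r (X :|: Y :\ e).
  by apply: submod; sets.
have h4 : r X <= r (X :|: Y) by apply: rf_mono; sets.
by rlia.
Qed.

Lemma rank_cl X : r (cl X) = r X.
Proof.
have := rank_cl_sub (subxx (cl X)).
by rewrite (_ : X :|: cl X = cl X) //; apply/setUidPr; apply: sub_cl.
Qed.

Lemma cl_flat X : flat (cl X).
Proof.
apply/subsetP => e; rewrite !in_cl rank_cl => h; apply: leq_trans h.
by apply: rf_mono; have := sub_cl X => s; sets.
Qed.

Lemma flat_cl F : flat F -> cl F = F.
Proof. by move=> fF; apply/eqP; rewrite eqEsubset sub_cl andbT. Qed.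

Lemma cl_min X F : X \subset F -> flat F -> cl X \subset F.
Proof. by move=> s f; apply: subset_trans f; apply: cl_mono. Qed.

Lemma cl_sub X Y : X \subset cl Y -> cl X \subset cl Y.
Proof. by move=> s; apply: cl_min (cl_flat _). Qed.

Lemma flatI F G : flat F -> flat G -> flat (F :&: G).
Proof.
move=> fF fG; rewrite /rflat subsetI; apply/andP.
by split; apply: cl_min; rewrite ?subsetIl ?subsetIr.
Qed.

Lemma flatT : flat setT. Proof. exact: subsetT. Qed.

Lemma rank_ge_cl X Y : X \subset Y -> r Y <= r X -> Y \subset cl X.
Proof.
move=> XY h; apply/subsetP => e eY; rewrite in_cl.
by apply: leq_trans h; apply: rf_mono; sets.
Qed.

Lemma flat_rank_sub F X : flat F -> F \subset X -> r X <= r F -> X \subset F.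
Proof. by move=> fF s h; rewrite -(flat_cl fF); apply: rank_ge_cl. Qed.

Lemma flatU1 F e : flat F -> e \notin F -> r (e |: F) = (r F).+1.
Proof. by move=> fF eF; apply: notin_cl; rewrite flat_cl. Qed.

Lemma clU1_exch X e f : e \in cl (f |: X) -> e \notin cl X -> f \in cl (e |: X).
Proof.
rewrite !in_cl => h1 h2.
have h3 : r (f |: (e |: X)) <= r (e |: (f |: X)) by apply: rf_mono; sets.
have := rankU1_le f X; have := rankU1_le e X; by rlia.
Qed.

Lemma rankU_cl X Y : r (cl X :|: Y) = r (X :|: Y).
Proof.
apply/eqP; rewrite eqn_leq.
have s := sub_cl X.
have -> /= : r (X :|: Y) <= r (cl X :|: Y) by apply: rf_mono; sets.
rewrite andbT; have h : r (cl X :|: Y) + r X <= r (cl X) + r (X :|: Y).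
  by apply: submod; sets.
by have := rank_cl X; rlia.
Qed.

Lemma rank_subflat F X : flat F -> ~~ (X \subset F) -> r (F :&: X) < r X.
Proof.
move=> fF /subsetPn[e eX eF]; have h := flatU1 fF eF.
have h2 : r (e |: F) + r (F :&: X) <= r F + r X by apply: submod; sets.
by rlia.
Qed.

(** Elements outside the closure of [x |: Y] are added one at a time; by exchange [x] never becomes
    spanned, and the process stops at corank one. *)
Lemma hyper_ext Y x : x \notin cl Y -> exists H,
  [/\ flat H, Y \subset H, x \notin H & (r H).+1 = r setT].
Proof.
elim: {Y}(r setT - r Y) {-2}Y (leqnn (r setT - r Y)) => [|n IH] Y hn xY.
  by have := notin_cl xY; have := leT (x |: Y); rlia.
have [h|h] := leqP (r setT) (r Y).+1.
  exists (cl Y); split=> //; [exact: cl_flat|exact: sub_cl|].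
  by rewrite rank_cl; have := notin_cl xY; have := leT (x |: Y); rlia.
have [e eh] : exists e, e \notin cl (x |: Y).
  apply/existsP; rewrite -negb_forall; apply/negP => /forallP hh.
  have : r setT <= r (cl (x |: Y)).
    by apply: rf_mono; apply/subsetP => e _; apply: hh.
  by rewrite rank_cl; have := rankU1_le x Y; rlia.
have ey : e \notin cl Y.
  by apply: contra eh; apply/subsetP; apply: cl_mono; sets.
have xe : x \notin cl (e |: Y).
  by apply: contra eh => h2; apply: clU1_exch h2 xY.
have le : r setT - r (e |: Y) <= n by rewrite (notin_cl ey); rlia.
have [H [fH sH xH rH]] := IH (e |: Y) le xe.
by exists H; split=> //; apply: subset_trans sH; sets.
Qed.

End Rank.

(** * Vertical connectivity *)

Section Connectivity.
Variables (T : finType) (r : rfun T).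
Implicit Types (X Y Z F G H I J K L P Q U V W : {set T}) (e x y z a b : T).
Local Notation R := (r setT).
Local Notation cl := (rcl r).
Local Notation flat := (rflat r).

(* The simplification of [r / Z] is 3-connected; covers take the place of
   partitions so that loops and parallel elements are immaterial. *)
Definition vconn Z : Prop := forall X Y d, d <= 1 -> X :|: Y = setT ->
  Z \subset X -> Z \subset Y -> r X + r Y <= R + r Z + d ->
  r X <= r Z + d \/ r Y <= r Z + d.

Local Notation VC := vconn.

(** Closing both sides changes no rank, so a failure has flat witnesses. *)
Lemma nVC Z : ~ VC Z -> exists X Y d,
  [/\ [/\ flat X, flat Y, d <= 1 & X :|: Y = setT], Z \subset X, Z \subset Y,
      r X + r Y <= R + r Z + d & r Z + d < r X /\ r Z + d < r Y].
Proof.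
move=> h; apply: NNPP => h2; apply: h => X Y d d1 c sX sY le.
apply: NNPP => h3; apply: h2; exists (cl X), (cl Y), d; rewrite !rank_cl.
have sX' := sub_cl r X; have sY' := sub_cl r Y.
split.
- by split; rewrite ?cl_flat //; sets.
- by sets.
- by sets.
- by [].
by split; rewrite ltnNge; apply/negP => h4; apply: h3; [left|right].
Qed.

Lemma coverI X Y : X :|: Y = setT -> R + r (X :&: Y) <= r X + r Y.
Proof. by move=> c; apply: submod; sets. Qed.

(** If the sum were smaller, the case [d = 1] would bound [r Y] by [r Z + 1]. As [X] does not span,
    the sum is then at most [R + r Z], the case [d = 0] applies, and the cover becomes too cheap for
    submodularity. *)
Lemma VC_big Z X Y : VC Z -> X :|: Y = setT -> Z \subset X -> Z \subset Y ->
  r Z + 2 <= r X -> r X < R -> R + r Z + 2 <= r X + r Y.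
Proof.
move=> vc c sX sY h1 h2; rewrite leqNgt; apply/negP => h3.
have [||h4] := vc X Y 1 isT c sX sY; [by rlia|by rlia|].
have [|h5|h5] := vc X Y 0 isT c sX sY; [|by rlia|].
  by rlia.
have hI : r Z <= r (X :&: Y) by apply: rf_mono; sets.
have := coverI c; by rlia.
Qed.

Lemma VC_cl Z : VC Z -> VC (cl Z).
Proof.
move=> vc X Y d d1 c sX sY; rewrite rank_cl => le.
by apply: vc => //; [apply: subset_trans sX|apply: subset_trans sY]; apply: sub_cl.
Qed.

Lemma cl_VC Z : VC (cl Z) -> VC Z.
Proof.
move=> vc X Y d d1 c sX sY le.
have := vc (cl X) (cl Y) d d1; rewrite !rank_cl; apply=> //.
- by have := sub_cl r X; have := sub_cl r Y => ? ?; sets.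
- exact: cl_mono.
exact: cl_mono.
Qed.

(** A bad separation over [W] has [x] on one side only. Adding [x] to the other side gives a
    separation over [x |: W], so the side of [x] has rank at most [r W + 2]. The other side, a flat
    missing [x], extends to [H], whose complement lies in the small side. *)
Lemma lemA W x : x \notin cl W -> VC (x |: W) -> ~ VC W -> exists H,
  [/\ flat H, W \subset H, x \notin H, (r H).+1 = R & r (W :|: (x |: ~: H)) <= r W + 2].
Proof.
move=> xW vc /nVC[X0 [Y0 [d [[fX0 fY0 d1 c0] sX0 sY0 le0 [lX0 lY0]]]]].
have rW := notin_cl xW.
have main X Y : flat X -> flat Y -> X :|: Y = setT -> W \subset X -> W \subset Y ->
    r X + r Y <= R + r W + d -> r W + d < r X -> r W + d < r Y -> x \in X ->
    exists H, [/\ flat H, W \subset H, x \notin H, (r H).+1 = R &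
      r (W :|: (x |: ~: H)) <= r W + 2].
  move=> fX fY c sX sY le lX lY xX.
  have xY : x \notin Y.
    apply/negP => xY.
    have xWX : x |: W \subset X by sets.
    have xWY : x |: W \subset Y by sets.
    have hI : r (x |: W) <= r (X :&: Y) by apply: rf_mono; sets.
    have hI2 := coverI c; rewrite rW in hI.
    have le' : r X + r Y <= R + r (x |: W) + 0 by rlia.
    by case: (vc X Y 0 isT c xWX xWY le'); rlia.
  have rY := flatU1 fY xY.
  have : r X <= r W + 2.
    have c' : X :|: (x |: Y) = setT by sets.
    have xWX : x |: W \subset X by sets.
    have xWY : x |: W \subset x |: Y by sets.
    have le' : r X + r (x |: Y) <= R + r (x |: W) + d by rlia.
    by case: (vc X (x |: Y) d d1 c' xWX xWY le'); rlia.
  move=> rX.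
  have xcY : x \notin cl Y by rewrite flat_cl.
  have [H [fH sH xH rH]] := hyper_ext xcY.
  exists H; split=> //; first by apply: subset_trans sH.
  by apply: leq_trans rX; apply: rf_mono; sets.
have : x \in X0 \/ x \in Y0.
  by move/setP/(_ x): c0; rewrite !inE => /orP.
case; first by apply: (main X0 Y0).
by apply: (main Y0 X0) => //; [sets|rlia].
Qed.

End Connectivity.

Definition simple_rf (T : finType) (r : rfun T) : Prop :=
  (forall e, r [set e] = 1) /\ (forall e f, e != f -> r [set e; f] = 2).

Section Simple.
Variables (T : finType) (r : rfun T).
Implicit Types (X Y Z F G H I J K L P Q U V W : {set T}) (e f x y z a b c : T).
Local Notation R := (r setT).
Local Notation cl := (rcl r).
Local Notation flat := (rflat r).
Local Notation VC := (vconn r).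

Lemma ex_notin X F : r F < r X -> exists2 e, e \in X & e \notin cl F.
Proof.
move=> h; apply/subsetPn; apply/negP => s.
by have := rf_mono r s; rewrite rank_cl; rlia.
Qed.

Lemma VC0_big X Y : VC set0 -> X :|: Y = setT -> 2 <= r X -> r X < R ->
  R + 2 <= r X + r Y.
Proof.
move=> vc c h1 h2.
have := VC_big vc c (sub0set _) (sub0set _); rewrite rank0.
by move=> h; have := h; rewrite !addn0 add0n => hh; apply: hh.
Qed.

Hypothesis simp : simple_rf r.

Lemma rank1 e : r [set e] = 1. Proof. exact: simp.1. Qed.
Lemma rank2 e f : e != f -> r [set e; f] = 2. Proof. exact: simp.2. Qed.

Lemma rank_gt0 X e : e \in X -> 0 < r X.
Proof. by move=> eX; rewrite -(rank1 e); apply: rf_mono; rewrite sub1set. Qed.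

Lemma eq_rank1 X e f : r X <= 1 -> e \in X -> f \in X -> e = f.
Proof.
move=> h eX fX; apply/eqP; apply/negPn/negP => /rank2 h2.
have : r [set e; f] <= r X by apply: rf_mono; sets.
by rlia.
Qed.

Lemma flat1 e : flat [set e].
Proof.
apply/subsetP => f; rewrite in_cl rank1 inE => h.
by apply/eqP/(eq_rank1 h); rewrite !inE eqxx ?orbT.
Qed.

Lemma line_cl L a b : flat L -> r L <= 2 -> a != b -> a \in L -> b \in L ->
  cl [set a; b] = L.
Proof.
move=> fL rL ab aL bL; apply/eqP; rewrite eqEsubset.
have s : [set a; b] \subset L by sets.
rewrite cl_min //=; apply: rank_ge_cl => //.
by rewrite rank2.
Qed.

Lemma line_eq L L' a b : flat L -> r L <= 2 -> flat L' -> r L' <= 2 -> a != b ->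
  a \in L -> b \in L -> a \in L' -> b \in L' -> L = L'.
Proof. by move=> *; rewrite -(@line_cl L a b) // -(@line_cl L' a b). Qed.

Lemma mem_cll a b : a \in cl [set a; b].
Proof. by apply: (subsetP (sub_cl r _)); rewrite !inE eqxx. Qed.

Lemma mem_clr a b : b \in cl [set a; b].
Proof. by apply: (subsetP (sub_cl r _)); rewrite !inE eqxx orbT. Qed.

Lemma rankU1 X Y e : e \in X -> e \in Y -> r (X :|: Y) < r X + r Y.
Proof.
move=> eX eY; have h : r (X :|: Y) + r [set e] <= r X + r Y.
  by apply: submod; sets.
by rewrite rank1 in h; rlia.
Qed.

(** The shape that a vertical separation at [z] imposes on the span of a rank-3 cocircuit through
    [z]: its two sides cut out the two lines. *)
Definition two_lines P z : Prop := exists L1 L2,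
  [/\ flat L1 /\ flat L2, r L1 <= 2 /\ r L2 <= 2, z \in L1 /\ z \in L2 &
      P \subset L1 :|: L2].
Local Notation covered := two_lines.

Lemma coveredW P z a : covered P z -> a \in P -> exists L1 L2,
  [/\ flat L1 /\ flat L2, r L1 <= 2 /\ r L2 <= 2, z \in L1 /\ z \in L2,
      P \subset L1 :|: L2 & a \in L1].
Proof.
case=> L1 [L2 [[f1 f2] [r1 r2] [z1 z2] s]] aP.
have := subsetP s a aP; rewrite inE => /orP[h|h]; first by exists L1, L2.
by exists L2, L1; split=> //; rewrite setUC.
Qed.

(** A point off the line of [z1] and [z2] lies on the second line of each cover. Two such points
    would identify these second lines, and the common line would contain both [z1] and [z2]. *)
Lemma cov_pair P z1 z2 : z1 != z2 -> z1 \in P -> z2 \in P -> 3 <= r P ->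
  covered P z1 -> covered P z2 ->
  exists p, [/\ p \in P, p \notin cl [set z1; z2] & P \subset p |: cl [set z1; z2]].
Proof.
move=> n12 P1 P2 rP c1 c2.
have [L1 [L1' [[f1 f1'] [r1 r1'] [z11 z11'] s1 z21]]] := coveredW c1 P2.
have [L2 [L2' [[f2 f2'] [r2 r2'] [z22 z22'] s2 z12]]] := coveredW c2 P1.
have E1 := line_cl f1 r1 n12 z11 z21.
have E2 := line_cl f2 r2 n12 z12 z22.
have [p pP pn] : exists2 p, p \in P & p \notin cl [set z1; z2].
  by apply: ex_notin; rewrite rank2.
exists p; split=> //; apply/subsetP => q qP; rewrite !inE.
have [//|qp /=] := eqVneq q p; apply/negPn/negP => qn.
have inL u : u \in P -> u \notin cl [set z1; z2] -> u \in L1' /\ u \in L2'.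
  move=> uP un; move: (subsetP s1 u uP) (subsetP s2 u uP).
  have u1 : u \notin L1 by rewrite -E1.
  have u2 : u \notin L2 by rewrite -E2.
  by rewrite !inE (negbTE u1) (negbTE u2) /= => -> ->.
have [p1 p2] := inL p pP pn; have [q1 q2] := inL q qP qn.
have E : L1' = L2' by apply: (@line_eq _ _ q p).
have : p \in cl [set z1; z2].
  by rewrite (@line_cl L1' z1 z2) // E.
by rewrite (negbTE pn).
Qed.

(** Pigeonhole: one of the two lines would carry two of the three collinear points and so be [L],
    which misses [z]. *)
Lemma not_covered P L z a b c : flat L -> r L <= 2 -> z \notin L ->
  a \in L -> b \in L -> c \in L -> a \in P -> b \in P -> c \in P ->
  a != b -> a != c -> b != c -> ~ covered P z.
Proof.
move=> fL rL zL aL bL cL aP bP cP ab ac bc cov.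
have key L' u v : flat L' -> r L' <= 2 -> z \in L' -> u \in L' -> v \in L' ->
    u \in L -> v \in L -> u != v -> False.
  move=> fL' rL' zL' uL' vL' uL vL uv; move: zL.
  by rewrite (@line_eq L L' u v) // zL'.
have [L1 [L2 [[f1 f2] [r1 r2] [z1 z2] s aL1]]] := coveredW cov aP.
have := subsetP s b bP; rewrite inE => /orP[h|bL2]; first exact: (key L1 a b).
have := subsetP s c cP; rewrite inE => /orP[h|cL2]; first exact: (key L1 a c).
exact: (key L2 b c).
Qed.

(** A vertical 3-separation whose sides are closed and overlap, with [x] in the guts. *)
Definition vert_sep X Y x : Prop :=
  [/\ flat X /\ flat Y, X :|: Y = setT, x \in X /\ x \in Y, 3 <= r X /\ 3 <= r Y &
      r X + r Y = R + 2].
Local Notation vsep := vert_sep.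

Lemma vsepC X Y x : vsep X Y x -> vsep Y X x.
Proof.
by case=> [[? ?] c [? ?] [? ?] e]; split=> //; [sets|rlia].
Qed.

Lemma sepP x : VC set0 -> ~ VC [set x] -> exists X Y, vsep X Y x.
Proof.
move=> vc /nVC[X [Y [d [[fX fY d1 c] sX sY]]]]; rewrite rank1 !sub1set in sX sY * => le [lX lY].
have c' : Y :|: X = setT by sets.
have hX := leT r X; have hY := leT r Y.
have [h|h] := ltnP (r X) R; last by rlia.
have h2 := VC0_big vc c; have lX2 : 2 <= r X by rlia.
have {h2} h3 := h2 lX2 h.
by exists X, Y; split=> //; [split; rlia|rlia].
Qed.

(** If one side of a separation at [z] contained the span of the cocircuit, the other could be cut
    down to its trace on [H]. This loses rank because [z] is outside [H], and the new cover
    contradicts 3-connectivity. So each side meets the span in rank at most 2. *)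
Lemma whittle_cov H z : VC set0 -> flat H -> (r H).+1 = R -> r (~: H) = 3 ->
  z \notin H -> ~ VC [set z] -> covered (cl (~: H)) z.
Proof.
move=> vc fH rH rC zH nz.
have [X [Y [[fX fY] c [zX zY] [rX rY] rXY]]] := sepP vc nz.
have scC := sub_cl r (~: H).
have zP : z \in cl (~: H) by apply: (subsetP scC); rewrite inE.
have fP := cl_flat r (~: H).
have nsub X' Y' : flat X' -> flat Y' -> X' :|: Y' = setT -> z \in X' -> z \in Y' ->
    3 <= r X' -> 3 <= r Y' -> r X' + r Y' = R + 2 -> ~~ (cl (~: H) \subset X').
  move=> fX' fY' c' zX' zY' rX' rY' e'; apply/negP => s.
  have c2 : X' :|: (H :&: Y') = setT by sets.
  have h1 : r (H :&: Y') < r Y'.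
    by apply: rank_subflat => //; apply/subsetPn; exists z.
  have := VC0_big vc c2; move=> h; have h2 : 2 <= r X' by rlia.
  have h3 : r X' < R by rlia.
  by have := h h2 h3; rlia.
have h1 := nsub _ _ fX fY c zX zY rX rY rXY.
have h2 : ~~ (cl (~: H) \subset Y).
  by apply: (nsub Y X) => //; [sets|rlia].
have p1 := rank_subflat fX h1; have p2 := rank_subflat fY h2.
rewrite rank_cl rC in p1 p2.
exists (X :&: cl (~: H)), (Y :&: cl (~: H)); split.
- by split; apply: flatI.
- by split.
- by rewrite !inE zX zY zP.
by sets.
Qed.

Lemma cocirc_rank H : VC set0 -> flat H -> (r H).+1 = R -> 3 <= R -> 3 <= r (~: H).
Proof.
move=> vc fH rH R3; have c : H :|: ~: H = setT by sets.
have h2 : 2 <= r H by rlia.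
have h3 : r H < R by rlia.
by have := VC0_big vc c h2 h3; rlia.
Qed.

(** Otherwise two points of the cocircuit force its span to be a line plus one point [p], itself in
    the cocircuit. The point [y] of [H] is then a third point on that line, so the span is not
    covered from [p]. *)
Lemma exists_VC H y : VC set0 -> flat H -> (r H).+1 = R -> r (~: H) = 3 ->
  y \in H -> y \in cl (~: H) -> exists2 z, z \notin H & VC [set z].
Proof.
move=> vc fH rH rC yH yP; apply: NNPP => no.
have scC := sub_cl r (~: H); set P := cl (~: H) in yP scC.
have rP : r P = 3 by rewrite rank_cl.
have cov z : z \notin H -> covered P z.
  by move=> zH; apply: whittle_cov => // vz; apply: no; exists z.
have [z1 z1H _] : exists2 z, z \in ~: H & z \notin cl set0.
  by apply: ex_notin; rewrite rC rank0.
have [z2 z2H z2n] : exists2 z, z \in ~: H & z \notin cl [set z1].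
  by apply: ex_notin; rewrite rC rank1.
have n12 : z1 != z2.
  by rewrite (flat_cl (flat1 _)) inE eq_sym in z2n.
have z1P : z1 \in P by apply: (subsetP scC).
have z2P : z2 \in P by apply: (subsetP scC).
rewrite !inE in z1H z2H.
have rP3 : 3 <= r P by rewrite rP.
have [p [pP pn sP]] := cov_pair n12 z1P z2P rP3 (cov _ z1H) (cov _ z2H).
have [q qH qn] : exists2 q, q \in ~: H & q \notin cl [set z1; z2].
  by apply: ex_notin; rewrite rC rank2.
have qp : q = p.
  have := subsetP sP q (subsetP scC q qH).
  by rewrite !inE (negbTE qn) orbF => /eqP.
rewrite {q}qp inE in qH qn.
have yp : y != p by apply: contraNneq qH => <-.
have ym : y \in cl [set z1; z2].
  by have := subsetP sP y yP; rewrite !inE (negbTE yp).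
have y1 : z1 != y by apply: contraNneq z1H => ->.
have y2 : z2 != y by apply: contraNneq z2H => ->.
have rm : r (cl [set z1; z2]) <= 2 by rewrite rank_cl rank2.
exact: (not_covered (cl_flat r _) rm pn (mem_cll _ _) (mem_clr _ _) ym z1P z2P yP
  n12 y1 y2 (cov p qH)).
Qed.

(** In a separation over [[set b; y]], a side with a cocircuit point off the line of [b] and [y]
    contains the whole rank-3 span, hence [a]. Intersecting the other side with [H] and adding [a]
    trades [b] for [a] at no cost in rank. *)
Lemma swapVC H y a b : VC set0 -> flat H -> (r H).+1 = R -> r (~: H) = 3 ->
  y \in H -> y \in cl (~: H) -> a \notin H -> b \notin H ->
  VC [set a; y] -> VC [set b; y].
Proof.
move=> vc fH rH rC yH yP aH bH va.
have ay : a != y by apply: contraNneq aH => ->.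
have by' : b != y by apply: contraNneq bH => ->.
apply: NNPP => /nVC[X0 [Y0 [d [[fX0 fY0 d1 c0] sX0 sY0]]]].
rewrite (rank2 by') => le0 [lX0 lY0].
have scC := sub_cl r (~: H).
have main X Y : flat X -> flat Y -> X :|: Y = setT -> [set b; y] \subset X ->
    [set b; y] \subset Y -> r X + r Y <= R + 2 + d -> 2 + d < r X -> 2 + d < r Y ->
    ~~ (~: H :&: X \subset cl [set b; y]) -> False.
  move=> fX fY c sX sY le lX lY /subsetPn[e]; rewrite !inE => /andP[eH eX] en.
  have sP : cl (~: H) \subset X.
    have s3 : e |: [set b; y] \subset cl (~: H) by sets.
    have h : r (e |: [set b; y]) = 3 by rewrite (notin_cl en) rank2.
    apply: subset_trans (_ : cl (e |: [set b; y]) \subset X).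
      by apply: flat_rank_sub; [exact: cl_flat|exact: cl_sub|rewrite !rank_cl h rC].
    by apply: cl_min => //; sets.
  have r1 : r (cl (a |: (H :&: Y))) = (r (H :&: Y)).+1.
    rewrite rank_cl notin_cl // flat_cl ?flatI // inE (negbTE aH) //.
  have r2 : r (H :&: Y) < r Y.
    apply: rank_subflat => //; apply/subsetPn; exists b => //.
    by apply: (subsetP sY); rewrite !inE eqxx.
  have aX : a \in X by apply: (subsetP sP); apply: (subsetP scC); rewrite inE.
  have s1 := sub_cl r (a |: (H :&: Y)).
  have c1 : X :|: cl (a |: (H :&: Y)) = setT by sets.
  have sX1 : [set a; y] \subset X.
    by rewrite subUset !sub1set aX; have := subsetP sX y; rewrite !inE eqxx orbT => ->.
  have sY1 : [set a; y] \subset cl (a |: (H :&: Y)).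
    have yY : y \in Y by apply: (subsetP sY); rewrite !inE eqxx orbT.
    by sets.
  have c2 : X :|: (H :&: Y) = setT by sets.
  have rX3 : 3 <= r X by rewrite -rC -(rank_cl r (~: H)); apply: rf_mono.
  have hXT : r X < R -> R + 2 <= r X + r (H :&: Y).
    by apply: VC0_big => //; rlia.
  have := va X (cl (a |: (H :&: Y))) d d1 c1 sX1 sY1.
  rewrite r1 (rank2 ay) => h.
  have hX := leT r X.
  case: h; [rlia|rlia|move=> h].
  have [hx|hx] := ltnP (r X) R; first by have := hXT hx; rlia.
  by rlia.
have [|n1] := boolP (~: H :&: X0 \subset cl [set b; y]); last exact: (main X0 Y0).
have [|n2] := boolP (~: H :&: Y0 \subset cl [set b; y]).
  move=> s1 s2; have s : ~: H \subset cl [set b; y] by sets.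
  by have := rf_mono r s; rewrite rank_cl rank2 // rC.
move=> _; apply: (main Y0 X0) => //; [sets|rlia].
Qed.

End Simple.

(** * Minors *)

Section Minor.
Variables (U : finType) (rN : rfun U).
Local Notation n := (rN setT).

(* [N] is a restriction of full rank of [r / C], so that contracting [C] and
   deleting the rest yields [N]. *)
Definition embeds (T : finType) (r : rfun T) (C : {set T}) : Prop :=
  r C + n = r setT /\
  exists g : U -> T, forall I : {set U}, r ((g @: I) :|: C) = rN I + r C.

Definition ncontr (T : finType) (r : rfun T) (Z : {set T}) : Prop :=
  exists2 C : {set T}, Z \subset C & embeds r C.

(* Vertical N-contractibility. *)
Definition vcontr (T : finType) (r : rfun T) (Z : {set T}) : Prop :=
  vconn r Z /\ ncontr r Z.

Hypothesis N1 : forall u, rN [set u] = 1.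
Hypothesis N3 : forall (I : {set U}) d, d <= 1 -> rN I + rN (~: I) <= n + d ->
  #|I| <= d \/ #|~: I| <= d.

Variables (T : finType) (r : rfun T).
Implicit Types (X Y Z F G H J K L P Q V W C : {set T}) (e f x y z a b c t : T).
Local Notation R := (r setT).
Local Notation cl := (rcl r).
Local Notation flat := (rflat r).
Local Notation VC := (vconn r).
Local Notation NM := (ncontr r).
Local Notation EMB := (embeds r).
Local Notation good := (vcontr r).

Lemma NM_sub Z Z' : Z \subset Z' -> NM Z' -> NM Z.
Proof. by move=> s [C s2 h]; exists C => //; apply: subset_trans s2. Qed.

Lemma EMB_cl C : EMB C -> EMB (cl C).
Proof.
case=> h [g gE]; split; first by rewrite rank_cl.
by exists g => I; rewrite setUC rankU_cl setUC gE rank_cl.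
Qed.

Lemma NM_cl Z : NM Z -> NM (cl Z).
Proof. by case=> C s h; exists (cl C); [apply: cl_mono|apply: EMB_cl]. Qed.

(** A cover splits the points of [N], which spans [r / C], and one part has at most [d] points. If
    the other part spans [N], its side has full rank. Otherwise the rank sum in [N] is one lower,
    [N3] applies with [d = 0], and [N] has rank at most [d]. *)
Lemma EMB_VC C : EMB C -> VC C.
Proof.
case=> rC [g gE] X Y d d1 c sX sY le.
have key X' Y' (I : {set U}) : X' :|: Y' = setT -> C \subset X' -> C \subset Y' ->
    (g @: I) \subset X' -> (g @: (~: I)) \subset Y' ->
    rN I + rN (~: I) <= n + d -> #|I| <= d -> r X' <= r C + d \/ R <= r Y'.
  move=> c' sX' sY' gX gY leN cI.
  have hY : rN (~: I) + r C <= r Y' by rewrite -gE; apply: rf_mono; sets.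
  have [h|h] := leqP n (rN (~: I)); first by right; rlia.
  left; have hI := rf_card rN I.
  have [|h2|h2] := @N3 I 0 isT; first by rlia.
    by move: h; rewrite (_ : ~: I = setT) ?ltnn //;
       move: h2; rewrite leqn0 cards_eq0 => /eqP->; rewrite setC0.
  have hT : rN setT <= rN I.
    apply: rf_mono; move: h2; rewrite leqn0 cards_eq0 => /eqP/(congr1 (@setC _)).
    by rewrite setCK setC0 => ->.
  by have := leT r X'; rlia.
pose I := [set u | g u \in X].
have gX : g @: I \subset X.
  by apply/subsetP => _ /imsetP[u uI ->]; rewrite inE in uI.
have gY : g @: (~: I) \subset Y.
  apply/subsetP => _ /imsetP[u uI ->]; rewrite !inE in uI.
  by move/setP/(_ (g u)): c; rewrite !inE (negbTE uI).
have hX : rN I + r C <= r X by rewrite -gE; apply: rf_mono; sets.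
have hY : rN (~: I) + r C <= r Y by rewrite -gE; apply: rf_mono; sets.
have leN : rN I + rN (~: I) <= n + d by rlia.
have c' : Y :|: X = setT by sets.
case: (N3 d1 leN) => h.
  by case: (key X Y I c sX sY gX gY leN h) => h2; [left|left; rlia].
have gX' : g @: (~: ~: I) \subset X by rewrite setCK.
have leN' : rN (~: I) + rN (~: ~: I) <= n + d by rewrite setCK; rlia.
by case: (key Y X (~: I) c' sY sX gY gX' leN' h) => h2; [right|right; rlia].
Qed.

(** The common point [t] gives one inequality. For the other, [J] and [Y] already attain equality,
    which passes to the subset [W] of [Y]. *)
Lemma skew_rank X Y J W t : r X + r Y = R + 2 -> t \in J -> t \in W -> r [set t] = 1 ->
  J \subset X -> W \subset Y -> (r J).+1 = r X -> r (J :|: Y) = R ->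
  (r (J :|: W)).+1 = r J + r W.
Proof.
move=> rXY tJ tW rt sJ sW rJ rJY.
have h1 : r (J :|: W) + r [set t] <= r J + r W by apply: submod; sets.
have h2 : r (J :|: Y) + r W <= r (J :|: W) + r Y by apply: submod; sets.
by rlia.
Qed.

(* If [J] spans all but one dimension of [X] and meets the guts of the
   separation [(X, Y)] in [t] only, contracting [J] leaves [Y / t] together
   with a single point on the guts, whatever [J] is. *)
Lemma NM_swap X Y t J J' : r [set t] = 1 -> X :|: Y = setT ->
  r X + r Y = R + 2 -> t \in Y ->
  t \in J -> t \in J' -> J \subset X -> J' \subset X -> (r J).+1 = r X ->
  (r J').+1 = r X -> r (J :|: Y) = R -> r (J' :|: Y) = R -> NM J -> NM J'.
Proof.
move=> rt c rXY tY tJ tJ' sJ sJ' rJ rJ' rJY rJY' [C sC EC].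
have [rC [g gE]] := EC.
pose J0 := C :&: X; pose B := t |: (C :&: Y).
have tC : t \in C by apply: (subsetP sC).
have tX : t \in X by apply: (subsetP sJ).
have CE : C = J0 :|: B by rewrite /J0 /B; sets.
have sJ0 : J \subset J0 by rewrite /J0; sets.
have rJ0 := rf_mono r sJ0.
have sJ0X : J0 \subset X by rewrite /J0; sets.
have rJ0X := rf_mono r sJ0X.
(* If the trace of [C] spans [X], the closure of [C] already contains [J']. *)
have [hJ|hJ] := leqP (r X) (r J0).
  exists (cl C); last exact: EMB_cl.
  apply: subset_trans sJ' _; apply: subset_trans (rank_ge_cl sJ0X hJ) _.
  by apply: cl_mono; rewrite /J0; sets.
have eJ0 : (r J0).+1 = r X by rlia.
have J0Y : r (J0 :|: Y) = R.
  by apply/eqP; rewrite eqn_leq leT -rJY; apply: rf_mono; sets.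
have sBY : B \subset Y by rewrite /B; sets.
have tB : t \in B by rewrite /B !inE eqxx.
have tJ0 : t \in J0 by apply: (subsetP sJ0).
have h0 W : W \subset Y -> t \in W -> (r (J0 :|: W)).+1 = r J0 + r W.
  by move=> sW tW; apply: (@skew_rank X Y J0 W t).
have h1 W : W \subset Y -> t \in W -> (r (J' :|: W)).+1 = r J' + r W.
  by move=> sW tW; apply: (@skew_rank X Y J' W t).
have [f fX fn] : exists2 f, f \in X & f \notin cl J' by apply: ex_notin; rlia.
have rr : r (J' :|: B) = r C.
  by rewrite CE; have := h0 _ sBY tB; have := h1 _ sBY tB; rlia.
exists (J' :|: B); first by sets.
split; first by rewrite rr.
(* After either contraction [X] has rank one, so a single point [f] of [X] off [cl J'] can stand for
   every point of [N] outside [Y]. *)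
exists (fun u => if g u \in Y then g u else f) => I; rewrite rr -gE.
set g' := fun u => _.
have span K e : K \subset X -> (r K).+1 = r X -> e \in X -> e \notin cl K ->
    forall W, r ((e |: K) :|: W) = r (X :|: W).
  move=> sK rK eX eK W; rewrite -(rankU_cl r (e |: K)) -(rankU_cl r X).
  have s1 : e |: K \subset X by sets.
  suff -> : cl (e |: K) = cl X by [].
  apply/eqP; rewrite eqEsubset cl_mono //= cl_sub //.
  by apply: rank_ge_cl => //; rewrite (notin_cl eK) rK.
have [hI|hI] := boolP [forall u in I, g u \in Y].
  have {}hI u : u \in I -> g u \in Y by move=> uI; apply: (implyP (forallP hI u)).
  have -> : g' @: I = g @: I.
    by apply: eq_in_imset => u /hI; rewrite /g' => ->.
  have sg : g @: I \subset Y by apply/subsetP => _ /imsetP[u /hI h ->].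
  have sW : (g @: I) :|: B \subset Y by sets.
  have tW : t \in (g @: I) :|: B by rewrite inE tB orbT.
  have e1 : (g @: I) :|: (J' :|: B) = J' :|: ((g @: I) :|: B) by sets.
  have e2 : (g @: I) :|: C = J0 :|: ((g @: I) :|: B) by rewrite CE; sets.
  by rewrite e1 e2; have := h0 _ sW tW; have := h1 _ sW tW; rlia.
move: hI; rewrite negb_forall_in => /exists_inP[u uI guY].
have guX : g u \in X by move/setP/(_ (g u)): c; rewrite !inE (negbTE guY) orbF.
have guC : g u \notin cl J0.
  rewrite in_cl; apply/negP => h.
  have : r ((g @: [set u]) :|: C) = 1 + r C by rewrite gE N1.
  rewrite imset_set1.
  have h2 : r ([set g u] :|: C) + r J0 <= r (g u |: J0) + r C.
    by rewrite CE; apply: submod; sets.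
  by move=> h3; have := h; have := h2; rewrite h3; rlia.
have gu1 : g u \in g @: I by apply: imset_f.
have fg' : f \in g' @: I.
  by apply/imsetP; exists u => //; rewrite /g' (negbTE guY).
have e1 : (g @: I) :|: C = (g u |: J0) :|: ((g @: I) :|: C) by sets.
have e2 : (g' @: I) :|: (J' :|: B) = (f |: J') :|: ((g' @: I) :|: (J' :|: B)).
  by sets.
rewrite e1 e2 (span J0 (g u)) // (span J' f) //.
congr (r _).
have q1 w : w \in I -> (g w \in X) || (g' w == g w).
  move=> wI; rewrite /g'; case: ifP => [_|hw]; first by rewrite eqxx orbT.
  by move/setP/(_ (g w)): c; rewrite !inE hw orbF => ->.
have q2 w : w \in I -> (g' w \in X) || (g' w == g w).
  by move=> wI; rewrite /g'; case: ifP => _; rewrite ?eqxx ?orbT ?fX.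
have s1 : g @: I \subset X :|: (g' @: I).
  apply/subsetP => _ /imsetP[w wI ->]; case/orP: (q1 w wI) => h.
    by rewrite inE h.
  by rewrite inE -(eqP h) imset_f ?orbT.
have s2 : g' @: I \subset X :|: (g @: I).
  apply/subsetP => _ /imsetP[w wI ->]; case/orP: (q2 w wI) => h.
    by rewrite inE h.
  by rewrite inE (eqP h) imset_f ?orbT.
by rewrite CE; sets.
Qed.

End Minor.

(** * Existence of a vertically contractible point *)

Section Existence.
Variables (U : finType) (rN : rfun U).
Hypothesis N1 : forall u, rN [set u] = 1.
Hypothesis N3 : forall (I : {set U}) d, d <= 1 -> rN I + rN (~: I) <= rN setT + d ->
  #|I| <= d \/ #|~: I| <= d.
Variables (T : finType) (r : rfun T).
Implicit Types (X Y Z F G H J K L P Q V W C : {set T}) (e f x y z a b c t q w : T).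
Local Notation R := (r setT).
Local Notation cl := (rcl r).
Local Notation flat := (rflat r).
Local Notation VC := (vconn r).
Local Notation NM := (ncontr rN r).
Local Notation EMB := (embeds rN r).
Local Notation good := (vcontr rN r).
Local Notation vsep := (vert_sep r).
Hypothesis simp : simple_rf r.
Hypothesis vc0 : VC set0.

(** The closure of the cocircuit and [H] form a separation with [y] in the guts, where both pairs
    have corank one in the rank-3 side. *)
Lemma swapNM H y a b : flat H -> (r H).+1 = R -> r (~: H) = 3 ->
  y \in H -> y \in cl (~: H) -> a \notin H -> b \notin H ->
  NM [set a; y] -> NM [set b; y].
Proof.
move=> fH rH rC yH yP aH bH.
have scC := sub_cl r (~: H).
have ay : a != y by apply: contraNneq aH => ->.
have by' : b != y by apply: contraNneq bH => ->.
have aP : a \in cl (~: H) by apply: (subsetP scC); rewrite inE.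
have bP : b \in cl (~: H) by apply: (subsetP scC); rewrite inE.
have span u : u \notin H -> r ([set u; y] :|: H) = R.
  move=> uH; have h := flatU1 fH uH; apply/eqP; rewrite eqn_leq leT -rH -h.
  by apply: rf_mono; sets.
apply: (@NM_swap _ rN N1 _ r (cl (~: H)) H y) => //.
- exact: rank1.
- by sets.
- by rewrite rank_cl rC; rlia.
- by rewrite !inE eqxx orbT.
- by rewrite !inE eqxx orbT.
- by sets.
- by sets.
- by rewrite rank_cl rC rank2.
- by rewrite rank_cl rC rank2.
- exact: span.
exact: span.
Qed.

(** The side [X] is poor in [N]. The inequality says that [J] and [Y] have local connectivity at
    most one, which the common point [x] already accounts for. *)
Definition small X Y x := forall J, J \subset X -> x \in J ->
  r J + r Y <= (r (J :|: Y)).+1 -> NM J.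

Lemma skew_ext X Y J : X :|: Y = setT -> J \subset X -> r J + r Y <= (r (J :|: Y)).+1 ->
  exists J', [/\ J \subset J', J' \subset X, r J' + r Y <= (r (J' :|: Y)).+1 &
    r (J' :|: Y) = R].
Proof.
move=> c.
elim: {J}(R - r (J :|: Y)) {-2}J (leqnn (R - r (J :|: Y))) => [|m IH] J hm sJ le.
  by exists J; split=> //; have := leT r (J :|: Y); rlia.
have [h|h] := leqP R (r (J :|: Y)).
  by exists J; split=> //; have := leT r (J :|: Y); rlia.
have [e _ en] : exists2 e, e \in [set: T] & e \notin cl (J :|: Y) by apply: ex_notin.
have r1 := notin_cl en.
have e1 : e |: (J :|: Y) = (e |: J) :|: Y by sets.
have eX : e \in X.
  have : e \notin Y by apply: contra en => eY; apply: (subsetP (sub_cl r _)); rewrite inE eY orbT.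
  by move/setP/(_ e): c; rewrite !inE => h1 /negbTE h2; move: h1; rewrite h2 orbF.
have r2 := rankU1_le r e J.
rewrite e1 in r1.
have [|||J' [s1 s2 s3 s4]] := IH (e |: J).
- by rlia.
- by sets.
- by rlia.
by exists J'; split=> //; apply: subset_trans s1; sets.
Qed.

(** Contracting [C] leaves at most one dimension of [X]. If none is left, the closure of [C]
    contains every [J]. Otherwise 3-connectivity of [r / C] makes [C :&: X] a set of corank one in
    [X] that spans together with [Y], and an extension of [J] can replace it by [NM_swap]. *)
Lemma small_side X Y x C : EMB C -> x \in C -> X :|: Y = setT -> x \in X -> x \in Y ->
  r X + r Y = R + 2 -> r (X :|: C) <= (r C).+1 ->
  r (X :|: C) <= r C \/ r C < r (Y :|: C) -> small X Y x.
Proof.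
move=> EC xC c xX xY rXY le hor J sJ xJ leJ.
case: (leqP (r (X :|: C)) (r C)) => [h|h].
  exists (cl C); last exact: EMB_cl.
  by apply: (subset_trans sJ); apply: subset_trans (rank_ge_cl (subsetUr X C) h); sets.
have hY : r C < r (Y :|: C) by case: hor; rlia.
have vC := EMB_VC N3 EC.
pose CX := C :&: X.
have h1 : r (X :|: C) + r CX <= r X + r C by apply: submod; rewrite /CX; sets.
have h2 : r (Y :|: C) + r [set x] <= r Y + r CX by apply: submod; rewrite /CX; sets.
rewrite rank1 // in h2.
have h3 : R + r C < r (X :|: C) + r (Y :|: C).
  rewrite ltnNge; apply/negP => h3.
  have c1 : (X :|: C) :|: (Y :|: C) = setT by sets.
  have sX : C \subset X :|: C by sets.
  have sY : C \subset Y :|: C by sets.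
  have le0 : r (X :|: C) + r (Y :|: C) <= R + r C + 0 by rlia.
  by case: (vC _ _ 0 isT c1 sX sY le0); rewrite addn0; rlia.
have h4 : r (Y :|: C) <= r (CX :|: Y) by apply: rf_mono; rewrite /CX; sets.
have h5 := leT r (CX :|: Y).
have [J' [s1 s2 le' sp]] := skew_ext c sJ leJ.
have xJ' : x \in J' by apply: (subsetP s1).
have h6 : r (J' :|: Y) + r [set x] <= r J' + r Y by apply: submod; sets.
rewrite rank1 // in h6.
apply: NM_sub s1 _.
apply: (@NM_swap _ rN N1 _ r X Y x CX J') => //; rewrite ?rank1 //; try by rlia.
- by rewrite inE xC.
- by rewrite /CX; sets.
by exists C => //; rewrite /CX; sets.
Qed.

(** Since [C] contains the guts point [x], the two sides have excess at most one over [C]; as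
    [r / C] is 3-connected, one of them has rank at most one there. *)
Lemma small_or X Y x : vsep X Y x -> NM [set x] -> small X Y x \/ small Y X x.
Proof.
case=> [[fX fY] c [xX xY] [rX rY] rXY] [C]; rewrite sub1set => xC EC.
have vC := EMB_VC N3 EC.
pose CX := C :&: X.
have h1 : r (X :|: C) + r CX <= r X + r C by apply: submod; rewrite /CX; sets.
have h2 : r (Y :|: C) + r [set x] <= r Y + r CX by apply: submod; rewrite /CX; sets.
rewrite rank1 // in h2.
have c1 : (X :|: C) :|: (Y :|: C) = setT by sets.
have c' : Y :|: X = setT by sets.
have rYX : r Y + r X = R + 2 by rlia.
have sX : C \subset X :|: C by sets.
have sY : C \subset Y :|: C by sets.
have le : r (X :|: C) + r (Y :|: C) <= R + r C + 1 by rlia.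
have [a1|a1] := leqP (r (X :|: C)) (r C).
  by left; apply: (small_side EC) => //; [rlia|left].
have [b1|b1] := leqP (r (Y :|: C)) (r C).
  by right; apply: (small_side EC) => //; [rlia|left].
case: (vC _ _ 1 isT c1 sX sY le) => h; rewrite addn1 in h.
  by left; apply: (small_side EC) => //; right.
by right; apply: (small_side EC) => //; right.
Qed.

(** * A minimal separation with a side poor in N *)

Section Minimal.
Variables (X Y : {set T}) (x : T).
Hypothesis sepXY : vsep X Y x.
Hypothesis smXY : small X Y x.
Hypothesis no_good : forall z, ~ good [set z].
Hypothesis minXY : forall X' Y' x', vsep X' Y' x' -> small X' Y' x' ->
  #|X' :\: Y'| < #|X :\: Y| -> False.

(** Smallness makes [[set x; e]] N-contractible, so only connectivity can fail at [e]. *)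
Lemma min_sep e : e \in X -> e \notin Y -> exists X2 Y2, vsep X2 Y2 e.
Proof.
have [[fX fY] c [xX xY] [rX rY] rXY] := sepXY.
move=> eX eY; apply: sepP => // ve.
apply: (@no_good e); split=> //.
apply: (@NM_sub _ _ _ _ _ [set x; e]); first by sets.
apply: smXY; rewrite ?inE ?eqxx //; first by sets.
have h := flatU1 fY eY.
have h2 : r (e |: Y) <= r ([set x; e] :|: Y) by apply: rf_mono; sets.
have h3 : r [set x; e] <= 2.
  by rewrite setUC; have := rankU1_le r e [set x]; rewrite rank1.
by rlia.
Qed.

(** Otherwise [X :&: X2] and the closure of [Y :|: Y2] form a separation at [e]: the opposite corner
    [Y :&: Y2] is large enough for 3-connectivity to make the uncrossing exact. The new side is
    again small and has lost [e], against minimality. *)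
Lemma min_uncross e X2 Y2 : e \in X -> e \notin Y -> vsep X2 Y2 e ->
  2 <= r (Y :&: Y2) -> r (X :&: X2) <= 2.
Proof.
have [[fX fY] c [xX xY] [rX rY] rXY] := sepXY.
move=> eX eY [[fX2 fY2] c2 [eX2 eY2] [rX2 rY2] rXY2] hYY.
rewrite leqNgt; apply/negP => hXX.
have h1 : r (X :&: X2) + r (X :|: X2) <= r X + r X2.
  by rewrite addnC; apply: submod; sets.
have h2 : r (Y :|: Y2) + r (Y :&: Y2) <= r Y + r Y2 by apply: submod; sets.
have c3 : (Y :&: Y2) :|: (X :|: X2) = setT by sets.
have h3 : r (Y :&: Y2) <= r Y by apply: rf_mono; sets.
have h4 : r (Y :&: Y2) < R by rlia.
have h5 := VC0_big vc0 c3 hYY h4.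
have sV := sub_cl r (Y :|: Y2); pose V := cl (Y :|: Y2).
have rV : r V = r (Y :|: Y2) by rewrite /V rank_cl.
have c4 : (X :&: X2) :|: V = setT by rewrite /V; sets.
have h6 : r (X :&: X2) <= r X by apply: rf_mono; sets.
have h7 : r (X :&: X2) < R by rlia.
have h8 : 2 <= r (X :&: X2) by rlia.
have h9 := VC0_big vc0 c4 h8 h7.
have eV : e \in V by apply: (subsetP sV); rewrite inE eY2 orbT.
have h10 : r Y <= r V by rewrite rV; apply: rf_mono; sets.
apply: (@minXY (X :&: X2) V e).
- split=> //.
  + by split; [apply: flatI|apply: cl_flat].
  + by rewrite inE eX eX2.
  + by split; [|rlia].
  by rlia.
- move=> J sJ eJ leJ.
  apply: (@NM_sub _ _ _ _ _ (x |: J)); first by sets.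
  apply: smXY; rewrite ?inE ?eqxx //; first by sets.
  have q1 := rankU1_le r x J.
  have q2 : r (J :|: V) + r (e |: Y) <= r ((x |: J) :|: Y) + r V.
    by apply: submod; rewrite /V; sets.
  have q3 := flatU1 fY eY.
  by rlia.
apply: proper_card; apply/properP; split; first by rewrite /V; sets.
by exists e; rewrite !inE ?eX ?eY // eV.
Qed.

(** In rank 3 the complement of [Y] is a rank-3 cocircuit with [x] in its span, and [exists_VC]
    yields a good point. *)
Lemma min_rank4 : 4 <= r X.
Proof.
have [[fX fY] c [xX xY] [rX rY] rXY] := sepXY.
rewrite ltn_neqAle rX andbT; apply/negP => /eqP rX3.
have rY1 : (r Y).+1 = R by rlia.
have R3 : 3 <= R by rlia.
have sC : ~: Y \subset X by sets.
have h := cocirc_rank vc0 fY rY1 R3.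
have rC : r (~: Y) = 3 by have := rf_mono r sC; rlia.
have xP : x \in cl (~: Y).
  by apply: (subsetP (rank_ge_cl sC _)) => //; rewrite rC -rX3.
have [z zY vz] := exists_VC simp vc0 fY rY1 rC xY xP.
apply: (@no_good z); split=> //.
have zX : z \in X by apply: (subsetP sC); rewrite inE.
apply: (@NM_sub _ _ _ _ _ [set x; z]); first by sets.
apply: smXY; rewrite ?inE ?eqxx //; first by sets.
have h1 := flatU1 fY zY.
have h2 : r (z |: Y) <= r ([set x; z] :|: Y) by apply: rf_mono; sets.
have h3 : r [set x; z] <= 2.
  by rewrite setUC; have := rankU1_le r z [set x]; rewrite rank1.
by rlia.
Qed.

(** Some side of the separation at [e] meets [Y] in rank at most 1; otherwise uncrossing both ways
    covers [X] by two sets of rank 2 through [e], against [min_rank4]. That side consists of a line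
    of [X] and the point [q], and the opposite side is the hyperplane. *)
Lemma min_line e : e \in X -> e \notin Y -> exists L q H,
  [/\ [/\ flat L, r L = 2, e \in L & L \subset X], q \in Y /\ q \notin X,
      flat H /\ (r H).+1 = R, ~: H = q |: (L :\ e) & r (~: H) = 3].
Proof.
have [[fX fY] c [xX xY] [rX rY] rXY] := sepXY.
have rX4 := min_rank4.
move=> eX eY; have [X2 [Y2 s2]] := min_sep eX eY.
have half X3 Y3 : vsep X3 Y3 e -> r (Y :&: Y3) <= 1 -> exists L q H,
  [/\ [/\ flat L, r L = 2, e \in L & L \subset X], q \in Y /\ q \notin X,
      flat H /\ (r H).+1 = R, ~: H = q |: (L :\ e) & r (~: H) = 3].
  move=> s3 le1; have [[fX3 fY3] c3 [eX3 eY3] [rX3 rY3] rXY3] := s3.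
  have h1 : r Y <= r (Y :&: X3) + r (Y :&: Y3) by apply: subadd; sets.
  have h2 : 2 <= r (Y :&: X3) by rlia.
  have h3 := min_uncross eX eY (vsepC s3) h2.
  have h4 : r Y3 <= r (X :&: Y3) + r (Y :&: Y3) by apply: subadd; sets.
  have rX1 : (r X3).+1 = R by rlia.
  have R3 : 3 <= R by rlia.
  have h5 := cocirc_rank vc0 fX3 rX1 R3.
  have sC : ~: X3 \subset Y3 by sets.
  have rC : r (~: X3) = 3 by have := rf_mono r sC; rlia.
  have fL : flat (X :&: Y3) by apply: flatI.
  have [q qX3 qL] : exists2 q, q \in ~: X3 & q \notin cl (X :&: Y3).
    by apply: ex_notin; rlia.
  rewrite (flat_cl fL) in qL.
  have qY3 : q \in Y3 by apply: (subsetP sC).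
  have qX : q \notin X by move: qL; rewrite inE qY3 andbT.
  have qY : q \in Y by move/setP/(_ q): c; rewrite !inE (negbTE qX).
  have eL : e \in X :&: Y3 by rewrite inE eX.
  exists (X :&: Y3), q, X3; split=> //; first by split=> //; [rlia|sets].
  apply/eqP; rewrite eqEsubset; apply/andP; split.
    apply/subsetP => u uX3; have uY3 := subsetP sC u uX3.
    have ue : u != e by apply: contraTneq uX3 => ->; rewrite inE eX3.
    rewrite !inE uY3 ue andbT /=.
    have /setP/(_ u) := c; rewrite !inE => /orP[->|uY]; first by rewrite orbT.
    by rewrite (@eq_rank1 _ _ simp (Y :&: Y3) u q) ?eqxx // inE ?uY ?uY3 ?qY.
  apply/subsetP => u; rewrite !inE => /orP[/eqP->|/and3P[ue uX uY3]].
    by rewrite inE in qX3.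
  apply/negP => uX3.
  have LE : cl [set u; e] = X :&: Y3.
    by apply: line_cl => //; rewrite inE uX.
  have sL : X :&: Y3 \subset X3 by rewrite -LE; apply: cl_min => //; sets.
  have : ~: X3 \subset Y :&: Y3 by sets.
  by move/(rf_mono r); rlia.
have [h|h] := leqP (r (Y :&: Y2)) 1; first exact: (half X2 Y2).
have [h'|h'] := leqP (r (Y :&: X2)) 1; first by apply: (half Y2 X2) => //; apply: vsepC.
have [[fX2 fY2] c2 [eX2 eY2] [rX2 rY2] rXY2] := s2.
have q1 := min_uncross eX eY s2 h.
have q2 := min_uncross eX eY (vsepC s2) h'.
have e1 : e \in X :&: X2 by rewrite inE eX.
have e2 : e \in X :&: Y2 by rewrite inE eX.
have := rankU1 simp e1 e2.
have : r X <= r ((X :&: X2) :|: (X :&: Y2)) by apply: rf_mono; sets.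
by rlia.
Qed.

(** The line at [e] is also the line at one of its points [z], so two cocircuits contain [L] without
    [e] and [L] without [z]. Therefore [L] raises the rank of [Y] by 2, which makes [[set z; e]]
    N-contractible. The swap carries this to [q], and three points of [L] show that [q] is not
    centre of a cover, so [q] is good. *)
Lemma min_absurd : False.
Proof.
have [[fX fY] c [xX xY] [rX rY] rXY] := sepXY.
have rX4 := min_rank4.
have [e eX eY] : exists2 e, e \in X & e \notin Y.
  apply/subsetPn; apply/negP => s.
  have : Y = setT by sets.
  by move=> E; move: rXY; rewrite E; rlia.
have [L [q [H [[fL rL eL LX] [qY qX] [fH rH] EH rC]]]] := min_line eX eY.
have rLe : 2 <= r (L :\ e).
  have : r (~: H) <= r [set q] + r (L :\ e) by apply: subadd; rewrite EH.
  by rewrite rC rank1 //; rlia.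
have rYL : r (Y :&: L) < r L by apply: rank_subflat => //; apply/subsetPn; exists e.
have [z zLe zn] : exists2 z, z \in L :\ e & z \notin cl (Y :&: L).
  by apply: ex_notin; rlia.
have /andP[ze zL] : (z != e) && (z \in L) by rewrite !inE in zLe.
have zX : z \in X by apply: (subsetP LX).
have zY : z \notin Y.
  by apply: contra zn => zY; apply: (subsetP (sub_cl r _)); rewrite inE zY.
have [L' [q' [H' [[fL' rL' zL' LX'] [qY' qX'] [fH' rH'] EH' rC']]]] := min_line zX zY.
have zH : z \notin H.
  by have /setP/(_ z) := EH; rewrite !inE zL ze orbT => ->.
have E : L' = L.
  have rLz : 2 <= r (L' :\ z).
    have : r (~: H') <= r [set q'] + r (L' :\ z) by apply: subadd; rewrite EH'.
    by rewrite rC' rank1 //; rlia.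
  have rHL : r (H :&: L') < r L' by apply: rank_subflat => //; apply/subsetPn; exists z.
  have [w wLz wn] : exists2 w, w \in L' :\ z & w \notin cl (H :&: L').
    by apply: ex_notin; rlia.
  have /andP[wz wL'] : (w != z) && (w \in L') by rewrite !inE in wLz.
  have wH : w \in ~: H.
    rewrite inE; apply: contra wn => wH; apply: (subsetP (sub_cl r _)).
    by rewrite inE wH.
  have wX : w \in X by apply: (subsetP LX').
  have wq : w != q by apply: contraNneq qX => <-.
  have wL : w \in L by move: wH; rewrite EH !inE (negbTE wq) => /andP[].
  by apply: (@line_eq _ _ simp _ _ w z); rewrite ?rL ?rL'.
rewrite {}E in fL' rL' zL' LX' EH'.
have eH : e \in H.
  have eq : e != q by apply: contraNneq qX => <-.
  by have /setP/(_ e) := EH; rewrite !inE eqxx (negbTE eq) /= => /negbFE.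
have eH' : e \notin H'.
  have ez : e != z by rewrite eq_sym.
  by have /setP/(_ e) := EH'; rewrite !inE ez eL orbT => ->.
have rYL2 : r Y + 2 <= r (Y :|: L).
  rewrite leqNgt; apply/negP => lt.
  have c1 : (Y :|: L) :|: (X :\: L) = setT by sets.
  have q1 : r (X :\: L) <= r (H' :&: (H :&: X)).
    by apply: rf_mono; sets.
  have q2 : r (H :&: X) < r X.
    by apply: rank_subflat => //; apply/subsetPn; exists z.
  have q3 : r (H' :&: (H :&: X)) < r (H :&: X).
    by apply: rank_subflat => //; apply/subsetPn; exists e; rewrite // inE eH.
  have q4 : r Y <= r (Y :|: L) by apply: rf_mono; sets.
  have q5 : 2 <= r (Y :|: L) by rlia.
  have q6 : r (Y :|: L) < R by rlia.
  by have := VC0_big vc0 c1 q5 q6; rlia.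
have LE : cl [set z; e] = L by apply: line_cl; rewrite ?rL.
have nze : NM [set z; e].
  apply: (@NM_sub _ _ _ _ _ (x |: [set z; e])); first by sets.
  apply: smXY; rewrite ?inE ?eqxx //; first by sets.
  have q1 := rankU1_le r x [set z; e]; rewrite rank2 // in q1.
  have q2 : r (Y :|: L) <= r ((x |: [set z; e]) :|: Y).
    by rewrite -LE setUC rankU_cl; apply: rf_mono; sets.
  by rlia.
have sLe : L :\ e \subset L by sets.
have eP : e \in cl (~: H).
  have h : L \subset cl (L :\ e) by apply: rank_ge_cl => //; rewrite rL.
  have s : L :\ e \subset ~: H by rewrite EH; sets.
  by apply: (subsetP (cl_mono r s)); apply: (subsetP h).
have qH : q \notin H by have /setP/(_ q) := EH; rewrite !inE eqxx => ->.
have nq := swapNM fH rH rC eH eP zH qH nze.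
have scC := sub_cl r (~: H).
apply: (@no_good q); split; last by apply: NM_sub nq; sets.
apply: NNPP => nvq.
have cov := whittle_cov simp vc0 fH rH rC qH nvq.
have [w wLe wn] : exists2 w, w \in L :\ e & w \notin cl [set z].
  by apply: ex_notin; rewrite rank1.
have zw : z != w by rewrite (flat_cl (flat1 simp _)) inE eq_sym in wn.
have /andP[we wL] : (w != e) && (w \in L) by rewrite !inE in wLe.
have sP : L :\ e \subset cl (~: H) by apply: subset_trans scC; rewrite EH; sets.
have qL : q \notin L by apply: contra qX; apply: (subsetP LX).
by apply: (@not_covered _ _ simp _ L q z w e _ _ _ _ _ _ _ _ _ _ _ _ cov);
  rewrite ?rL // (subsetP sP).
Qed.

End Minimal.

Lemma exists_good : NM set0 -> rN setT < R -> exists x, good [set x].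
Proof.
move=> [C _ EC] lt; apply: NNPP => no.
have no_good z : ~ good [set z] by move=> gz; apply: no; exists z.
have [rC _] := EC.
have [x xC _] : exists2 x, x \in C & x \notin cl set0.
  by apply: ex_notin; rewrite rank0; rlia.
have nx : NM [set x] by exists C; rewrite ?sub1set.
have key m : forall X Y z, vsep X Y z -> small X Y z -> #|X :\: Y| < m -> False.
  elim: m => [//|m IH] X Y z s1 s2 cm.
  apply: (min_absurd s1 s2 no_good) => X' Y' z' s1' s2' lt'.
  by apply: (IH X' Y' z') => //; apply: leq_trans lt' _.
have nv : ~ VC [set x] by move=> v; apply: (no_good x).
have [X [Y s]] := sepP simp vc0 nv.
case: (small_or s nx) => h; first exact: (key _ X Y x s h (leqnn _)).
exact: (key _ Y X x (vsepC s) h (leqnn _)).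
Qed.

End Existence.

(** * Good lines and thin lines *)

Section Lines.
Variables (U : finType) (rN : rfun U).
Hypothesis N1 : forall u, rN [set u] = 1.
Variables (T : finType) (r : rfun T).
Implicit Types (X Y Z F G H J K L P Q V W C S : {set T}).
Implicit Types (e f x y z a b c t q w u v : T).
Local Notation R := (r setT).
Local Notation cl := (rcl r).
Local Notation flat := (rflat r).
Local Notation VC := (vconn r).
Local Notation NM := (ncontr rN r).
Local Notation good := (vcontr rN r).
Local Notation vsep := (vert_sep r).
Hypothesis simp : simple_rf r.
Hypothesis vc0 : VC set0.

(** The closure of the good points, described by flats because goodness is a proposition and does
    not define a finite set. *)
Definition gspan X := forall Q, flat Q -> (forall z, good [set z] -> z \in Q) -> X \subset Q.

(* The cocircuit [(L - y) + z] of a carambole, through its hyperplane. *)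
Definition line_spike L y z H :=
  [/\ y \in L, z \notin L, flat H, (r H).+1 = R & ~: H = z |: (L :\ y)].
Local Notation spike := line_spike.

Definition thin L :=
  [/\ [/\ flat L, r L = 2 & good L],
      exists a b c, [/\ [/\ a \in L, b \in L & c \in L], a != b, a != c & b != c],
      forall a b, a \in L -> b \in L -> good [set a] -> good [set b] -> a = b &
      forall y, y \in L -> ~ good [set y] -> exists z H, good [set z] /\ spike L y z H].

Lemma good_sub Z Z' : Z \subset Z' -> NM Z' -> ~ good Z -> ~ VC Z.
Proof. by move=> s nm ng vc; apply: ng; split=> //; apply: NM_sub nm. Qed.

Lemma bad_rank x : ~ VC [set x] -> 4 <= R.
Proof.
move=> /(sepP simp vc0)[X [Y [[fX fY] c [xX xY] [rX rY] rXY]]].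
by have := leT r X; have := leT r Y; rlia.
Qed.

(** [lemA] over [[set y]] bounds the cocircuit together with [y] by rank 3, and 3-connectivity gives
    the cocircuit alone that rank; so it spans [y]. *)
Lemma bad_plane a y : a != y -> VC [set a; y] -> ~ VC [set y] -> exists H,
  [/\ flat H /\ (r H).+1 = R, y \in H, a \notin H, r (~: H) = 3 & y \in cl (~: H)].
Proof.
move=> ay va nvy.
have aY : a \notin cl [set y] by rewrite (flat_cl (flat1 simp _)) inE.
have [H [fH sH aH rH rC]] := lemA aY va nvy.
rewrite sub1set in sH; rewrite rank1 // in rC.
have R4 := bad_rank nvy; have R3 : 3 <= R by rlia.
have h := cocirc_rank vc0 fH rH R3.
have s1 : ~: H \subset [set y] :|: (a |: ~: H) by sets.
have h1 := rf_mono r s1.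
exists H; split=> //; first by rlia.
apply: (subsetP (rank_ge_cl s1 _)); last by rewrite !inE eqxx.
by rlia.
Qed.

Lemma spike_meet L y H : flat L -> r L = 2 -> flat H -> y \in L -> y \in H ->
  ~~ (L \subset H) -> forall u, u \in L -> u \in H -> u = y.
Proof.
move=> fL rL fH yL yH nLH u uL uH; apply/eqP/negPn/negP => uy.
move/negP: nLH; apply; rewrite -(@line_cl _ _ simp L u y) ?rL //.
by apply: cl_min => //; sets.
Qed.

(** The span of the cocircuit from [bad_plane] is covered from [a] by [L] and one line [L2]. Its
    points off [L] are good, as they see three points of [L]. A single such point is the top of a
    spike at [y]. Two of them span [L2], hence [a]; then [b] is good as well, and the good points
    span [L]. *)
Lemma bad_pair L a y : flat L -> r L = 2 -> good L -> a \in L -> y \in L -> a != y ->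
  ~ good [set a] -> ~ good [set y] ->
  (exists b, [/\ b \in L, b != a & b != y]) /\
  ((exists z H, good [set z] /\ spike L y z H) \/
   (gspan L /\ exists2 b, b \in L & good [set b])).
Proof.
move=> fL rL [vL nL] aL yL ay nga ngy.
have rL2 : r L <= 2 by rewrite rL.
have nva : ~ VC [set a] by apply: good_sub nL nga; sets.
have nvy : ~ VC [set y] by apply: good_sub nL ngy; sets.
have LE := line_cl simp fL rL2 ay aL yL.
have va : VC [set a; y] by apply: cl_VC; rewrite LE.
have [H [[fH rH] yH aH rC yP]] := bad_plane ay va nvy.
have scC := sub_cl r (~: H).
have aP : a \in cl (~: H) by apply: (subsetP scC); rewrite inE.
have LP : L \subset cl (~: H).
  by rewrite -LE; apply: cl_min (cl_flat _ _); sets.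
have LH : ~~ (L \subset H) by apply/subsetPn; exists a.
have meet := spike_meet fL rL fH yL yH LH.
have cov := whittle_cov simp vc0 fH rH rC aH nva.
have [L1 [L2 [[f1 f2] [r1 r2] [a1 a2] s y1]]] := coveredW cov yP.
have E1 : L1 = L by apply: (@line_eq _ _ simp _ _ a y).
rewrite {}E1 in s.
have out u : u \notin H -> u \notin L -> u \in L2.
  move=> uH uL; have : u \in cl (~: H) by apply: (subsetP scC); rewrite inE.
  by move/(subsetP s); rewrite inE (negbTE uL).
have [b [bL ba by']] : exists b, [/\ b \in L, b != a & b != y].
  have [/exists_inP[b bL /andP[? ?]]|no] := boolP [exists b in L, (b != a) && (b != y)].
    by exists b.
  have : ~: H \subset L2.
    apply/subsetP => u; rewrite inE => uH.
    have [uL|uL] := boolP (u \in L); last exact: out.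
    have [->//|ua] := eqVneq u a.
    move: no; rewrite negb_exists_in => /forall_inP/(_ u uL).
    by rewrite ua /= negbK => /eqP uy; rewrite uy yH in uH.
  by move/(rf_mono r); rlia.
split; first by exists b.
have nay : NM [set a; y] by apply: NM_sub nL; sets.
have gw w : w \notin H -> w \notin L -> good [set w].
  move=> wH wL; split.
    apply: NNPP => nvw; have cw := whittle_cov simp vc0 fH rH rC wH nvw.
    apply: (@not_covered _ _ simp _ L w a y b _ _ _ _ _ _ _ _ _ _ _ _ cw) => //;
      rewrite 1?eq_sym //; exact: (subsetP LP).
  apply: NM_sub (swapNM N1 simp fH rH rC yH yP aH wH nay); sets.
have [w wH wL] : exists2 w, w \in ~: H & w \notin cl L.
  by apply: ex_notin; rewrite rL rC.
rewrite (flat_cl fL) in wL; rewrite inE in wH.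
have [/existsP[w' /and3P[w'H w'L ww']]|no] :=
    boolP [exists w', [&& w' \notin H, w' \notin L & w' != w]].
  right; have w2 := out _ wH wL; have w'2 := out _ w'H w'L.
  have L2E := line_cl simp f2 r2 ww' w'2 w2.
  have bH : b \notin H by apply: contra by' => bH; rewrite (meet b).
  have gb : good [set b].
    split; last by apply: NM_sub nL; sets.
    apply: NNPP => nvb; have cb := whittle_cov simp vc0 fH rH rC bH nvb.
    have wP : w \in cl (~: H) by apply: (subsetP scC); rewrite inE.
    have w'P : w' \in cl (~: H) by apply: (subsetP scC); rewrite inE.
    have [M1 [M2 [[fM1 fM2] [rM1 rM2] [b1 b2] sM wM1]]] := coveredW cb wP.
    have aM1 : a \notin M1.
      apply/negP => aM1; move: wL.
      by rewrite -(@line_eq _ _ simp M1 L a b) ?wM1 ?rL // eq_sym.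
    have aM2 : a \in M2 by move/(subsetP sM): aP; rewrite inE (negbTE aM1).
    have E2 : M2 = L by apply: (@line_eq _ _ simp _ _ a b) => //; rewrite ?rL // eq_sym.
    have : w' \in M1 by move/(subsetP sM): w'P; rewrite inE E2 (negbTE w'L) orbF.
    move=> w'M1.
    have E3 : M1 = L2 by apply: (@line_eq _ _ simp _ _ w' w).
    by rewrite E3 a2 in aM1.
  split; last by exists b.
  move=> Q fQ hQ; have s2 : L2 \subset Q.
    rewrite -L2E; apply: cl_min => //.
    by rewrite subUset !sub1set !hQ //; apply: gw.
  rewrite -(@line_cl _ _ simp L a b) ?rL // 1?eq_sym //.
  by apply: cl_min => //; rewrite subUset !sub1set (subsetP s2) ?hQ.
left; exists w, H; split; first exact: gw.
split=> //; apply/eqP; rewrite eqEsubset; apply/andP; split.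
  apply/subsetP => u; rewrite !inE => uH.
  have [uL|uL] := boolP (u \in L).
    by apply/orP; right; rewrite andbT; apply: contraNneq uH => ->.
  move: no; rewrite negb_exists => /forallP/(_ u).
  by rewrite uH uL /= negbK => ->.
apply/subsetP => u; rewrite !inE => /orP[/eqP->//|/andP[uy uL]].
by apply: contra uy => uH; rewrite (meet u).
Qed.

(** With no two bad points and at most one good point, [L] is a pair. Otherwise a bad point without
    a spike has a bad partner, and [bad_pair] leaves only the spanned case. *)
Lemma line_cases L : flat L -> r L = 2 -> good L ->
  (forall a b, a \in L -> b \in L -> good [set a] -> good [set b] -> a = b) ->
  thin L \/
  exists2 b, b \in L & good [set b] /\ (gspan L \/ exists a, L \subset [set a; b]).
Proof.
move=> fL rL gL uniq.
have [[a [y [aL yL ay nga ngy]]]|no] := classic (exists a y,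
    [/\ a \in L, y \in L, a != y, ~ good [set a] & ~ good [set y]]); last first.
  right.
  have [u uL _] : exists2 u, u \in L & u \notin cl set0.
    by apply: ex_notin; rewrite rL rank0.
  have [v vL vn] : exists2 v, v \in L & v \notin cl [set u].
    by apply: ex_notin; rewrite rL rank1.
  have uv : u != v by rewrite (flat_cl (flat1 simp _)) inE eq_sym in vn.
  have main p q : p \in L -> q \in L -> p != q -> good [set p] ->
      exists2 b, b \in L & good [set b] /\ (gspan L \/ exists a, L \subset [set a; b]).
    move=> pL qL pq gp; exists p => //; split=> //; right; exists q.
    have nq : ~ good [set q] by move=> gq; rewrite (uniq p q) ?eqxx in pq.
    apply/subsetP => w wL; rewrite !inE.
    have [gw|ngw] := classic (good [set w]); first by rewrite (uniq w p) ?eqxx ?orbT.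
    have [//|wq] := eqVneq w q.
    by case: no; exists w, q.
  have [gu|ngu] := classic (good [set u]); first exact: (main u v).
  have [gv|ngv] := classic (good [set v]); first by apply: (main v u) => //; rewrite eq_sym.
  by case: no; exists u, v.
have [[b [bL ba by']] _] := bad_pair fL rL gL aL yL ay nga ngy.
have [hy|hy] := classic (forall y, y \in L -> ~ good [set y] ->
    exists z H, good [set z] /\ spike L y z H).
  by left; split=> //; exists a, y, b; split=> //; rewrite eq_sym.
right; have [y' hy'] := not_all_ex_not _ _ hy.
have {hy'}[y'L hy'] := imply_to_and _ _ hy'.
have {hy'}[ngy' hy'] := imply_to_and _ _ hy'.
have [a' [a'L ay' nga']] : exists a', [/\ a' \in L, a' != y' & ~ good [set a']].
  have [e|ne] := eqVneq a y'; last by exists a.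
  by exists y; rewrite -e eq_sym.
have [_ []] := bad_pair fL rL gL a'L y'L ay' nga' ngy'; first by [].
by case=> gs [b' b'L gb']; exists b' => //; split=> //; left.
Qed.

Lemma no_good_thin L : flat L -> r L = 2 -> good L ->
  (forall a, a \in L -> ~ good [set a]) -> thin L.
Proof.
move=> fL rL gL no; case: (line_cases fL rL gL) => // [a b aL _ /(no a aL)//|].
by case=> b /no h [/h].
Qed.

Lemma spike_mem L y z H : spike L y z H -> y \in H.
Proof.
case=> yL zL _ _ E; apply/negPn; move/setP/(_ y): E; rewrite !inE eqxx /= orbF => ->.
by apply: contraNneq zL => <-.
Qed.

Lemma spike_out L y z H u : spike L y z H -> u \in L -> u != y -> u \notin H.
Proof.
by case=> yL zL _ _ E uL uy; move/setP/(_ u): E; rewrite !inE uL uy orbT => ->.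
Qed.

Lemma spike_in L y z H u : spike L y z H -> u \notin L -> u != z -> u \in H.
Proof.
case=> yL zL _ _ E uL uz; move/setP/(_ u): E.
by rewrite !inE (negbTE uL) (negbTE uz) andbF => /negbFE.
Qed.

Lemma spike_top L y z H : spike L y z H -> z \notin H.
Proof. by case=> yL zL _ _ E; move/setP/(_ z): E; rewrite !inE eqxx => ->. Qed.

(** All the rest lies in both hyperplanes, so in rank at most [R - 2]; 3-connectivity then asks for
    rank 4 here. *)
Lemma spike2 L y1 y2 z1 z2 H1 H2 : flat L -> r L = 2 -> 4 <= R -> y1 != y2 ->
  spike L y1 z1 H1 -> spike L y2 z2 H2 -> r (z1 |: (z2 |: L)) = 4.
Proof.
move=> fL rL R4 y12 s1 s2.
have [y1L z1L fH1 rH1 E1] := s1; have [y2L z2L fH2 rH2 E2] := s2.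
have h1 := rankU1_le r z2 L; have h2 := rankU1_le r z1 (z2 |: L).
have : 4 <= r (z1 |: (z2 |: L)); last by rlia.
rewrite leqNgt; apply/negP => lt.
have c : (z1 |: (z2 |: L)) :|: ~: (z1 |: (z2 |: L)) = setT by sets.
have q1 : r (~: (z1 |: (z2 |: L))) <= r (H2 :&: H1).
  by apply: rf_mono; sets.
have q2 : r (H2 :&: H1) < r H1.
  apply: rank_subflat => //; apply/subsetPn; exists y1; first exact: spike_mem s1.
  exact: (spike_out s2).
have q3 : r L <= r (z1 |: (z2 |: L)) by apply: rf_mono; sets.
have q4 : 2 <= r (z1 |: (z2 |: L)) by rlia.
have q5 : r (z1 |: (z2 |: L)) < R by rlia.
by have := VC0_big vc0 c q4 q5; rlia.
Qed.

Lemma spike2_neq L y1 y2 z1 z2 H1 H2 : flat L -> r L = 2 -> 4 <= R -> y1 != y2 ->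
  spike L y1 z1 H1 -> spike L y2 z2 H2 -> z1 != z2.
Proof.
move=> fL rL R4 y12 s1 s2; have h := spike2 fL rL R4 y12 s1 s2.
apply/eqP => e; move: h; rewrite e setUA setUid.
by have := rankU1_le r z2 L; rlia.
Qed.

Lemma thin_rank L : thin L -> 4 <= R.
Proof.
case=> [[fL rL gL] [a [b [c [[aL bL cL] ab ac bc]]]] uniq _].
have [ga|nga] := classic (good [set a]).
  have ngb : ~ good [set b] by move=> gb; rewrite (uniq a b) ?eqxx in ab.
  by apply: (@bad_rank b); apply: good_sub gL.2 ngb; sets.
by apply: (@bad_rank a); apply: good_sub gL.2 nga; sets.
Qed.

Lemma thin_bad2 L : thin L -> exists y1 y2 b,
  [/\ [/\ y1 \in L, y2 \in L & b \in L], [/\ y1 != y2, b != y1 & b != y2],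
      ~ good [set y1] & ~ good [set y2]].
Proof.
case=> [[fL rL gL] [a [b [c [[aL bL cL] ab ac bc]]]] uniq _].
have bad u v : u \in L -> v \in L -> u != v -> good [set u] -> ~ good [set v].
  by move=> uL vL uv gu gv; rewrite (uniq u v) ?eqxx in uv.
have [ga|nga] := classic (good [set a]).
  by exists b, c, a; split=> //; apply: (bad a).
have [gb|ngb] := classic (good [set b]).
  exists a, c, b; split=> //; first by rewrite ac (eq_sym b a) ab bc.
  exact: (bad b).
by exists a, b, c; rewrite ab (eq_sym c a) ac (eq_sym c b) bc.
Qed.

(** Tops of spikes are good. If [b] is good, its collinearity with two tops contradicts [spike2]. If
    [b] is bad it has a top too; were the three tops collinear, all that is off them and off [L]
    would lie in three hyperplanes, and adding [L] would still give rank at most [R - 1], too little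
    against a line. *)
Lemma thin_three L : thin L -> exists a b c,
  [/\ good [set a], good [set b], good [set c] & r (a |: [set b; c]) = 3].
Proof.
move=> tL; have R4 := thin_rank tL.
have [y1 [y2 [b [[y1L y2L bL] [y12 by1 by2] ng1 ng2]]]] := thin_bad2 tL.
have [[fL rL gL] _ _ sp] := tL.
have [z1 [H1 [gz1 s1]]] := sp _ y1L ng1.
have [z2 [H2 [gz2 s2]]] := sp _ y2L ng2.
have z12 := spike2_neq fL rL R4 y12 s1 s2.
have up u : r (u |: [set z1; z2]) <= 3.
  by have := rankU1_le r u [set z1; z2]; rewrite rank2.
have [gb|ngb] := classic (good [set b]).
  exists b, z1, z2; split=> //.
  have h := spike2 fL rL R4 y12 s1 s2.
  have h1 : r (z1 |: (z2 |: L)) + r [set b] <= r L + r (b |: [set z1; z2]).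
    by apply: submod; sets.
  by have := up b; rewrite rank1 // in h1; rlia.
have [z3 [H3 [gz3 s3]]] := sp _ bL ngb.
have z31 := spike2_neq fL rL R4 by1 s3 s1.
have z32 := spike2_neq fL rL R4 by2 s3 s2.
have [_ z1L fH1 rH1 E1] := s1; have [_ z2L fH2 rH2 E2] := s2.
have [_ z3L fH3 rH3 E3] := s3.
exists z3, z1, z2; split=> //.
have : 3 <= r (z3 |: [set z1; z2]); last by have := up z3; rlia.
rewrite leqNgt; apply/negP => lt.
set S := z3 |: [set z1; z2] in lt.
have q1 : r (~: (S :|: L)) <= r (H3 :&: (H2 :&: H1)).
  by apply: rf_mono; rewrite /S; clear - E1 E2 E3; sets.
have q2 : r (H2 :&: H1) < r H1.
  apply: rank_subflat => //; apply/subsetPn; exists y1; first exact: spike_mem s1.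
  exact: (spike_out s2).
have q3 : r (H3 :&: (H2 :&: H1)) < r (H2 :&: H1).
  apply: rank_subflat => //; apply/subsetPn; exists z3; last exact: spike_top s3.
  by rewrite inE (spike_in s1) // (spike_in s2).
have q4 : r (~: (S :|: L) :|: L) <= r (~: (S :|: L)) + r L by apply: subadd.
have c : S :|: (~: (S :|: L) :|: L) = setT by sets.
have q5 : r [set z1; z2] <= r S by apply: rf_mono; rewrite /S; sets.
rewrite rank2 // in q5.
have q6 : r S < R by rlia.
by have := VC0_big vc0 c q5 q6; rlia.
Qed.

(** If [y] is bad and outside [Q], the swap lemmas turn each point [a] of the cocircuit from
    [bad_plane] into a good line through [y]. This line has at most one good point, since two would
    put [y] in [Q], and it is not thin, so [line_cases] makes [a] good. Then [Q] contains the
    cocircuit, which spans [y]. *)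
Lemma lift_point x y : (forall L, ~ thin L) -> x != y -> good [set x; y] ->
  gspan [set y].
Proof.
move=> nt xy [vxy nxy] Q fQ hQ; rewrite sub1set.
have [gy|ngy] := classic (good [set y]); first exact: hQ.
have nvy : ~ VC [set y] by apply: good_sub nxy ngy; sets.
have [H [[fH rH] yH xH rC yP]] := bad_plane xy vxy nvy.
apply/negPn/negP => yQ.
have : ~: H \subset Q.
  apply/subsetP => a; rewrite inE => aH.
  have [ga|nga] := classic (good [set a]); first exact: hQ.
  have ay : a != y by apply: contraNneq aH => ->.
  have gL : good (cl [set a; y]).
    split; first by apply: VC_cl; apply: (swapVC simp vc0 fH rH rC yH yP xH aH vxy).
    by apply: NM_cl; apply: (swapNM N1 simp fH rH rC yH yP xH aH nxy).
  have fL := cl_flat r [set a; y].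
  have rL : r (cl [set a; y]) = 2 by rewrite rank_cl rank2.
  have aL := mem_cll r a y; have yL := mem_clr r a y.
  have uniq u v : u \in cl [set a; y] -> v \in cl [set a; y] ->
      good [set u] -> good [set v] -> u = v.
    move=> uL vL gu gv; apply/eqP/negPn/negP => uv; move/negP: yQ; apply.
    have E := line_cl simp fL _ uv uL vL; rewrite rL in E.
    move: yL; rewrite -E //; apply: (subsetP (cl_min _ fQ)).
    by rewrite subUset !sub1set !hQ.
  case: (line_cases fL rL gL uniq) => [/nt//|[b bL [gb [gs|[a' s]]]]].
    by rewrite (subsetP (gs Q fQ hQ) _ yL) in yQ.
  have := subsetP s a aL; have := subsetP s y yL; rewrite !inE.
  case/orP=> /eqP e1; case/orP=> /eqP e2.
  - by rewrite e1 e2 eqxx in ay.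
  - by rewrite e2 in nga.
  - by rewrite e1 in ngy.
  by rewrite e1 e2 eqxx in ay.
by move=> s; move/negP: yQ; apply; apply: (subsetP (cl_min s fQ)).
Qed.

End Lines.

(** * Filaments of the contraction of a point *)

Section Planes.
Variables (U : finType) (rN : rfun U).
Variables (T : finType) (r : rfun T).
Implicit Types (X Y Z F G K L P Q V W C S m B : {set T}).
Implicit Types (e f x z a b c t q w u v : T).
Local Notation R := (r setT).
Local Notation cl := (rcl r).
Local Notation flat := (rflat r).
Local Notation VC := (vconn r).
Local Notation NM := (ncontr rN r).
Local Notation good := (vcontr rN r).
Local Notation vsep := (vert_sep r).
Local Notation covered := (two_lines r).
Hypothesis simp : simple_rf r.
Hypothesis vc0 : VC set0.

(* Trace in [r] of three of the cocircuits of a carambole of [r / B] with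
   filament [G / B]: [H i] is the complementary hyperplane, [y i] the point of
   the filament it avoids and [p i] its point outside the filament. *)
Definition hub B G (y p : 'I_3 -> T) (H : 'I_3 -> {set T}) : Prop :=
  [/\ [/\ flat G, B \subset G & r G = r B + 2],
      forall i, [/\ flat (H i), (r (H i)).+1 = R, B \subset H i, y i \in H i & y i \in G],
      forall i j, i != j -> y j \notin H i,
      forall i e, e \notin H i -> e \in G \/ e \in cl (p i |: B) &
      forall i j, i != j -> r (p i |: (p j |: G)) = r B + 4].

Lemma ord3_pick (P : pred 'I_3) : (forall i j, i != j -> ~~ (P i && P j)) ->
  exists i j, [/\ i != j, ~~ P i & ~~ P j].
Proof.
move=> h.
have [p0|p0] := boolP (P (inord 0)).
  exists (inord 1), (inord 2).
  have n1 : (inord 0 : 'I_3) != inord 1 by rewrite -val_eqE /= !inordK.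
  have n2 : (inord 0 : 'I_3) != inord 2 by rewrite -val_eqE /= !inordK.
  have := h _ _ n1; have := h _ _ n2; rewrite p0 /= => -> ->.
  by rewrite -val_eqE /= !inordK.
have [p1|p1] := boolP (P (inord 1)).
  exists (inord 0), (inord 2).
  have n2 : (inord 1 : 'I_3) != inord 2 by rewrite -val_eqE /= !inordK.
  have := h _ _ n2; rewrite p1 /= => ->.
  by rewrite -val_eqE /= !inordK.
by exists (inord 0), (inord 1); rewrite -val_eqE /= !inordK.
Qed.

(** At most one [p i] lies in [X], since two of them with [G] have too large a rank; this is why a
    hub keeps three cocircuits. The other two hyperplanes contain [X :\: G], and each lowers the
    rank of [X]. *)
Lemma hub_color B G y p H X : hub B G y p H -> flat X -> G \subset X ->
  r X = (r G).+1 -> (r (B :|: (X :\: G))).+2 <= r X.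
Proof.
move=> [[fG BG rG] hH yH hp pp] fX GX rX.
have [i [j [ij pi pj]]] : exists i j, [/\ i != j, p i \notin X & p j \notin X].
  apply: (@ord3_pick (fun i => p i \in X)) => i j ij.
  apply/negP => /andP[pi pj]; have := pp i j ij.
  have s : p i |: (p j |: G) \subset X by sets.
  by have := rf_mono r s; rlia.
have clB : cl B \subset G by apply: cl_min.
have key k : p k \notin X -> X :\: G \subset H k.
  move=> pk; apply/subsetP => e; rewrite inE => /andP[eG eX].
  apply/negPn/negP => /hp[h|h]; first by rewrite h in eG.
  have eB : e \notin cl B by apply: contra eG; apply: (subsetP clB).
  move/negP: pk; apply; apply: (subsetP (cl_min _ fX)) (clU1_exch h eB).
  by rewrite subUset sub1set eX (subset_trans BG).
have [fi ri Bi yi yiG] := hH i; have [fj rj Bj yj yjG] := hH j.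
have ki := key i pi; have kj := key j pj.
have s : B :|: (X :\: G) \subset H j :&: (H i :&: X) by sets.
have h1 := rf_mono r s.
have h2 : r (H i :&: X) < r X.
  apply: rank_subflat => //; apply/subsetPn; exists (y j); last exact: yH.
  exact: (subsetP GX).
have h3 : r (H j :&: (H i :&: X)) < r (H i :&: X).
  apply: rank_subflat => //; apply/subsetPn; exists (y i).
    by rewrite inE yi (subsetP GX).
  by apply: yH; rewrite eq_sym.
by rlia.
Qed.

(** The cover by [X] and [G :|: Y] has excess at most one over [G], and [G :|: Y] is too large to be
    its small side; hence [X] is. *)
Lemma plane_sep G X Y t : VC G -> flat G -> r G = 3 -> vsep X Y t -> t \in G ->
  G \subset X -> ~~ (G \subset Y) /\ (r X = 3 \/ r X = 4 /\ r (G :|: Y) = R).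
Proof.
move=> vG fG rG [[fX fY] c [tX tY] [rX rY] rXY] tG GX.
have h1 : R + r (X :&: Y) <= r X + r Y by apply: submod; sets.
have nGY : ~~ (G \subset Y).
  apply/negP => GY; have s : G \subset X :&: Y by sets.
  by have := rf_mono r s; rlia.
split=> //.
have c1 : X :|: (G :|: Y) = setT by sets.
have sG : G \subset G :|: Y by sets.
have h2 : r (G :|: Y) + r [set t] <= r G + r Y by apply: submod; sets.
rewrite rank1 // in h2.
have h3 : r (Y :&: G) < r G by apply: rank_subflat.
have h4 : (r Y).+1 <= r (G :|: Y).
  have [e eG eY] := subsetPn nGY.
  by rewrite -(flatU1 fY eY); apply: rf_mono; sets.
have le1 : r X + r (G :|: Y) <= R + r G + 1 by rlia.
have h5 := vG _ _ 1 isT c1 GX sG le1.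
have h6 : r X + r (G :|: Y) <= R + r G + 0 -> r X <= r G + 0 \/ r (G :|: Y) <= r G + 0.
  by apply: vG.
have h7 := leT r (G :|: Y).
have [l3|l3] := leqP (r X) 3; first by left; rlia.
right.
have [l4|l4] := leqP (r X + r (G :|: Y)) (R + r G + 0).
  by case: (h6 l4); rlia.
by case: h5; rlia.
Qed.

Lemma uncovered_side G X Y t : vsep X Y t -> flat G -> r G = 3 -> t \in G ->
  ~ covered G t -> G \subset X \/ G \subset Y.
Proof.
move=> [[fX fY] c [tX tY] _ _] fG rG tG nc.
have [|h1] := boolP (G \subset X); first by left.
have [|h2] := boolP (G \subset Y); first by right.
have q1 := rank_subflat fX h1; have q2 := rank_subflat fY h2.
case: nc; exists (X :&: G), (Y :&: G); split.
- by split; apply: flatI.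
- by split; rlia.
- by rewrite !inE tX tY tG.
by sets.
Qed.

(** * A plane over a point [x] without further good points or good lines off [x] *)

Section Prism.
Variables (x : T) (G : {set T}) (y p : 'I_3 -> T) (H : 'I_3 -> {set T}).
Hypothesis hubG : hub [set x] G y p H.
Hypothesis gG : good G.
Hypothesis no_pt : forall z, z \in G -> z != x -> ~ good [set z].
Hypothesis no_line : forall m, flat m -> r m = 2 -> m \subset G -> x \notin m -> ~ good m.

Hypothesis fG : flat G.
Hypothesis xG : x \in G.
Hypothesis rG : r G = 3.

Lemma pt_covered z Y : z \in G -> z != x -> flat Y -> (r Y).+1 = R -> ~: Y \subset G ->
  z \notin Y -> covered G z.
Proof.
move=> zG zx fY rY sY zY.
have R3 : 3 <= R by rewrite -rG leT.
have h := cocirc_rank vc0 fY rY R3.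
have rC : r (~: Y) = 3 by have := rf_mono r sY; rlia.
have -> : G = cl (~: Y).
  apply/eqP; rewrite eqEsubset (cl_min sY fG) andbT.
  by apply: rank_ge_cl => //; rewrite rG rC.
apply: (whittle_cov simp) => // vz; apply: (no_pt zG zx); split=> //.
by apply: NM_sub gG.2; rewrite sub1set.
Qed.

(** Two cocircuit points other than [x] are bad, so [G] is their line plus one point [q] of the
    cocircuit. Being outside the cocircuit, [t] is on that line, which together with the join of [t]
    and [q] covers [G]. *)
Lemma inner_cocircuit t Y : t \in G -> t \in Y -> ~ covered G t -> flat Y ->
  (r Y).+1 = R -> ~: Y \subset G -> False.
Proof.
move=> tG tY nc fY rY sY.
have R3 : 3 <= R by rewrite -rG leT.
have h := cocirc_rank vc0 fY rY R3.
have [z1 z1Y z1n] : exists2 z, z \in ~: Y & z \notin cl [set x].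
  by apply: ex_notin; rewrite rank1 //; rlia.
have z1x : z1 != x by rewrite (flat_cl (flat1 simp _)) inE in z1n.
have [z2 z2Y z2n] : exists2 z, z \in ~: Y & z \notin cl [set x; z1].
  by apply: ex_notin; rewrite rank2 // eq_sym.
have z2x : z2 != x by apply: contraNneq z2n => ->; apply: mem_cll.
have z12 : z1 != z2 by apply: contraNneq z2n => <-; apply: mem_clr.
have z1G := subsetP sY _ z1Y; have z2G := subsetP sY _ z2Y.
have c1 : covered G z1 by apply: (pt_covered z1G z1x fY rY sY); rewrite inE in z1Y.
have c2 : covered G z2 by apply: (pt_covered z2G z2x fY rY sY); rewrite inE in z2Y.
have rG3 : 3 <= r G by rewrite rG.
have [q [qG qn sG]] := cov_pair simp z12 z1G z2G rG3 c1 c2.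
have [w wY wn] : exists2 w, w \in ~: Y & w \notin cl [set z1; z2].
  by apply: ex_notin; rewrite rank2.
have wq : w = q.
  have := subsetP sG w (subsetP sY w wY).
  by rewrite !inE (negbTE wn) orbF => /eqP.
rewrite {w}wq inE in wY wn.
have tq : t != q by apply: contraNneq wY => <-.
have tm : t \in cl [set z1; z2].
  by have := subsetP sG t tG; rewrite !inE (negbTE tq).
apply: nc; exists (cl [set z1; z2]), (cl [set t; q]); split.
- by split; apply: cl_flat.
- by split; rewrite rank_cl rank2.
- by rewrite tm mem_cll.
apply: (subset_trans sG); rewrite setUC.
by apply: setUS; rewrite sub1set mem_clr.
Qed.

(** Adding [x] to the bad line [m] spans the good plane [G], which is the situation of [lemA]; the
    bound 4 is [r m + 2]. *)
Lemma line_cut m : flat m -> r m = 2 -> m \subset G -> x \notin m -> exists K,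
  [/\ flat K /\ (r K).+1 = R, m \subset K, x \notin K & r (G :|: ~: K) <= 4].
Proof.
move=> fm rm sm xm.
have GE : cl (x |: m) = G.
  apply/eqP; rewrite eqEsubset cl_min //=; last by sets.
  apply: rank_ge_cl; first by sets.
  by rewrite (flatU1 fm xm) rm rG.
have xm' : x \notin cl m by rewrite flat_cl.
have vm : VC (x |: m) by apply: cl_VC; rewrite GE; apply: gG.1.
have nvm : ~ VC m.
  by move=> v; apply: (no_line fm rm sm xm); split=> //; apply: NM_sub gG.2.
have [K [fK sK xK rK le]] := lemA xm' vm nvm.
exists K; split=> //.
have -> : r (G :|: ~: K) = r ((x |: m) :|: ~: K) by rewrite -GE rankU_cl.
have -> : (x |: m) :|: ~: K = m :|: (x |: ~: K) by sets.
by rewrite rm in le.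
Qed.

Lemma color_line K : r (G :|: ~: K) <= 4 -> r ([set x] :|: (~: K :\: G)) <= 2.
Proof.
move=> le; have [s|/subsetPn[e eK eG]] := boolP (~: K \subset G).
  by have -> : [set x] :|: (~: K :\: G) = [set x]; [sets|rewrite rank1].
have h1 : r (e |: G) <= r (G :|: ~: K) by apply: rf_mono; sets.
have rX : r (cl (G :|: ~: K)) = (r G).+1.
  by rewrite rank_cl; rewrite (flatU1 fG eG) rG in h1; rewrite rG; rlia.
have sX := sub_cl r (G :|: ~: K).
have GX : G \subset cl (G :|: ~: K) by sets.
have h := hub_color hubG (cl_flat _ _) GX rX.
rewrite rX rG in h.
have : r ([set x] :|: (~: K :\: G)) <= r ([set x] :|: (cl (G :|: ~: K) :\: G)).
  by apply: rf_mono; sets.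
by rlia.
Qed.

(** Otherwise the cocircuit from [line_cut] has no point of [G] except [x], and [color_line] gives
    it rank at most 2. *)
Lemma not_near_pencil m : flat m -> r m = 2 -> m \subset G -> x \notin m ->
  ~~ (G \subset x |: m).
Proof.
move=> fm rm sm xm; apply/negP => sG.
have [K [[fK rK] mK xK le]] := line_cut fm rm sm xm.
have R3 : 3 <= R by rewrite -rG leT.
have h := cocirc_rank vc0 fK rK R3.
have h2 := color_line le.
have : r (~: K) <= r ([set x] :|: (~: K :\: G)) by apply: rf_mono; sets.
by rlia.
Qed.

Lemma hub_noncol i j : i != j -> y j \notin cl [set x; y i].
Proof.
move=> ij; have [_ hH yH _ _] := hubG.
have [fi _ xi yi _] := hH i; rewrite sub1set in xi.
apply: contra (yH i j ij); apply: (subsetP (cl_min _ fi)).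
by rewrite subUset !sub1set xi.
Qed.

Lemma hub_neqx i : y i != x.
Proof.
have [_ hH yH _ _] := hubG.
have [j ij] : exists j : 'I_3, j != i.
  have [e|ne] := eqVneq (inord 0) i; last by exists (inord 0).
  by exists (inord 1); rewrite -e -val_eqE /= !inordK.
have [_ _ xj _ _] := hH j; rewrite sub1set in xj.
by apply: contraNneq (yH j i ij) => ->.
Qed.

Lemma hub_neq i j : i != j -> y i != y j.
Proof.
by move=> ij; apply: contraNneq (hub_noncol ij) => <-; apply: mem_clr.
Qed.

Lemma hub_inG i : y i \in G.
Proof. by have [_ hH _ _ _] := hubG; case: (hH i). Qed.

(** If two hub points are centres of covers, the covers share the line [M2] joining them. A point
    off [M2] lies on the joins of [x] with both hub points, hence is [x], and [G] is a near
    pencil. *)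
Lemma ex_uncovered : exists z, [/\ z \in G, z != x & ~ covered G z].
Proof.
apply: NNPP => no.
have cov i : covered G (y i).
  by apply: NNPP => h; apply: no; exists (y i); rewrite hub_inG hub_neqx.
pose i0 : 'I_3 := inord 0; pose i1 : 'I_3 := inord 1; pose i2 : 'I_3 := inord 2.
have n01 : i0 != i1 by rewrite -val_eqE /= !inordK.
have n02 : i0 != i2 by rewrite -val_eqE /= !inordK.
have n12 : i1 != i2 by rewrite -val_eqE /= !inordK.
have n10 : i1 != i0 by rewrite eq_sym.
have [M1 [M2 [[f1 f2] [r1 r2] [a1 a2] s xM]]] := coveredW (cov i0) xG.
have [M1' [M2' [[f1' f2'] [r1' r2'] [a1' a2'] s' xM']]] := coveredW (cov i1) xG.
have x0 : x != y i0 by rewrite eq_sym hub_neqx.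
have x1 : x != y i1 by rewrite eq_sym hub_neqx.
have E1 := line_cl simp f1 r1 x0 xM a1.
have E1' := line_cl simp f1' r1' x1 xM' a1'.
have y1M : y i1 \in M2.
  have := subsetP s _ (hub_inG i1); rewrite inE -E1.
  by rewrite (negbTE (hub_noncol n01)).
have y0M' : y i0 \in M2'.
  have := subsetP s' _ (hub_inG i0); rewrite inE -E1'.
  by rewrite (negbTE (hub_noncol n10)).
have E2 : M2' = M2 by apply: (@line_eq _ _ simp _ _ (y i0) (y i1)) => //; apply: hub_neq.
have xM2 : x \notin M2.
  apply/negP => h; have := hub_noncol n01.
  by rewrite (line_cl simp f2 r2 x0 h a2) y1M.
have rM2 : r M2 = 2.
  have : r [set y i0; y i1] <= r M2 by apply: rf_mono; sets.
  by rewrite rank2 ?hub_neq //; rlia.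
have sM : M2 \subset G.
  rewrite -(line_cl simp f2 r2 (hub_neq n01) a2 y1M); apply: cl_min => //.
  by rewrite subUset !sub1set !hub_inG.
move/negP: (not_near_pencil f2 rM2 sM xM2); apply.
apply/subsetP => u uG; rewrite !inE.
have [//|ux /=] := eqVneq u x.
apply/negPn/negP => uM.
have u1 : u \in M1 by move/(subsetP s): uG; rewrite inE (negbTE uM) orbF.
have u1' : u \in M1' by move/(subsetP s'): uG; rewrite inE E2 (negbTE uM) orbF.
have E : M1 = M1' by apply: (@line_eq _ _ simp _ _ u x).
by have := hub_noncol n01; rewrite E1 E a1'.
Qed.

(** Two hub points off the line of [x] and [t] span a line missing [x]. If it contains [t], a point
    [w] off both lines exists because [t] is uncovered, and joining [w] to one of the two hub points
    avoids [x] and [t]. *)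
Lemma ex_line_avoiding t : t \in G -> t != x -> ~ covered G t -> exists m,
  [/\ flat m, r m = 2, m \subset G, x \notin m & t \notin m].
Proof.
move=> tG tx nc.
have xt : x != t by rewrite eq_sym.
have fl := cl_flat r [set x; t].
have rl : r (cl [set x; t]) <= 2 by rewrite rank_cl rank2.
have xl := mem_cll r x t; have tl := mem_clr r x t.
have [i [j [ij yi yj]]] : exists i j,
    [/\ i != j, y i \notin cl [set x; t] & y j \notin cl [set x; t]].
  apply: (@ord3_pick (fun i => y i \in cl [set x; t])) => i j ij.
  apply/negP => /andP[yi yj]; have := hub_noncol ij.
  by rewrite (line_cl simp fl rl _ xl yi) ?yj // eq_sym hub_neqx.
have yij := hub_neq ij.
have good_line a b : a != b -> a \in G -> b \in G ->
    [/\ flat (cl [set a; b]), r (cl [set a; b]) = 2 & cl [set a; b] \subset G].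
  move=> ab aG bG; split; [exact: cl_flat|by rewrite rank_cl rank2|].
  by apply: cl_min => //; rewrite subUset !sub1set aG.
have [fm rm sm] := good_line _ _ yij (hub_inG i) (hub_inG j).
set m := cl [set y i; y j] in fm rm sm.
have yim : y i \in m := mem_cll _ _ _; have yjm : y j \in m := mem_clr _ _ _.
have xm : x \notin m.
  apply/negP => xm; have := hub_noncol ij.
  by rewrite (line_cl simp fm _ _ xm yim) ?rm ?yjm // eq_sym hub_neqx.
have [tm|tm] := boolP (t \in m); last by exists m.
have [w wG] : exists2 w, w \in G & w \notin m :|: cl [set x; t].
  apply/subsetPn; apply/negP => s; apply: nc.
  by exists m, (cl [set x; t]); rewrite rm.
rewrite inE negb_or => /andP[wm wl].
have wx : w != x by apply: contraNneq wl => ->.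
have [c [cm cl' xc]] : exists c, [/\ c \in m, c \notin cl [set x; t] &
    x \notin cl [set w; c]].
  have [xi|xi] := boolP (x \in cl [set w; y i]); last by exists (y i).
  exists (y j); split=> //; apply/negP => xj.
  have wi : w != y i by apply: contraNneq wm => ->.
  have wj : w != y j by apply: contraNneq wm => ->.
  have Ei := line_cl simp (cl_flat r [set w; y i]) _ wx (mem_cll _ _ _) xi.
  have Ej := line_cl simp (cl_flat r [set w; y j]) _ wx (mem_cll _ _ _) xj.
  rewrite !rank_cl !rank2 // in Ei Ej.
  have yiw : y i \in cl [set w; x] by rewrite Ei ?mem_clr.
  have yjw : y j \in cl [set w; x] by rewrite Ej ?mem_clr.
  have := hub_noncol ij.
  rewrite (line_cl simp (cl_flat r [set w; x]) _ _ (mem_clr _ _ _) yiw) ?yjw //.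
    by rewrite rank_cl rank2.
  by rewrite eq_sym hub_neqx.
have wc : w != c by apply: contraNneq wm => ->.
have cG := subsetP sm c cm.
have [fn rn sn] := good_line _ _ wc wG cG.
exists (cl [set w; c]); split=> //; apply/negP => tn.
have ct : c != t by apply: contraNneq cl' => ->.
move/negP: wm; apply.
rewrite (@line_eq _ _ simp m (cl [set w; c]) c t) ?rm ?rn ?mem_clr //.
exact: mem_cll.
Qed.

(** One side [X] of the separation at an uncovered [t] contains [G]. In rank 3 the cocircuit
    opposite to [Y] lies in [G]. In rank 4 the part of [X] off [G] is shown to have rank at most 1;
    moving it to [Y] again leaves a cocircuit inside [G]. *)
Lemma prism_absurd : False.
Proof.
have [t [tG tx nc]] := ex_uncovered.
have nvt : ~ VC [set t].
  apply: (good_sub _ gG.2 (no_pt tG tx)); first by rewrite sub1set.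
have [X0 [Y0 s0]] := sepP simp vc0 nvt.
have main X Y : vsep X Y t -> G \subset X -> False.
  move=> s GX; have [[fX fY] c [tX tY] [rX rY] rXY] := s.
  have [nGY] := plane_sep gG.1 fG rG s tG GX.
  case=> [rX3|[rX4 rGY]].
    have XG : X \subset G by apply: (flat_rank_sub fG GX); rewrite rX3 rG.
    apply: (@inner_cocircuit t Y) => //; [rlia|sets].
  have [m [fm rm sm xm tm]] := ex_line_avoiding tG tx nc.
  have [K [[fK rK] mK xK le]] := line_cut fm rm sm xm.
  have tK : t \notin K.
    apply/negP => tK; move/negP: xK; apply.
    have stm : t |: m \subset G by sets.
    have h : G \subset cl (t |: m).
      by apply: rank_ge_cl => //; rewrite (flatU1 fm tm) rm rG.
    have sK : t |: m \subset K by sets.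
    exact: (subsetP (cl_min sK fK)) (subsetP h x xG).
  have cXY : X :|: (Y :\: X) = setT by sets.
  have b1 : 2 <= r X by rlia.
  have b2 : r X < R by rlia.
  have b3 := VC0_big vc0 cXY b1 b2.
  have sYX : Y :\: X \subset Y by sets.
  have tYX : t \in cl (Y :\: X).
    by apply: (subsetP (rank_ge_cl sYX _)) => //; rlia.
  have [u uYX uK] : exists2 u, u \in Y :\: X & u \notin K.
    apply/subsetPn; apply/negP => h; move/negP: tK; apply.
    exact: (subsetP (cl_min h fK)).
  have /andP[uX uY] : (u \notin X) && (u \in Y) by rewrite inE in uYX.
  (* A point of [X] outside [G] and [K] would span, with [G], the complement of [K] and hence [u],
     which is not in [X]. *)
  have XK : X :\: G \subset K.
    apply/subsetP => v; rewrite inE => /andP[vG vX].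
    apply/negPn/negP => vK; move/negP: uX; apply.
    have XE : X \subset cl (v |: G).
      apply: rank_ge_cl; first by sets.
      by rewrite (flatU1 fG vG) rG rX4.
    have svG : v |: G \subset G :|: ~: K by sets.
    have h : cl (G :|: ~: K) \subset cl (v |: G).
      apply: cl_sub; apply: rank_ge_cl => //.
      by rewrite (flatU1 fG vG) rG.
    have svX : v |: G \subset X by sets.
    have h2 := subset_trans h (cl_min svX fX).
    apply: (subsetP h2); apply: (subsetP (sub_cl r _)).
    by rewrite !inE uK orbT.
  have col := hub_color hubG fX GX; rewrite rX4 rG in col.
  have {}col : r ([set x] :|: (X :\: G)) <= 2 by have := col erefl; rlia.
  (* Rank 2 would make this part of [K] span [x], which is outside [K]. *)
  have rXG : r (X :\: G) <= 1.
    rewrite leqNgt; apply/negP => gt; move/negP: xK; apply.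
    have : x \in cl (X :\: G) by rewrite in_cl; rlia.
    exact: (subsetP (cl_min XK fK)).
  have sY' := sub_cl r (Y :|: (X :\: G)); set Y' := cl _ in sY'.
  have rY' : r Y' <= r Y + r (X :\: G) by rewrite rank_cl; apply: subadd.
  have cG : G :|: Y' = setT by sets.
  have g1 : 2 <= r G by rewrite rG.
  have g2 : r G < R by rewrite rG; rlia.
  have g3 := VC0_big vc0 cG g1 g2.
  have fY' : flat Y' := cl_flat r _.
  have tY' : t \in Y' by apply: (subsetP sY'); rewrite inE tY.
  have rY'1 : (r Y').+1 = R by rlia.
  have sC : ~: Y' \subset G by sets.
  exact: (inner_cocircuit tG tY' nc fY' rY'1 sC).
case: (uncovered_side s0 fG rG tG nc); first exact: (main _ _ s0).
exact: (main _ _ (vsepC s0)).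
Qed.

End Prism.
End Planes.

(** * Contracting a thin line *)

Section OverThin.
Variables (U : finType) (rN : rfun U).
Hypothesis N1 : forall u, rN [set u] = 1.
Variables (T : finType) (r : rfun T).
Implicit Types (X Y Z F G H K L P Q V W C S m B : {set T}).
Implicit Types (e f x y z a b c t q w u v s : T).
Local Notation R := (r setT).
Local Notation cl := (rcl r).
Local Notation flat := (rflat r).
Local Notation VC := (vconn r).
Local Notation NM := (ncontr rN r).
Local Notation good := (vcontr rN r).
Local Notation vsep := (vert_sep r).
Local Notation covered := (two_lines r).
Local Notation spike := (line_spike r).
Hypothesis simp : simple_rf r.
Hypothesis vc0 : VC set0.

Lemma spike_plane_rank L y1 y2 z1 z2 H1 H2 X : spike L y1 z1 H1 -> spike L y2 z2 H2 ->
  y1 != y2 -> L \subset X -> (r (H2 :&: (H1 :&: X))).+2 <= r X.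
Proof.
move=> s1 s2 y12 LX; have [y1L _ f1 _ _] := s1; have [y2L _ f2 _ _] := s2.
have h1 : r (H1 :&: X) < r X.
  apply: rank_subflat => //; apply/subsetPn; exists y2; first exact: (subsetP LX).
  by apply: (spike_out s1) => //; rewrite eq_sym.
have h2 : r (H2 :&: (H1 :&: X)) < r (H1 :&: X).
  apply: rank_subflat => //; apply/subsetPn; exists y1; last exact: (spike_out s2).
  by rewrite inE (spike_mem s1) (subsetP LX).
by rlia.
Qed.

(* Two of the three points lie on the same side, and they span the line. *)
Lemma line_side L X Y a b c : flat L -> r L = 2 -> flat X -> flat Y ->
  X :|: Y = setT -> a \in L -> b \in L -> c \in L -> a != b -> a != c -> b != c ->
  L \subset X \/ L \subset Y.
Proof.
move=> fL rL fX fY c0 aL bL cL ab ac bc.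
have key W u v : flat W -> u \in L -> v \in L -> u != v -> u \in W -> v \in W ->
    L \subset W.
  move=> fW uL vL uv uW vW; rewrite -(line_cl simp fL _ uv uL vL) ?rL //.
  by apply: cl_min => //; rewrite subUset !sub1set uW.
have side u : u \notin X -> u \in Y.
  by move=> uX; move/setP/(_ u): c0; rewrite !inE (negbTE uX).
have [aX|/side aY] := boolP (a \in X).
  have [bX|/side bY] := boolP (b \in X); first by left; apply: (key X a b).
  have [cX|/side cY] := boolP (c \in X); first by left; apply: (key X a c).
  by right; apply: (key Y b c).
have [bX|/side bY] := boolP (b \in X); last by right; apply: (key Y a b).
have [cX|/side cY] := boolP (c \in X); last by right; apply: (key Y a c).
by left; apply: (key X b c).
Qed.

(** * A good plane formed by a line and one further point *)

Section Plane.
Variables (L G Q : {set T}) (t b0 : T).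
Hypothesis fL : flat L.
Hypothesis rL : r L = 2.
Hypothesis fG : flat G.
Hypothesis rG : r G = 3.
Hypothesis gG : good G.
Hypothesis fQ : flat Q.
Hypothesis LQ : L \subset Q.
Hypothesis gQ : forall z, good [set z] -> z \in Q.
Hypothesis tG : t \in G.
Hypothesis tQ : t \notin Q.
Hypothesis GL : G = t |: L.
Hypothesis b0L : b0 \in L.

(** Off [L] and [z1], the side [X] lies in the trace [F] of both hyperplanes, a line through [t].
    Some [s] of [F] off [Y] spans [X] with [L] and [z1], so it is bad, or [t] would be in [Q].
    Exchanging [G] for [z1], [s] and [t] shows that [s] is N-contractible, so it has a separation.
    The side containing [L] is forced to be the span of [s] and [L], and the cocircuit inside it has
    no room off [L]. *)
Lemma one_spike_inside y1 y2 z1 z2 H1 H2 X Y : spike L y1 z1 H1 -> spike L y2 z2 H2 ->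
  y1 != y2 -> b0 != y1 -> b0 != y2 ->
  good [set z1] -> z1 \in X -> z2 \notin X -> vsep X Y t -> G \subset X -> r X = 4 ->
  r (G :|: Y) = R -> False.
Proof.
move=> s1 s2 y12 b1 b2 gz1 z1X z2X sXY GX rX rGY.
have [[fX fY] c [tX tY] [_ rY] rXY] := sXY.
have [y1L z1L f1 rH1 _] := s1; have [y2L z2L f2 rH2 _] := s2.
have LX : L \subset X by apply: subset_trans GX; rewrite GL; sets.
have tL : t \notin L by apply: contra tQ; apply: (subsetP LQ).
have z1Q := gQ gz1.
have tz1 : t != z1 by apply: contraNneq tQ => ->.
have tz2 : t != z2 by apply: contraNneq z2X => <-.
pose F := H2 :&: (H1 :&: X).
have rF := spike_plane_rank s1 s2 y12 LX; rewrite -/F rX in rF.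
have {}rF : r F <= 2 by rlia.
have fF : flat F by do 2!apply: flatI => //.
have tF : t \in F by rewrite !inE (spike_in s1 tL tz1) (spike_in s2 tL tz2).
have Xin u : u \in X -> [\/ u \in L, u \in F | u = z1].
  move=> uX; have [uL|uL] := boolP (u \in L); first exact: Or31.
  have [->|uz1] := eqVneq u z1; first exact: Or33.
  have uz2 : u != z2 by apply: contraNneq z2X => <-.
  by apply: Or32; rewrite !inE uX (spike_in s1 uL uz1) (spike_in s2 uL uz2).
have XU u : u \notin Y -> u \in X.
  by move=> uY; move/setP/(_ u): c; rewrite !inE (negbTE uY) orbF.
have rL2 : 2 <= r L by rewrite rL.
have rLR : r L < R by rlia.
have hF : R <= r (z1 |: (Y :|: F)).
  have c1 : L :|: (z1 |: (Y :|: F)) = setT.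
    apply/setP => u; rewrite !inE; have [uY|/XU/Xin[->|uF|->]] := boolP (u \in Y).
    - by rewrite !orbT.
    - by [].
    - by move: uF; rewrite !inE => ->; rewrite !orbT.
    by rewrite eqxx orbT.
  by have := VC0_big vc0 c1 rL2 rLR; rlia.
have hYF : R <= (r (Y :|: F)).+1 by have := rankU1_le r z1 (Y :|: F); rlia.
have zcQ : cl (z1 |: L) \subset Q by apply: cl_min => //; rewrite subUset sub1set z1Q.
have tz : t \notin cl (z1 |: L) by apply: contra tQ; apply: (subsetP zcQ).
have rz : r (z1 |: L) = 3 by rewrite (flatU1 fL z1L) rL.
have [s [sF sY sz]] : exists s, [/\ s \in F, s \notin Y & s \notin cl (z1 |: L)].
  apply: NNPP => no.
  have inz s : s \in F -> s \notin Y -> s \in cl (z1 |: L).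
    by move=> sF sY; apply/negPn/negP => sz; apply: no; exists s.
  have c2 : cl (z1 |: L) :|: Y = setT.
    have [s0 s0F s0Y] : exists2 s, s \in F & s \notin Y.
      apply/subsetPn; apply/negP => sFY.
      by have : r (Y :|: F) <= r Y; [apply: rf_mono; rewrite subUset subxx|rlia].
    have [sc1 sc2] : z1 \in cl (z1 |: L) /\ L \subset cl (z1 |: L).
      have h := sub_cl r (z1 |: L); split; last by sets.
      by apply: (subsetP h); rewrite !inE eqxx.
    apply/setP => u; rewrite !inE; have [uY|uY] := boolP (u \in Y); first by rewrite orbT.
    rewrite orbF; case: (Xin u (XU u uY)) => [uL|uF|->]; last by [].
      exact: (subsetP sc2).
    exact: inz.
  have a1 : 2 <= r (cl (z1 |: L)) by rewrite rank_cl rz.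
  have a2 : r (cl (z1 |: L)) < R by rewrite rank_cl rz; rlia.
  by have := VC0_big vc0 c2 a1 a2; rewrite rank_cl rz; rlia.
have sX : s \in X by move: sF; rewrite !inE => /and3P[].
have st : s != t by apply: contraNneq sY => ->.
have szL : r (s |: (z1 |: L)) = 4 by rewrite (notin_cl sz) rz.
have szX : s |: (z1 |: L) \subset X by rewrite !subUset !sub1set sX z1X.
have XE : X \subset cl (s |: (z1 |: L)) by apply: rank_ge_cl => //; rewrite szL rX.
have FE := line_cl simp fF rF st sF tF.
have ngs : ~ good [set s].
  move=> gs; move/negP: tQ; apply; apply: (subsetP (cl_min _ fQ)) (subsetP XE t tX).
  by rewrite !subUset !sub1set gQ // z1Q.
have z1F : z1 \notin F by rewrite !inE (negbTE (spike_top s1)) andbF.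
have y2F : y2 \notin F.
  by rewrite !inE (negbTE (spike_out s1 y2L _)) ?andbF // eq_sym.
have rJ : r (z1 |: [set s; t]) = 3.
  by rewrite notin_cl ?FE // rank2.
have JX : z1 |: [set s; t] \subset X by rewrite !subUset !sub1set sX z1X.
have JY : r ((z1 |: [set s; t]) :|: Y) = R.
  apply/eqP; rewrite eqn_leq leT /=; apply: leq_trans hF _.
  have -> : (z1 |: [set s; t]) :|: Y = [set s; t] :|: (z1 |: Y) by clear; sets.
  by rewrite -(rankU_cl r [set s; t]) FE; apply: rf_mono; clear; sets.
have ns : NM [set s].
  apply: (@NM_sub _ _ _ _ _ (z1 |: [set s; t])); first by sets.
  apply: (@NM_swap _ rN N1 _ r X Y t G) => //; rewrite ?rank1 ?rG ?rJ //.
  - by rewrite !inE eqxx !orbT.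
  exact: gG.2.
have nvs : ~ VC [set s] by move=> v; apply: ngs.
have y2c : y2 \in cl (z1 |: [set s; t]).
  have h1 : r (H2 :&: X) < r X.
    apply: rank_subflat => //; apply/subsetPn; exists y1; first exact: (subsetP LX).
    exact: (spike_out s2).
  have sH : y2 |: [set s; t] \subset H2 :&: X.
    have y2X := subsetP LX y2 y2L; have y2H := spike_mem s2.
    have sH2 : s \in H2 by move: sF; rewrite !inE => /andP[].
    have tH2 : t \in H2 by move: tF; rewrite !inE => /andP[].
    by apply/subsetP => u; rewrite !inE => /or3P[]/eqP->; apply/andP; split.
  have rK : r (y2 |: [set s; t]) = 3 by rewrite notin_cl ?FE // rank2.
  have h2 : r (H2 :&: X) <= 3 -> H2 :&: X \subset cl (y2 |: [set s; t]).
    by move=> h; apply: (rank_ge_cl sH); rewrite rK.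
  have z12 : z1 != z2 by apply: contraNneq z2X => <-.
  have z1c : z1 \in cl (y2 |: [set s; t]).
    apply: (subsetP (h2 _)); first by rlia.
    by rewrite inE z1X (spike_in s2 z1L z12).
  by apply: clU1_exch z1c _; rewrite FE.
have [X2 [Y2 sep2]] := sepP simp vc0 nvs.
have main X3 Y3 : vsep X3 Y3 s -> L \subset X3 -> False.
  move=> sep3 LX3; have [[fX3 fY3] c3 [sX3 sY3] [rX3 rY3] rXY3] := sep3.
  have all_in : z1 \in X3 -> X \subset X3.
    move=> z1X3; apply: subset_trans XE _; apply: cl_min => //.
    by rewrite !subUset !sub1set sX3 z1X3.
  have X3U u : u \notin X3 -> u \in Y3.
    by move=> uX; move/setP/(_ u): c3; rewrite !inE (negbTE uX).
  have t3 : t \notin X3.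
    apply/negP => tX3.
    have FX3 : F \subset X3 by rewrite -FE; apply: cl_min => //; rewrite subUset !sub1set sX3.
    have z1X3 : z1 \in X3.
      have s5 : y2 |: [set s; t] \subset X3.
        by rewrite !subUset !sub1set (subsetP LX3) // sX3.
      apply: (subsetP (cl_min s5 fX3)); apply: clU1_exch y2c _.
      by rewrite FE.
    have XX3 := all_in z1X3.
    have c4 : X3 :|: (Y :&: Y3) = setT by clear - c c3 XX3; sets.
    have d1 : 2 <= r X3 by rlia.
    have d2 : r X3 < R by rlia.
    have d3 := VC0_big vc0 c4 d1 d2.
    have : r (Y :&: Y3) < r Y3 by apply: rank_subflat => //; apply/subsetPn; exists s.
    by rlia.
  have tY3 := X3U t t3.
  have z13 : z1 \notin X3.
    by apply: contra t3 => /all_in/subsetP; apply.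
  have z1Y3 := X3U z1 z13.
  have y2Y3 : y2 \in Y3.
    apply: (subsetP (cl_min _ fY3)) y2c.
    by rewrite !subUset !sub1set z1Y3 sY3.
  have u1 : 3 <= r (X :&: Y3).
    by rewrite -rJ; apply: rf_mono; rewrite subsetI JX !subUset !sub1set z1Y3 sY3.
  have u2 : r (X :|: Y3) + r (X :&: Y3) <= r X + r Y3.
    apply: submod; clear; sets.
  have u3 : r (G :|: Y) + r (Y :&: X3) <= r Y + r X3.
    rewrite [r Y + _]addnC; apply: submod; last by clear; sets.
    by clear - GX c3 LX3 GL tY3 tY; rewrite GL; sets.
  have c5 : (Y :&: X3) :|: (X :|: Y3) = setT by clear - c c3; sets.
  have u4 : r (Y :&: X3) <= 1.
    rewrite leqNgt; apply/negP => gt.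
    have : r (Y :&: X3) <= r X3 by apply: rf_mono; clear; sets.
    move=> u5; have u6 : r (Y :&: X3) < R by rlia.
    by have := VC0_big vc0 c5 gt u6; rlia.
  have inX3 u : u \in X -> u \in X3 -> u != s -> u \in L.
    move=> uX uX3 us; case: (Xin u uX) => [//|uF|E].
      move/negP: t3; case; rewrite -(line_cl simp fF rF us uF sF) in tF.
      apply: (subsetP (cl_min _ fX3)) tF.
      by rewrite subUset !sub1set uX3.
    by rewrite -E uX3 in z13.
  have c6 : Y3 :|: ~: Y3 = setT by rewrite setUCr.
  have e1 : 2 <= r Y3 by rlia.
  have e2 : r Y3 < R by rlia.
  have e3 := VC0_big vc0 c6 e1 e2.
  have e4 : r (~: Y3) <= r (L :|: (Y :&: X3)).
    apply: rf_mono; apply/subsetP => u; rewrite !inE => uY3.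
    have uX3 : u \in X3 by move/setP/(_ u): c3; rewrite !inE (negbTE uY3) orbF.
    have us : u != s by apply: contraNneq uY3 => ->.
    rewrite uX3 andbT; have [uY|uY] := boolP (u \in Y); first by rewrite orbT.
    by rewrite (inX3 u) ?XU.
  have e5 : r (L :|: (Y :&: X3)) <= r L + r (Y :&: X3) by apply: subadd.
  have rX33 : r X3 = 3 by rlia.
  have [a aY3 aL] : exists2 a, a \in ~: Y3 & a \notin cl L by apply: ex_notin; rlia.
  rewrite (flat_cl fL) in aL; rewrite inE in aY3.
  have aX3 : a \in X3 by move/setP/(_ a): c3; rewrite !inE (negbTE aY3) orbF.
  have as' : a != s by apply: contraNneq aY3 => ->.
  have sL : s \notin L.
    apply: contra sz => sL; apply: (subsetP (sub_cl r _)).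
    by rewrite !inE sL orbT.
  have sLX3 : s |: L \subset X3 by rewrite subUset sub1set sX3.
  have X3E : X3 \subset cl (s |: L).
    by apply: rank_ge_cl => //; rewrite (flatU1 fL sL) rL rX33.
  have aX : a \in X.
    apply: (subsetP (subset_trans X3E _)) aX3; apply: cl_min => //.
    by rewrite subUset sub1set sX.
  by rewrite (inX3 a) in aL.
have [[fX2 fY2] c2 _ _ _] := sep2.
have b1' : y1 != b0 by rewrite eq_sym.
have b2' : y2 != b0 by rewrite eq_sym.
case: (line_side fL rL fX2 fY2 c2 y1L y2L b0L y12 b1' b2') => h.
  exact: (main _ _ sep2 h).
exact: (main _ _ (vsepC sep2) h).
Qed.

End Plane.

(** Outside [Q], the plane [G] would be [L] plus one point [t], since two spike hyperplanes cut it
    in rank at most 1. Three points of [L] make [t] uncovered. In the rank-4 side of its separation,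
    two tops would put [t] in [Q], one top is excluded by [one_spike_inside], and without tops [L]
    splits off too cheaply. *)
Lemma thin_plane L G Q : thin rN r L -> flat G -> L \subset G -> r G = 3 -> good G ->
  flat Q -> L \subset Q -> (forall z, good [set z] -> z \in Q) -> G \subset Q.
Proof.
move=> tL fG LG rG gG fQ LQ gQ; apply/negPn/negP => nGQ.
have [[fL rL gL] _ _ sp] := tL.
have [y1 [y2 [b [[y1L y2L bL] [y12 b1 b2] ng1 ng2]]]] := thin_bad2 tL.
have [z1 [H1 [gz1 s1]]] := sp _ y1L ng1.
have [z2 [H2 [gz2 s2]]] := sp _ y2L ng2.
have R4 := thin_rank simp vc0 tL.
have QG : G :&: Q \subset L.
  apply: (flat_rank_sub fL); last first.
    by rewrite setIC rL; have := rank_subflat fQ nGQ; rlia.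
  by rewrite subsetI LG.
have inL u : u \in G -> u \in Q -> u \in L.
  by move=> uG uQ; apply: (subsetP QG); rewrite inE uG.
have zG z y H : good [set z] -> spike L y z H -> z \notin G.
  by move=> gz [_ zL _ _ _]; apply: contra zL => zG; apply: inL => //; apply: gQ.
have z1G := zG _ _ _ gz1 s1; have z2G := zG _ _ _ gz2 s2.
have rF := spike_plane_rank s1 s2 y12 LG; rewrite rG in rF.
have [t tG tn] : exists2 t, t \in G & t \notin cl L by apply: ex_notin; rlia.
have tL' : t \notin L by rewrite flat_cl in tn.
have inF u : u \in G -> u \notin L -> u \in H2 :&: (H1 :&: G).
  move=> uG uL; rewrite !inE uG (spike_in s1) ?(spike_in s2) //.
    by apply: contraNneq z2G => <-.
  by apply: contraNneq z1G => <-.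
have GE : G = t |: L.
  apply/eqP; rewrite eqEsubset subUset sub1set tG LG !andbT.
  apply/subsetP => u uG; rewrite !inE; have [uL|uL] := boolP (u \in L).
    by rewrite orbT.
  rewrite orbF; apply/eqP; apply: (@eq_rank1 _ _ simp (H2 :&: (H1 :&: G))).
  - by rlia.
  - exact: inF.
  exact: inF.
have tQ : t \notin Q by apply: contra tL' => tQ; apply: inL.
have nc : ~ covered G t.
  move=> cov; apply: (@not_covered _ _ simp G L t y1 y2 b _ _ _ _ _ _ _ _ _ _ _ _ cov);
    rewrite ?rL // 1?eq_sym //; exact: (subsetP LG).
have nvt : ~ VC [set t].
  move=> v; move/negP: tQ; apply; apply: gQ; split=> //.
  by apply: NM_sub gG.2; rewrite sub1set.
have [X0 [Y0 sep0]] := sepP simp vc0 nvt.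
have main X Y : vsep X Y t -> G \subset X -> False.
  move=> sep GX; have [[fX fY] c [tX tY] [rX rY] rXY] := sep.
  have [nGY] := plane_sep simp gG.1 fG rG sep tG GX.
  case=> [rX3|[rX4 rGY]].
    have XG : X \subset G by apply: (flat_rank_sub fG GX); rewrite rX3 rG.
    have rY1 : (r Y).+1 = R by rlia.
    have R3 : 3 <= R by rlia.
    have h := cocirc_rank vc0 fY rY1 R3.
    have : ~: Y \subset L by rewrite GE in XG; sets.
    by move/(rf_mono r); rlia.
  have LX := subset_trans LG GX.
  have b1' : b != y1 by []; have b2' : b != y2 by [].
  have y21 : y2 != y1 by rewrite eq_sym.
  have [z1X|z1X] := boolP (z1 \in X); have [z2X|z2X] := boolP (z2 \in X).
  - have h4 := spike2 vc0 fL rL R4 y12 s1 s2.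
    have sX : z1 |: (z2 |: L) \subset X by rewrite !subUset !sub1set z1X z2X.
    have XE : X \subset cl (z1 |: (z2 |: L)) by apply: rank_ge_cl => //; rewrite h4 rX4.
    move/negP: tQ; apply; apply: (subsetP (cl_min _ fQ)) (subsetP XE t tX).
    by rewrite !subUset !sub1set !gQ.
  - exact: (one_spike_inside fL rL rG gG fQ LQ gQ tG tQ GE bL s1 s2 y12 b1 b2 gz1 z1X
      z2X sep GX rX4 rGY).
  - exact: (one_spike_inside fL rL rG gG fQ LQ gQ tG tQ GE bL s2 s1 y21 b2 b1 gz2 z2X
      z1X sep GX rX4 rGY).
  pose F := H2 :&: (H1 :&: X).
  have rF' := spike_plane_rank s1 s2 y12 LX; rewrite -/F rX4 in rF'.
  have tz1 : t != z1 by apply: contraNneq z1G => <-.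
  have tz2 : t != z2 by apply: contraNneq z2G => <-.
  have tF : t \in F by rewrite !inE tX (spike_in s1 tL' tz1) (spike_in s2 tL' tz2).
  have c1 : L :|: (Y :|: F) = setT.
    apply/setP => u; rewrite [RHS]inE; have [uX|uX] := boolP (u \in X); last first.
      by move/setP/(_ u): c; rewrite !inE (negbTE uX) /= => ->; rewrite orbT.
    have [uL|uL] := boolP (u \in L); first by rewrite inE uL.
    have uz1 : u != z1 by apply: contraNneq z1X => <-.
    have uz2 : u != z2 by apply: contraNneq z2X => <-.
    by rewrite !inE uX (spike_in s1 uL uz1) (spike_in s2 uL uz2) !orbT.
  have a1 : 2 <= r L by rewrite rL.
  have a2 : r L < R by rlia.
  have a3 := VC0_big vc0 c1 a1 a2.
  have a4 := rankU1 simp tY tF.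
  by rlia.
case: (uncovered_side sep0 fG rG tG nc) => h; first exact: (main _ _ sep0 h).
exact: (main _ _ (vsepC sep0) h).
Qed.

(** Two spike hyperplanes cut [G] in a line [m] disjoint from [L] with [G] inside [L :|: m], so [m]
    has no good point. A separation over [m] has [L], hence [G], on one side, and [claim] excludes
    it. *)
Lemma thin_solid L G (yy p : 'I_3 -> T) HH Q : thin rN r L -> hub r L G yy p HH -> good G ->
  flat Q -> L \subset Q -> (forall z, good [set z] -> z \in Q) ->
  r (Q :|: G) = r Q + 2 ->
  exists m, [/\ flat m, r m = 2, good m, forall a, a \in m -> ~ good [set a] &
    r (Q :|: m) = r Q + 2].
Proof.
move=> tL hG gG fQ LQ gQ rQG.
have [[fL rL gL] _ _ sp] := tL.
have [[fG LG rG] _ _ _ _] := hG; rewrite rL in rG.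
have [y1 [y2 [b [[y1L y2L bL] [y12 b1 b2] ng1 ng2]]]] := thin_bad2 tL.
have [z1 [H1 [gz1 s1]]] := sp _ y1L ng1.
have [z2 [H2 [gz2 s2]]] := sp _ y2L ng2.
have R4 := thin_rank simp vc0 tL.
have QG : G :&: Q \subset L.
  apply: (flat_rank_sub fL); first (by apply/subsetIP; split).
  have : r (Q :|: G) + r (G :&: Q) <= r Q + r G by apply: submod; sets.
  by rlia.
have inL u : u \in G -> u \in Q -> u \in L.
  by move=> uG uQ; apply: (subsetP QG); rewrite inE uG.
have zG z y' H' : good [set z] -> spike L y' z H' -> z \notin G.
  by move=> gz [_ zL _ _ _]; apply: contra zL => zG; apply: inL => //; apply: gQ.
have z1G := zG _ _ _ gz1 s1; have z2G := zG _ _ _ gz2 s2.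
pose m := H2 :&: (H1 :&: G).
have rm := spike_plane_rank s1 s2 y12 LG; rewrite -/m rG in rm.
have [_ _ f1 _ _] := s1; have [_ _ f2 _ _] := s2.
have fm : flat m by do 2!apply: flatI => //.
have mG : m \subset G by rewrite /m; sets.
have GE : G \subset L :|: m.
  apply/subsetP => u uG; rewrite inE; have [//|uL /=] := boolP (u \in L).
  rewrite !inE uG (spike_in s1) ?(spike_in s2) //.
    by apply: contraNneq z2G => <-.
  by apply: contraNneq z1G => <-.
have mL u : u \in m -> u \notin L.
  rewrite !inE => /and3P[u2 u1 uG]; apply/negP => uL.
  have [e|uy1] := eqVneq u y1; last by have := spike_out s1 uL uy1; rewrite u1.
  have uy2 : u != y2 by rewrite e.
  by have := spike_out s2 uL uy2; rewrite u2.
have rm2 : r m = 2.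
  by have := @subadd _ r L m G GE; rlia.
have nG : forall a, a \in m -> ~ good [set a].
  move=> a am ga; move/negP: (mL a am); apply.
  by apply: inL; [apply: (subsetP mG)|apply: gQ].
exists m; split=> //; last first.
  have : r (Q :|: G) <= r (Q :|: m) by apply: rf_mono; sets.
  by have := @subadd _ r Q m _ (subxx _); rlia.
split; last by apply: NM_sub gG.2.
(* [R + 4] is [R + r m + 2]. From rank 6 on, contractibility of [G] suffices; in rank 5 the hub
   confines [X :\: G]; in rank 4 [X] is [G], and [L] alone is opposed to the rest. *)
have claim X : flat X -> G \subset X -> r X < R -> R + 4 <= r X + r (m :|: ~: X).
  move=> fX GX rX.
  have rGX := rf_mono r GX; rewrite rG in rGX.
  have a1 : 2 <= r L by rewrite rL.
  have a2 : r L < R by rlia.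
  have [r6|r6] := leqP 6 (r X).
    have c1 : X :|: (G :|: ~: X) = setT by sets.
    have sG : G \subset G :|: ~: X by sets.
    have r6' : r G + 2 <= r X by rlia.
    have h := VC_big gG.1 c1 GX sG r6' rX.
    have : r (G :|: ~: X) <= r L + r (m :|: ~: X) by apply: subadd; sets.
    by rlia.
  have [r5|r5] := leqP 5 (r X).
    have rX5 : r X = (r G).+1 by rlia.
    have h := hub_color hG fX GX rX5.
    have c1 : (L :|: (X :\: G)) :|: (m :|: ~: X) = setT by sets.
    have b3 : r L <= r (L :|: (X :\: G)) by apply: rf_mono; sets.
    have b4 : 2 <= r (L :|: (X :\: G)) by rlia.
    have b5 : r (L :|: (X :\: G)) < R by rlia.
    by have := VC0_big vc0 c1 b4 b5; rlia.
  have XG : X \subset G by apply: (flat_rank_sub fG) => //; rlia.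
  have c1 : L :|: (m :|: ~: X) = setT by sets.
  by have := VC0_big vc0 c1 a1 a2; rlia.
apply: NNPP => /nVC[X [Y [d [[fX fY d1 c] mX mY]]]]; rewrite rm2 => le [lX lY].
have main X' Y' : flat X' -> X' :|: Y' = setT -> m \subset X' -> m \subset Y' ->
    r X' + r Y' <= R + 2 + d -> 2 + d < r Y' -> L \subset X' -> False.
  move=> fX' c' mX' mY' le' lY' LX'.
  have GX' : G \subset X' by sets.
  have lt : r X' < R by rlia.
  have h := claim X' fX' GX' lt.
  have : r (m :|: ~: X') <= r Y' by apply: rf_mono; sets.
  by rlia.
have b1' : y1 != b by rewrite eq_sym.
have b2' : y2 != b by rewrite eq_sym.
case: (line_side fL rL fX fY c y1L y2L bL y12 b1' b2') => h.
  exact: (main X Y).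
by apply: (main Y X) => //; [sets|rlia].
Qed.

End OverThin.

(** * Simplified contractions *)

(* [r1] is the simplification of the contraction of [C], embedded by [v]. *)
Definition reduction (T T1 : finType) (r : rfun T) (C : {set T}) (r1 : rfun T1)
    (v : T1 -> T) : Prop :=
  (forall X : {set T1}, r1 X + r C = r (C :|: v @: X)) /\
  (forall e, e \in rcl r C \/ exists s, e \in rcl r (v s |: C)).

Section ContractionRank.
Variables (T : finType) (r : rfun T) (C : {set T}).
Local Notation cl := (rcl r).

(** The representatives are chosen as in [simp_set], so that the canonical simplification is
    recovered on the nose. *)
Definition least_rep (e : T) : bool :=
  (e \notin cl C) &&
  [forall f, (f \in cl (e |: C)) && (f \notin cl C) ==> (enum_rank e <= enum_rank f)].

Local Notation T1 := {e | least_rep e}.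

Lemma contr_card (X : {set T1}) : r (C :|: val @: X) - r C <= #|X|.
Proof.
rewrite -(card_imset _ val_inj); apply: leq_trans (rf_card r _).
by rewrite leq_subLR; apply: subadd.
Qed.

Lemma contr_mono (X Y : {set T1}) : X \subset Y ->
  r (C :|: val @: X) - r C <= r (C :|: val @: Y) - r C.
Proof. by move=> s; apply: leq_sub2r; apply: rf_mono; apply: setUS; apply: imsetS. Qed.

Lemma contr_subm (X Y : {set T1}) :
  r (C :|: val @: (X :|: Y)) - r C + (r (C :|: val @: (X :&: Y)) - r C) <=
  r (C :|: val @: X) - r C + (r (C :|: val @: Y) - r C).
Proof.
have h : r (C :|: val @: (X :|: Y)) + r (C :|: val @: (X :&: Y)) <=
    r (C :|: val @: X) + r (C :|: val @: Y).
  rewrite imsetU imsetI; last by move=> ? ? _ _; apply: val_inj.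
  by apply: submod; clear; sets.
have b Z : r C <= r (C :|: Z) by apply: rf_mono; apply: subsetUl.
have := b (val @: (X :|: Y)); have := b (val @: (X :&: Y)).
by have := b (val @: X); have := b (val @: Y); rlia.
Qed.

Definition contr_rf : rfun T1 := Rfun contr_card contr_mono contr_subm.

Lemma contr_reduction : reduction r C contr_rf val.
Proof.
split=> [X|e].
  by rewrite /contr_rf /= subnK //; apply: rf_mono; apply: subsetUl.
have [eC|eC] := boolP (e \in cl C); [by left|right].
pose P f := (f \in cl (e |: C)) && (f \notin cl C).
have Pe : P e by rewrite /P eC andbT; apply: (subsetP (sub_cl r _)); rewrite !inE eqxx.
case: (@arg_minnP _ e P (fun f => enum_rank f) Pe) => s /andP[sE sC] smin.
have sl : least_rep s.
  rewrite /least_rep sC; apply/forallP => f; apply/implyP => /andP[fs fC].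
  apply: smin; rewrite /P fC andbT.
  apply: (subsetP (cl_sub _)) fs; rewrite subUset sub1set sE.
  by apply: subset_trans (sub_cl r _); apply: subsetUr.
by exists (Sub s sl); rewrite SubK; apply: clU1_exch.
Qed.

Lemma contr_simple : simple_rf contr_rf.
Proof.
have one (e : T1) : r (val e |: C) = (r C).+1.
  by apply: notin_cl; case: e => e /= /andP[].
have h1 (e : T1) : contr_rf [set e] = 1.
  by rewrite /contr_rf /= imset_set1 setUC one; lia.
split=> // e f ef; have := contr_reduction.1 [set e; f].
rewrite imsetU !imset_set1.
have fe : val f \notin cl (val e |: C).
  apply/negP => fe; move/negP: ef; apply; apply/eqP; apply: val_inj.
  case/andP: (valP e) (fe) => eC /forallP/(_ (val f))/implyP he.
  case/andP: (valP f) => fC /forallP/(_ (val e))/implyP hf fe'.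
  apply: enum_rank_inj; apply: val_inj; apply/eqP; rewrite eqn_leq.
  by rewrite he ?fe' // hf // eC andbT; apply: clU1_exch.
have -> : C :|: ([set val e] :|: [set val f]) = val f |: (val e |: C) by clear; sets.
by rewrite (notin_cl fe) one; lia.
Qed.

End ContractionRank.

Section Transport.
Variables (U : finType) (rN : rfun U).
Hypothesis N1 : forall u, rN [set u] = 1.
Variables (T T1 : finType) (r : rfun T) (C : {set T}) (r1 : rfun T1) (v : T1 -> T).
Hypothesis red : reduction r C r1 v.
Implicit Types (X Y Z F G : {set T}) (A B D E : {set T1}).
Local Notation cl := (rcl r).
Local Notation cl1 := (rcl r1).
Local Notation flat := (rflat r).

Definition up_set A := C :|: v @: A.
Local Notation up := up_set.

Lemma up_rank A : r (up A) = r1 A + r C. Proof. by rewrite red.1. Qed.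

Lemma up_mono A B : A \subset B -> up A \subset up B.
Proof. by move=> s; apply: setUS; apply: imsetS. Qed.

Lemma upU1 s A : v s |: up A = up (s |: A).
Proof. by rewrite /up imsetU imset_set1; clear; sets. Qed.

Lemma upU A B : up A :|: up B = up (A :|: B).
Proof. by rewrite /up imsetU; clear; sets. Qed.

Lemma up0 : up set0 = C. Proof. by rewrite /up imset0 setU0. Qed.

Lemma sub_up A : C \subset up A. Proof. exact: subsetUl. Qed.

Lemma mem_up s A : s \in A -> v s \in up A.
Proof. by move=> sX; rewrite inE imset_f ?orbT. Qed.

Lemma v_notin s : r1 [set s] = 1 -> v s \notin cl C.
Proof.
move=> h; rewrite in_cl -[C in v s |: C]up0 upU1 up_rank.
by rewrite setU0 h; rlia.
Qed.

Lemma in_up_cl s A : (v s \in cl (up A)) = (s \in cl1 A).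
Proof. by rewrite !in_cl upU1 !up_rank leq_add2r. Qed.

Lemma above Y : flat Y -> C \subset Y -> Y = cl (up (v @^-1: Y)).
Proof.
move=> fY CY; apply/eqP; rewrite eqEsubset; apply/andP; split; last first.
  apply: cl_min => //; rewrite subUset CY; apply/subsetP => e.
  by case/imsetP => s; rewrite inE => ? ->.
apply/subsetP => e eY; have [eC|eC] := boolP (e \in cl C).
  by apply: (subsetP (cl_mono r _)) eC; apply: sub_up.
have [h|[s es]] := red.2 e; first by rewrite h in eC.
have sY : v s \in Y.
  apply: (subsetP (cl_min _ fY)) (clU1_exch es eC).
  by rewrite subUset sub1set eY.
apply: (subsetP (cl_mono r _)) es; rewrite subUset sub_up sub1set andbT.
by apply: mem_up; rewrite inE.
Qed.

Lemma above_rank Y : flat Y -> C \subset Y -> r Y = r1 (v @^-1: Y) + r C.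
Proof. by move=> fY CY; rewrite {1}(above fY CY) rank_cl up_rank. Qed.

Lemma rankT : r setT = r1 setT + r C.
Proof. by rewrite (above_rank (flatT r) (subsetT C)) preimsetT. Qed.

Lemma up_cover A B : A :|: B = setT -> cl (up A) :|: cl (up B) = setT.
Proof.
move=> c; apply/setP => e; rewrite !inE.
case: (red.2 e) => [eC|[s es]].
  by rewrite (subsetP (cl_mono r (sub_up A)) e eC).
have h E : s \in E -> e \in cl (up E).
  move=> sW; apply: (subsetP (cl_mono r _)) es.
  by rewrite subUset sub_up sub1set mem_up.
by move/setP/(_ s): c; rewrite !inE => /orP[] /h ->; rewrite ?orbT.
Qed.

Lemma VC_down D : vconn r (up D) -> vconn r1 D.
Proof.
move=> vc A B d d1 c sX sY le.
have := vc (cl (up A)) (cl (up B)) d d1 (up_cover c).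
rewrite !rank_cl !up_rank rankT.
have h E : D \subset E -> up D \subset cl (up E).
  by move=> s; apply: subset_trans (sub_cl r _); apply: up_mono.
by move/(_ (h _ sX) (h _ sY)); case; [rlia|left; rlia|right; rlia].
Qed.

Lemma VC_up D : vconn r1 D -> vconn r (up D).
Proof.
move=> vc; apply: NNPP => /nVC[X [Y [d [[fX fY d1 c] sX sY le [lX lY]]]]].
have CX := subset_trans (sub_up D) sX; have CY := subset_trans (sub_up D) sY.
rewrite up_rank (above_rank fX CX) (above_rank fY CY) in le lX lY.
have rT := rankT.
have inv (W : {set T}) : up D \subset W -> D \subset v @^-1: W.
  by move=> s; apply/subsetP => e eZ; rewrite inE (subsetP s) ?mem_up.
have := vc (v @^-1: X) (v @^-1: Y) d d1.
case; [by rewrite -preimsetU c preimsetT|exact: inv|exact: inv|rlia|rlia|rlia].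
Qed.

Lemma NM_up D : ncontr rN r1 D -> ncontr rN r (up D).
Proof.
move=> [C1 s [rC [g gE]]]; exists (up C1); first exact: up_mono.
split; first by rewrite up_rank rankT; rlia.
exists (v \o g) => I; rewrite imset_comp.
have -> : v @: (g @: I) :|: up C1 = up (g @: I :|: C1).
  by rewrite /up imsetU; clear; sets.
by rewrite !up_rank gE; lia.
Qed.

(** The copy of [N] misses the contracted flat [K], so each of its points is parallel over [C] to a
    representative; replacing it changes no closure over [K]. *)
Lemma NM_down D : ncontr rN r (up D) -> ncontr rN r1 D.
Proof.
move=> /NM_cl[K0 s0 /EMB_cl]; set K := cl K0 => -[rK [g gE]].
have fK : flat K by apply: cl_flat.
have sK : up D \subset K.
  exact: subset_trans (sub_cl r _) (subset_trans s0 (sub_cl r _)).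
have CK := subset_trans (sub_up D) sK.
have rep u : exists s, g u \in cl (v s |: C) /\ v s \in cl (g u |: C).
  have gK : g u \notin K.
    apply/negP => gK; have := gE [set u]; rewrite imset_set1 N1.
    have -> : [set g u] :|: K = K by apply/setUidPr; rewrite sub1set.
    by rlia.
  have gC : g u \notin cl C.
    by apply: contra gK; apply: (subsetP (cl_min CK fK)).
  case: (red.2 (g u)) => [h|[s es]]; first by rewrite h in gC.
  by exists s; split=> //; apply: clU1_exch.
have [g1 g1E] := fin_all_exists rep.
exists (v @^-1: K).
  by apply/subsetP => e eZ; rewrite inE (subsetP sK) ?mem_up.
have rKE := above_rank fK CK.
split; first by have := rankT; rlia.
exists g1 => I; apply/eqP; rewrite -(eqn_add2r (r C)) -up_rank; apply/eqP.
rewrite -addnA -rKE -gE -upU -[LHS]rank_cl -[RHS]rank_cl; congr (r _).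
have cK : cl (up (v @^-1: K)) = K by rewrite -above.
have sup : K \subset cl (g @: I :|: K).
  by apply: subset_trans (sub_cl r _); apply: subsetUr.
apply/eqP; rewrite eqEsubset; apply/andP; split; apply: cl_sub.
  rewrite subUset; apply/andP; split; last first.
    by apply: subset_trans sup; rewrite -{2}cK; apply: sub_cl.
  rewrite subUset (subset_trans CK sup); apply/subsetP => e.
  case/imsetP => s /imsetP[u uI ->] ->.
  apply: (subsetP (cl_mono r _)) (g1E u).2.
  rewrite subUset sub1set inE imset_f //=.
  exact: subset_trans CK (subsetUr _ _).
rewrite subUset; apply/andP; split; last first.
  by rewrite -{1}cK; apply: cl_mono; apply: subsetUr.
apply/subsetP => e /imsetP[u uI ->].
apply: (subsetP (cl_mono r _)) (g1E u).1.
rewrite subUset sub1set inE mem_up ?imset_f //=.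
exact: subset_trans (sub_up (g1 @: I)) (subsetUl _ _).
Qed.

Lemma good_up D : vcontr rN r1 D -> vcontr rN r (up D).
Proof. by case=> a b; split; [apply: VC_up|apply: NM_up]. Qed.

Lemma good_cl Z : vcontr rN r Z -> vcontr rN r (cl Z).
Proof. by case=> a b; split; [apply: VC_cl|apply: NM_cl]. Qed.

End Transport.

(* The family for [k = 1] is a single point, whereas [uphalf 1 + 1 = 2]. *)
Definition ceil_half_succ (k : nat) : nat := if k == 1 then 1 else uphalf k + 1.

(** * Lifting free families *)

Ltac slia :=
  repeat match goal with
  | H : context[@bigop.body ?A ?I ?i ?r ?F] |- _ =>
      let n := fresh "n" in set n := (@bigop.body A I i r F) in *; clearbody n
  | |- context[@bigop.body ?A ?I ?i ?r ?F] =>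
      let n := fresh "n" in set n := (@bigop.body A I i r F) in *; clearbody n
  end; rlia.

Section Skew.
Variables (T : finType) (r : rfun T).
Implicit Types (X Y Q O L : {set T}) (s : seq {set T}).

Definition skew s : Prop := r (\bigcup_(X <- s) X) = \sum_(X <- s) r X.

Lemma rank_bigcup_le Q s : r (Q :|: \bigcup_(X <- s) X) <= r Q + \sum_(X <- s) r X.
Proof.
elim: s Q => [|O s IH] Q; first by rewrite !big_nil setU0 addn0.
rewrite !big_cons setUA; apply: leq_trans (IH _) _; rewrite addnA leq_add2r.
exact: subadd.
Qed.

Lemma skew_sub L O s : O \subset L ->
  r (L :|: \bigcup_(X <- s) X) = r L + \sum_(X <- s) r X -> skew (O :: s).
Proof.
move=> OL e; rewrite /skew !big_cons; set S := \bigcup_(X <- s) X.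
have := rank_bigcup_le O s; rewrite -/S.
have h : r (L :|: S) + r O <= r L + r (O :|: S).
  by apply: submod; clear - OL; sets.
by move: e h; rewrite -/S => e h h2; apply/eqP; rewrite eqn_leq h2 /=; rlia.
Qed.

Lemma skew_take n s : skew s -> skew (take n s).
Proof.
rewrite /skew -{1 2}(cat_take_drop n s) !big_cat /= => e.
have h := rank_bigcup_le (\bigcup_(X <- take n s) X) (drop n s).
have h2 := rank_bigcup_le set0 (take n s); rewrite set0U rank0 in h2.
by apply/eqP; rewrite eqn_leq h2 /= -(leq_add2r (\sum_(X <- drop n s) r X)) -e.
Qed.

End Skew.

Section Family.
Variables (U : finType) (rN : rfun U).
Hypothesis N1 : forall u, rN [set u] = 1.
Hypothesis N3 : forall (I : {set U}) d, d <= 1 -> rN I + rN (~: I) <= rN setT + d ->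
  #|I| <= d \/ #|~: I| <= d.

Section Objects.
Variables (T : finType) (r : rfun T).
Implicit Types (X : {set T}).
Local Notation good := (vcontr rN r).

(** Spikes are not part of the definition: [no_good_thin] supplies them, and they become the
    cocircuits of a carambole in [gfil_filament]. *)
Definition gfil X : Prop :=
  [/\ rflat r X, r X = 2, good X & forall a, a \in X -> ~ good [set a]].

Definition member X : Prop := (exists x, X = [set x] /\ good [set x]) \/ gfil X.

Lemma point_outside Q z : good [set z] -> z \notin rcl r Q ->
  exists O, member O /\ r (Q :|: O) = r Q + r O.
Proof.
move=> gz zQ; exists [set z]; split; first by left; exists z.
have h := notin_cl zQ; rewrite setUC h.
have := rank1_le r z; have := @subadd _ r [set z] Q (z |: Q) (subxx _).
by rlia.
Qed.

End Objects.

Section Lift.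
Variables (T T1 : finType) (r : rfun T) (C : {set T}) (r1 : rfun T1) (v : T1 -> T).
Hypothesis red : reduction r C r1 v.
Hypothesis simp1 : simple_rf r1.
Hypothesis vc1 : vconn r1 set0.
Implicit Types (X Y Q O L G : {set T}) (A B : {set T1}).
Local Notation cl := (rcl r).
Local Notation flat := (rflat r).
Local Notation good := (vcontr rN r).
Local Notation up := (up_set C v).

Lemma rankU_up Q A : C \subset Q -> r (Q :|: cl (up A)) = r (Q :|: v @: A).
Proof.
move=> CQ; rewrite setUC rankU_cl; congr (r _).
by rewrite /up; clear - CQ; sets.
Qed.

(** Three spikes of the filament are lifted; [spike2] gives the rank of two tops with [G]. *)
Lemma fil_hub A : gfil r1 A -> exists y p H, hub r C (cl (up A)) y p H.
Proof.
move=> [fA rA gA no].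
have tA := no_good_thin N1 simp1 vc1 fA rA gA no.
have R4 := thin_rank simp1 vc1 tA.
have [_ [a [b [c [[aA bA cA] ab ac bc]]]] _ sp] := tA.
pose f (i : 'I_3) := tnth [tuple a; b; c] i.
have fin i : f i \in A.
  have := mem_tnth i [tuple a; b; c]; rewrite -/(f i) !inE.
  by case/or3P => /eqP->.
have finj i j : i != j -> f i != f j.
  apply: contra => /eqP e; apply/eqP/(tuple_uniqP [tuple a; b; c]) => //=.
  by rewrite !inE negb_or ab ac bc.
have sp' i : exists z, exists H, line_spike r1 A (f i) z H.
  by have [z [H [_ h]]] := sp _ (fin i) (no _ (fin i)); exists z, H.
have [z zE] := fin_all_exists sp'.
have [H HE] := fin_all_exists zE.
have HF i : rcl r1 (H i) = H i by case: (HE i) => _ _ fH _ _; apply: flat_cl.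
exists (v \o f), (v \o z), (fun i => cl (up (H i))); split.
- split; first exact: cl_flat.
    exact: subset_trans (sub_up _ _ _) (sub_cl r _).
  by rewrite rank_cl (up_rank red) rA addnC.
- move=> i; have [_ _ _ rH _] := HE i; split.
  + exact: cl_flat.
  + by rewrite rank_cl (up_rank red) (rankT red); rlia.
  + exact: subset_trans (sub_up _ _ _) (sub_cl r _).
  + by rewrite (in_up_cl red) HF; apply: spike_mem (HE i).
  by rewrite (in_up_cl red) (flat_cl fA).
- move=> i j ij; rewrite (in_up_cl red) HF.
  by apply: (spike_out (HE i)) => //; apply: finj; rewrite eq_sym.
- move=> i e eH; have CH := subset_trans (sub_up C v (H i)) (sub_cl r _).
  have [eC|[s es]] := red.2 e.
    by move/negP: eH; case; apply: (subsetP (cl_min CH (cl_flat _ _))).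
  have inW B : s \in B -> e \in cl (up B).
    move=> sB; apply: (subsetP (cl_mono r _)) es.
    by rewrite subUset sub_up sub1set mem_up.
  have sH : s \notin H i by apply: contra eH; apply: inW.
  have [_ _ _ _ E] := HE i; move/setP/(_ s): E; rewrite !inE sH => /esym/orP[/eqP sz|].
    by right; rewrite /= -sz.
  by case/andP => _ sA; left; apply: inW.
move=> i j ij; have := spike2 vc1 fA rA R4 (finj _ _ ij) (HE i) (HE j).
rewrite /= !setUA [X in r X]setUC rankU_cl => h4.
rewrite addnC -h4 -(up_rank red); congr (r _).
by rewrite /up !imsetU !imset_set1; clear; sets.
Qed.

(** The member [O] need not come from [A]; it only has to stay skew to what [A] was skew to. *)
Definition liftable A : Prop := forall Q, C \subset Q -> r (Q :|: v @: A) = r Q + r1 A ->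
  exists O, member r O /\ r (Q :|: O) = r Q + r O.

(** Members are replaced one at a time. Each new one is chosen skew to [Q] together with the members
    still to be lifted, and then joins [Q]. *)
Lemma lift_family (sA : seq {set T1}) Q : (forall A, A \in sA -> liftable A) -> C \subset Q ->
  r (Q :|: v @: (\bigcup_(A <- sA) A)) = r Q + \sum_(A <- sA) r1 A ->
  exists s : seq {set T}, [/\ size s = size sA, forall O, O \in s -> member r O &
    r (Q :|: \bigcup_(O <- s) O) = r Q + \sum_(O <- s) r O].
Proof.
elim: sA Q => [|A sA IH] Q hA CQ.
  by move=> _; exists [::]; split=> //; rewrite !big_nil setU0 addn0.
rewrite !big_cons imsetU; set W := v @: (\bigcup_(B <- sA) B) => e.
have le (P : {set T}) B : C \subset P -> r (P :|: v @: B) <= r P + r1 B.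
  move=> CP; have := up_rank red B; rewrite /up => hB.
  have h : r (P :|: v @: B) + r C <= r P + r (C :|: v @: B).
    by apply: submod; clear - CP; sets.
  by rlia.
have leW (P : {set T}) : C \subset P -> r (P :|: W) <= r P + \sum_(B <- sA) r1 B.
  move=> CP; apply: leq_trans (le _ _ CP) _; rewrite leq_add2l.
  by have := rank_bigcup_le r1 set0 sA; rewrite set0U rank0.
have hA1 : liftable A by apply: hA; rewrite inE eqxx.
have CQW : C \subset Q :|: W by apply: subset_trans CQ (subsetUl _ _).
have e2 : Q :|: (v @: A :|: W) = (Q :|: W) :|: v @: A by clear; sets.
rewrite e2 in e.
have h1 := le _ A CQW; have h2 := leW _ CQ.
have [O [mO rO]] : exists O, member r O /\ r ((Q :|: W) :|: O) = r (Q :|: W) + r O.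
  by apply: hA1 => //; apply/eqP; rewrite eqn_leq h1 /=; slia.
have CQO : C \subset Q :|: O by apply: subset_trans CQ (subsetUl _ _).
have e3 : (Q :|: W) :|: O = (Q :|: O) :|: W by clear; sets.
rewrite e3 in rO.
have h3 := leW _ CQO.
have h4 : r (Q :|: O) <= r Q + r O by apply: subadd.
have h5 : r (Q :|: W) = r Q + \sum_(B <- sA) r1 B by slia.
have [||s [sz ms rs]] := IH (Q :|: O) _ CQO.
- by move=> B BA; apply: hA; rewrite inE BA orbT.
- by apply/eqP; rewrite eqn_leq h3 /=; slia.
exists (O :: s); split; first by rewrite /= sz.
  by move=> P; rewrite inE => /predU1P[->|/ms].
by rewrite !big_cons setUA rs; slia.
Qed.

Lemma good_up_cl A : vcontr rN r1 A -> good (cl (up A)).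
Proof. by move=> gA; apply: good_cl; apply: (good_up red). Qed.

End Lift.

Section LiftCases.
Variables (T T1 : finType) (r : rfun T) (C : {set T}) (r1 : rfun T1) (v : T1 -> T).
Hypothesis red : reduction r C r1 v.
Hypothesis simp : simple_rf r.
Hypothesis vc0 : vconn r set0.
Hypothesis simp1 : simple_rf r1.
Hypothesis vc1 : vconn r1 set0.
Implicit Types (X Y Q O L G : {set T}) (A B : {set T1}).
Local Notation cl := (rcl r).
Local Notation flat := (rflat r).
Local Notation good := (vcontr rN r).
Local Notation up := (up_set C v).

Lemma inside_or_point Q : (forall z, good [set z] -> z \in cl Q) \/
  exists O, member r O /\ r (Q :|: O) = r Q + r O.
Proof.
have [?|no] := classic (forall z, good [set z] -> z \in cl Q); [by left|right].
have [z gz zQ] : exists2 z, good [set z] & z \notin cl Q.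
  apply: NNPP => h; apply: no => z gz; apply/negPn/negP => zQ.
  by apply: h; exists z.
exact: point_outside gz zQ.
Qed.

(** If [cl Q] contains all good points, it contains a lifted point by [lift_point]. For a filament,
    [prism_absurd] gives the plane [G] a good point besides [x], so [G] meets [cl Q] in rank 2,
    against skewness. *)
Lemma lift_at_point x A : C = [set x] -> (forall L, ~ thin rN r L) -> member r1 A ->
  liftable r C r1 v A.
Proof.
move=> Cx nt mA Q CQ rQ.
have fC : flat C by rewrite Cx; apply: flat1.
have [inQ|//] := inside_or_point Q.
case: mA => [[s [As gs]]|fA].
  have sx : v s \notin C by rewrite -(flat_cl fC) (v_notin red) // (rank1 simp1).
  have g2 : good [set x; v s].
    by have := good_up red gs; rewrite /up_set imset_set1 Cx.
  have xs : x != v s by move: sx; rewrite Cx inE eq_sym.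
  have := lift_point N1 simp vc0 nt xs g2 (cl_flat r Q) inQ.
  rewrite sub1set in_cl setUC => h.
  by move: rQ; rewrite As imset_set1 (rank1 simp1); rlia.
have [y [p [H hG]]] := fil_hub red simp1 vc1 fA.
have [_ rA gA _] := fA.
have rC : r C = 1 by rewrite Cx (rank1 simp).
pose G := cl (up A); have fG : flat G by apply: cl_flat.
have CG : C \subset G by apply: subset_trans (sub_up _ _ _) (sub_cl r _).
have xG : x \in G by apply: (subsetP CG); rewrite Cx inE.
have rG : r G = 3 by rewrite rank_cl (up_rank red) rA rC.
have gG := good_up_cl red gA : good G.
have rQG : r (Q :|: G) = r Q + 2 by rewrite rankU_up // rQ rA.
have [z [zG zx gz]] : exists z, [/\ z \in G, z != x & good [set z]].
  apply: NNPP => no; rewrite {1}Cx in hG.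
  apply: (prism_absurd simp vc0 hG gG) => // [z zG zx gz|m fm rm mG xm gm].
    by apply: no; exists z.
  apply: (nt m); apply: (no_good_thin N1 simp vc0) => // a am ga.
  apply: no; exists a; split=> //; first exact: (subsetP mG).
  by apply: contraNneq xm => <-.
have zQ := inQ z gz; have xQ : x \in cl Q.
  by apply: (subsetP (sub_cl r Q)); apply: (subsetP CQ); rewrite Cx inE.
have h1 : r (Q :|: G) + r [set z; x] <= r (cl Q) + r G.
  apply: submod; last by rewrite subUset !sub1set !inE zQ zG xQ xG.
  by apply: setSU; apply: sub_cl.
by rewrite rank_cl (rank2 simp) // in h1; rlia.
Qed.

Lemma lift_at_thin A : thin rN r C -> member r1 A -> liftable r C r1 v A.
Proof.
move=> tC mA Q CQ rQ; have [[fC rC gC] _ _ _] := tC.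
have [inQ|//] := inside_or_point Q.
have CQ' := subset_trans CQ (sub_cl r Q).
pose G := cl (up A); have fG : flat G by apply: cl_flat.
have CG : C \subset G by apply: subset_trans (sub_up _ _ _) (sub_cl r _).
have rQG : r (Q :|: G) = r Q + r1 A by rewrite rankU_up // rQ.
case: mA => [[s [As gs]]|fA].
  have gG := good_up_cl red gs; rewrite -As -/G in gG.
  have rA : r1 A = 1 by rewrite As (rank1 simp1).
  have rG : r G = 3 by rewrite rank_cl (up_rank red) rC rA.
  have := thin_plane N1 simp vc0 tC fG CG rG gG (cl_flat r Q) CQ' inQ.
  by move/rank_cl_sub; rewrite rQG; rlia.
have [y [p [H hG]]] := fil_hub red simp1 vc1 fA.
have [_ rA gA _] := fA.
have gG := good_up_cl red gA : good G.
have e : r (cl Q :|: G) = r (cl Q) + 2 by rewrite rankU_cl rQG rank_cl rA.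
have [m [fm rm gm nm rQm]] := thin_solid simp vc0 tC hG gG (cl_flat r Q) CQ' inQ e.
exists m; split; first by right.
by rewrite rankU_cl rank_cl in rQm; rewrite rQm rm.
Qed.

End LiftCases.

Lemma members_exist k : forall (T : finType) (r : rfun T), simple_rf r -> vconn r set0 ->
  ncontr rN r set0 -> 0 < k -> rN setT + k = r setT ->
  exists s : seq {set T}, [/\ size s = ceil_half_succ k, forall O, O \in s -> member r O &
    skew r s].
Proof.
elim/ltn_ind: k => k IH T r simp vc0 nc0 k0 rk.
have few (s : seq {set T}) : ceil_half_succ k <= size s ->
    (forall O, O \in s -> member r O) -> skew r s ->
    exists s : seq {set T}, [/\ size s = ceil_half_succ k,
      forall O, O \in s -> member r O & skew r s].
  move=> sz ms sk; exists (take (ceil_half_succ k) s); split.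
  - by rewrite size_takel.
  - by move=> O /mem_take/ms.
  exact: skew_take.
have step C n : vcontr rN r C -> 0 < n -> rN setT + n + r C = r setT -> n < k ->
    (forall A, member (contr_rf r C) A -> liftable r C (contr_rf r C) val A) ->
    exists s : seq {set T}, [/\ size s = ceil_half_succ n,
      forall O, O \in s -> member r O &
      r (C :|: \bigcup_(X <- s) X) = r C + \sum_(X <- s) r X].
  move=> [vcC ncC] n0 rn nk lift.
  have red := contr_reduction r C; have simp1 := contr_simple r C.
  have upE := up0 C (fun x : {e | least_rep r C e} => val x).
  have vc1 : vconn (contr_rf r C) set0 by apply: (VC_down red); rewrite upE.
  have nc1 : ncontr rN (contr_rf r C) set0 by apply: (NM_down N1 red); rewrite upE.
  have rT := rankT red.
  have [|s1 [sz ms sk]] := IH n nk _ _ simp1 vc1 nc1 n0; first by rlia.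
  have [||s [sz2 ms2 rs]] := @lift_family _ _ _ _ _ _ red s1 C _ (subxx _).
  - by move=> A /ms; apply: lift.
  - by rewrite -red.1 sk addnC.
  by exists s; rewrite sz2 sz.
have [[L tL]|nt] := classic (exists L, thin rN r L).
  have [[fL rL gL] _ _ _] := tL.
  (* Contracting [L] at [k = 3] would leave the exceptional value [k = 1]. Up to [k = 4] at most
     three members are required. *)
  have [k5|k4] := leqP 5 k; last first.
    have [a [b [c [ga gb gc rabc]]]] := thin_three simp vc0 tL.
    apply: (few [:: [set a]; [set b]; [set c]]).
    - by rewrite /ceil_half_succ; case: (k) k4 => [|[|[|[|[|k']]]]].
    - move=> O; rewrite !inE => /or3P[]/eqP->; left;
        [by exists a|by exists b|by exists c].
    by rewrite /skew !big_cons !big_nil !setU0 !(rank1 simp) rabc.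
  have n0 : 0 < k - 2 by lia.
  have rn : rN setT + (k - 2) + r L = r setT by rlia.
  have nk : k - 2 < k by lia.
  have [A mA|s [sz ms rs]] := step L (k - 2) gL n0 rn nk.
    have red := contr_reduction r L.
    have vc1 : vconn (contr_rf r L) set0.
      by apply: (VC_down red); rewrite up0; apply: gL.1.
    exact: (lift_at_thin red simp vc0 (contr_simple r L) vc1 tL mA).
  have [O [mO OL]] : exists O, member r O /\ O \subset L.
    have [[z [zL gz]]|no] := classic (exists z, z \in L /\ vcontr rN r [set z]).
      by exists [set z]; split; [left; exists z|rewrite sub1set].
    exists L; split=> //; right; split=> // a aL ga.
    by apply: no; exists a.
  apply: (few (O :: s)).
  - by rewrite /= sz /ceil_half_succ !eqn_leq; case: (k) k5 => [|[|[|[|[|k']]]]].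
  - by move=> P; rewrite inE => /predU1P[->|/ms].
  exact: skew_sub OL rs.
have {}nt L : ~ thin rN r L by move=> tL; apply: nt; exists L.
have [|x gx] := exists_good N1 N3 simp vc0 nc0; first by rlia.
have mx : member r [set x] by left; exists x.
have [k1|k2] := leqP k 1.
  apply: (few [:: [set x]]).
  - by case: (k) k0 k1 => [|[|k']].
  - by move=> O; rewrite inE => /eqP->.
  by rewrite /skew !big_cons !big_nil setU0 addn0.
have n0 : 0 < k - 1 by lia.
have rn : rN setT + (k - 1) + r [set x] = r setT by rewrite (rank1 simp); rlia.
have nk : k - 1 < k by lia.
have [A mA|s [sz ms rs]] := step [set x] (k - 1) gx n0 rn nk.
  have red := contr_reduction r [set x].
  have vc1 : vconn (contr_rf r [set x]) set0.
    by apply: (VC_down red); rewrite up0; apply: gx.1.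
  exact: (lift_at_point red simp vc0 (contr_simple r [set x]) vc1 erefl nt mA).
apply: (few ([set x] :: s)).
- rewrite /= sz /ceil_half_succ; case: (k) k2 => [|[|[|k']]] //= _.
  by rewrite !addn1 !ltnS uphalf_half leq_addl.
- by move=> P; rewrite inE => /predU1P[->|/ms].
exact: skew_sub (subxx _) rs.
Qed.

End Family.

(** * From matroids to rank functions *)

Section RankFunction.
Variables (T : finType) (M : matroid T).
Implicit Types (X Y I J S : {set T}).

Lemma rank_ge X I : indep M I -> I \subset X -> #|I| <= rank M X.
Proof.
by move=> iI sI; apply: (@leq_bigmax_cond _ _ (fun I : {set T} => #|I|)); rewrite iI.
Qed.

Lemma rank_le X n : (forall I, indep M I -> I \subset X -> #|I| <= n) -> rank M X <= n.
Proof. by move=> h; apply/bigmax_leqP => I /andP[]; apply: h. Qed.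

Lemma rank_card X : rank M X <= #|X|.
Proof. by apply: rank_le => I _; apply: subset_leq_card. Qed.

Lemma rank_mono X Y : X \subset Y -> rank M X <= rank M Y.
Proof.
by move=> s; apply: rank_le => I iI sI; apply: rank_ge => //; apply: subset_trans s.
Qed.

Lemma rank_restrict S Y : rank (restrict M S) Y = rank M (Y :&: S).
Proof.
rewrite /rank /=; apply: eq_bigl => I; rewrite subsetI -andbA.
by case: (indep M I) => //=; rewrite andbC.
Qed.

Hypothesis hM : is_matroid M.

Lemma rank_extend I X : indep M I -> I \subset X -> exists J,
  [/\ indep M J, I \subset J, J \subset X & #|J| = rank M X].
Proof.
move=> iI sI; pose P J := [&& indep M J, I \subset J & J \subset X].
have PI : P I by rewrite /P iI subxx.
case: (@arg_maxnP _ I P (fun J => #|J|) PI) => J /and3P[iJ sIJ sJX] Jmax.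
exists J; split=> //; apply/eqP; rewrite eqn_leq rank_ge //=.
apply: rank_le => K iK sK; rewrite leqNgt; apply/negP => lt.
have [_ _ _ aug] := hM; have [x xK ix] := aug _ _ iJ iK lt.
move: xK; rewrite inE => /andP[xJ xK].
have : P (x |: J).
  rewrite /P ix subUset sub1set (subsetP sK) //= sJX andbT.
  by apply: subset_trans sIJ (subsetUr _ _).
by move/Jmax; rewrite cardsU1 xJ; lia.
Qed.

Lemma rank_subm X Y : rank M (X :|: Y) + rank M (X :&: Y) <= rank M X + rank M Y.
Proof.
have [i0 _ down _] := hM.
have [I [iI _ sI <-]] := rank_extend i0 (sub0set (X :&: Y)).
have sIU : I \subset X :|: Y by clear - sI; sets.
have [J [iJ sIJ sJ <-]] := rank_extend iI sIU.
have hX : #|J :&: X| <= rank M X.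
  by apply: rank_ge (subsetIr _ _); apply: (down _ J) => //; apply: subsetIl.
have hY : #|J :&: Y| <= rank M Y.
  by apply: rank_ge (subsetIr _ _); apply: (down _ J) => //; apply: subsetIl.
apply: leq_trans (leq_add hX hY); rewrite -(cardsUI (J :&: X)); apply: leq_add.
  by apply: subset_leq_card; clear - sJ; sets.
by apply: subset_leq_card; clear - sI sIJ; sets.
Qed.

(** Defined on all of [T]: elements outside the ground set act as loops. *)
Definition matroid_rf : rfun T := Rfun rank_card rank_mono rank_subm.
Local Notation r := matroid_rf.

Lemma indep_rank I : indep M I = (r I == #|I|).
Proof.
have [i0 _ _ _] := hM; apply/idP/eqP => [iI|e].
  by apply/eqP; rewrite eqn_leq rf_card; apply: rank_ge.
have [J [iJ _ sJ cJ]] := rank_extend i0 (sub0set I).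
suff <- : J = I by [].
by apply/eqP; rewrite eqEcard sJ cJ -e; apply: leqnn.
Qed.

Lemma outside_loop e : e \notin ground M -> r [set e] = 0.
Proof.
have [_ sub _ _] := hM; move=> eM; apply/eqP; rewrite -leqn0.
apply: rank_le => I /sub sI sIe; rewrite leqn0 cards_eq0 -subset0.
apply/subsetP => f fI; have := subsetP sI f fI.
by have := subsetP sIe f fI; rewrite inE => /eqP->; rewrite (negbTE eM).
Qed.

Lemma outside_cl e X : e \notin ground M -> e \in rcl r X.
Proof.
by move/outside_loop => h; rewrite in_cl; have := @subadd _ r [set e] X _ (subxx _); rlia.
Qed.

Lemma rank_ground X : r (X :&: ground M) = r X.
Proof.
apply/eqP; rewrite eqn_leq rf_mono ?subsetIl // andTb.
rewrite -[r (_ :&: _)]rank_cl; apply: rf_mono; apply/subsetP => e eX.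
have [eM|/outside_cl//] := boolP (e \in ground M).
by apply: (subsetP (sub_cl r _)); rewrite inE eX.
Qed.

Lemma rk_setT : rk M = r setT. Proof. by rewrite -rank_ground setTI. Qed.

End RankFunction.

Lemma relative_basis (T : finType) (r : rfun T) (X Y : {set T}) : exists2 I : {set T},
  I \subset Y & r (I :|: X) = #|I| + r X /\ r (I :|: X) = r (Y :|: X).
Proof.
pose P (I : {set T}) := (I \subset Y) && (r (I :|: X) == #|I| + r X).
have P0 : P set0 by rewrite /P sub0set set0U cards0 eqxx.
case: (@arg_maxnP _ set0 P (fun I => #|I|) P0) => I /andP[sI /eqP rI] Imax.
exists I => //; split=> //; apply/eqP; rewrite eqn_leq rf_mono ?setSU // andTb.
rewrite -[r (I :|: X)]rank_cl; apply: rf_mono; rewrite subUset; apply/andP; split; last first.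
  by apply: subset_trans (sub_cl r _); apply: subsetUr.
apply/subsetP => e eY; apply/negPn/negP => eI.
have eI' : e \notin I.
  by apply: contra eI => eI; apply: (subsetP (sub_cl r _)); rewrite inE eI.
have : P (e |: I).
  rewrite /P subUset sub1set eY sI -setUA (notin_cl eI) cardsU1 eI' rI.
  by apply/eqP; lia.
by move/Imax; rewrite cardsU1 eI'; lia.
Qed.

Section Contraction.
Variables (T : finType) (M : matroid T) (hM : is_matroid M).
Local Notation r := (matroid_rf hM).
Implicit Types (X Y I J S : {set T}).

Lemma rank_contract X Y : rank (contract M X) Y = r (Y :|: X) - r X.
Proof.
apply/eqP; rewrite eqn_leq; apply/andP; split.
  apply: rank_le => I /= /andP[_ /eqP rI] sI.
  rewrite leq_subRL; last by apply: (@rf_mono _ r); apply: subsetUr.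
  by rewrite addnC -rI; apply: (@rf_mono _ r _ _ (setSU X sI)).
have [I sI [rI <-]] := relative_basis r X Y; rewrite rI addnK.
apply: rank_ge => //=; rewrite -[rank M _]/(r _) -[rank M X]/(r X) rI eqxx andbT.
apply/subsetP => e eI; apply/negPn/negP; rewrite inE negb_and negbK => h.
have eX : e \in rcl r X.
  by case/orP: h => [/(subsetP (sub_cl r X))//|]; apply: outside_cl.
have : r (I :|: X) <= #|I :\ e| + r X.
  have -> : I :|: X = e |: (I :\ e :|: X) by clear - eI; sets.
  have : r (e |: (I :\ e :|: X)) <= r (I :\ e :|: X).
    by rewrite -in_cl; apply: (subsetP (cl_mono r _)) eX; apply: subsetUr.
  move=> h1; apply: leq_trans h1 _; apply: leq_trans (@subadd _ r (I :\ e) X _ (subxx _)) _.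
  by rewrite leq_add2r rf_card.
by rewrite rI leq_add2r (cardsD1 e I) eI; lia.
Qed.

Lemma loop_contract X e : loop (contract M X) e = [&& e \in ground M :\: X & e \in rcl r X].
Proof.
rewrite /loop rank_contract in_cl subn_eq0 /=.
by rewrite -[rank M _]/(r _).
Qed.

Lemma simp_set_contract X e : (e \in simp_set (contract M X)) = least_rep r X e.
Proof.
have inX f : f \notin rcl r X -> f \in ground M :\: X.
  move=> fX; rewrite inE; apply/andP; split.
    by apply: contra fX => /(subsetP (sub_cl r X)).
  by apply/negPn/negP => fM; move/negP: fX; case; apply: outside_cl.
rewrite inE loop_contract /least_rep /=.
have [eX|eX] := boolP (e \in rcl r X); first by rewrite andbT; case: (e \in _).
rewrite inX //=; apply: eq_forallb => f.
rewrite /parallel !loop_contract rank_contract /= (negbTE eX) andbF /= (inX e) //=.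
have [fX|fX] := boolP (f \in rcl r X).
  by rewrite /= !andbF; case: (f \in _); rewrite /= ?andbF.
rewrite (inX f) //= andbT.
have [->|fe] := eqVneq f e; first by rewrite leqnn !implybT.
rewrite andTb -[rank M (_ :|: _)]/(r _) -[rank M X]/(r _) -setUA in_cl; have := notin_cl eX.
have : r (e |: X) <= r (f |: (e |: X)) by apply: rf_mono; apply: subsetUr.
by move=> h1 h2; congr (_ ==> _); rlia.
Qed.

End Contraction.

Lemma simple_card (T : finType) (r : rfun T) (A : {set T}) d :
  simple_rf r -> d <= 1 -> r A <= d -> #|A| <= d.
Proof.
move=> simp; case: d => [|[|//]] _ h.
  rewrite leqn0 cards_eq0; apply/eqP/setP => e; rewrite inE; apply/negP => eA.
  by have := rank_gt0 simp eA; rlia.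
by apply/card_le1_eqP => e f eA fA; apply: (eq_rank1 simp h).
Qed.

Lemma val_preim (T : finType) (P : pred T) (Y : {set T}) :
  val @: ((fun x : {e | P e} => val x) @^-1: Y) = Y :&: [set e | P e].
Proof.
apply/setP => e; rewrite !inE; apply/imsetP/andP.
  by case=> x; rewrite inE => xY ->; split=> //; apply: valP.
by case=> eY Pe; exists (Sub e Pe); rewrite ?inE SubK.
Qed.

Section Geometry.
Variables (T : finType) (M : matroid T) (hM : is_matroid M).
Local Notation r := (matroid_rf hM).
Implicit Types (X Y I J S : {set T}).

(** Contracting the empty set discards loops, parallel copies and the elements outside the ground
    set, so a simple matroid gets a type of its own. *)
Definition geometry : rfun {e | least_rep r set0 e} := contr_rf r set0.

Lemma geometryE (I : {set {e | least_rep r set0 e}}) : geometry I = r (val @: I).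
Proof. by have := (contr_reduction r set0).1 I; rewrite rank0 addn0 set0U. Qed.

Lemma ground_rep : (forall e, e \in ground M -> r [set e] = 1) ->
  (forall e f, e \in ground M -> f \in ground M -> e != f -> r [set e; f] = 2) ->
  forall e, least_rep r set0 e = (e \in ground M).
Proof.
move=> h1 h2 e; rewrite /least_rep.
have in0 f : (f \in rcl r set0) = (f \notin ground M).
  rewrite in_cl setU0 rank0; have [fM|fM] := boolP (f \in ground M).
    by rewrite h1.
  by rewrite outside_loop.
rewrite in0 negbK; have [eM /=|//] := boolP (e \in ground M).
apply/forallP => f; apply/implyP; rewrite in0 negbK setU0 in_cl => /andP[le fM].
have [->//|fe] := eqVneq f e.
by move: le; rewrite h2 // h1.
Qed.

Lemma vconn_geometry : vconn r set0 -> vconn geometry set0.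
Proof. by move=> vc; apply: (VC_down (contr_reduction r set0)); rewrite up0. Qed.

Lemma three_connected_sep : three_connected M -> forall (A : {set T}) k,
  A \subset ground M -> 1 <= k <= 2 -> k <= #|A| -> k <= #|ground M :\: A| ->
  r setT + k <= r A + r (ground M :\: A).
Proof.
move=> tc A k sA hk c1 c2; rewrite leqNgt; apply/negP => lt.
apply: (tc A sA k hk); split=> //.
rewrite -[rank M A]/(r A) -[rank M (_ :\: _)]/(r _) (rk_setT hM).
by case/andP: hk => k1 _; rlia.
Qed.

(** A set of rank above [d] has more than [d] elements, so [X] is large enough for a separation. If
    its complement is not, it is empty or the condition for [k = 1] applies; either way [X] spans
    and [r Y] is at most [d]. *)
Lemma three_connected_vconn : three_connected M -> vconn r set0.
Proof.
move=> tc X Y d d1 c _ _; rewrite rank0 addn0 => le.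
pose E := ground M.
have sep := three_connected_sep tc; rewrite -/E in sep.
have rX : r (X :&: E) = r X by apply: rank_ground.
have XC : r (E :\: X) <= r Y by apply: rf_mono; clear - c; sets.
have big (A : {set T}) n : n <= r A -> n <= #|A :&: E|.
  by move=> h; have := rf_card r (A :&: E); rewrite (rank_ground hM A); apply: leq_trans.
have [//|lX] := leqP (r X) d; first by left.
have [//|lY] := leqP (r Y) d; first by right.
have EX : E :\: (X :&: E) = E :\: X by clear; sets.
have cX : d < #|X :&: E| by apply: big.
have [cY|cY] := ltnP d #|E :\: X|.
  have := @sep (X :&: E) d.+1 (subsetIr _ _); rewrite EX rX.
  have hk : 1 <= d.+1 <= 2 by rewrite !ltnS leq0n.
  by move/(_ hk cX cY); rlia.
have sE : r (E :\: X) <= #|E :\: X| by apply: rf_card.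
have TE : r setT <= r (X :&: E) + r (E :\: X).
  rewrite -[r setT](rank_ground hM) setTI; apply: subadd; rewrite -/E.
  by clear; sets.
rewrite rX in TE.
have [c0|c1] := posnP #|E :\: X|; first by rlia.
have := @sep (X :&: E) 1 (subsetIr _ _) isT; rewrite EX rX => h.
have {}h : r setT + 1 <= r X + r (E :\: X) by apply: h => //; apply: leq_trans cX.
have : #|E :\: X| <= 1 by apply: leq_trans d1.
by rlia.
Qed.

(** A loop or a parallel pair would be a side of a small separation. When the rest is too small to
    be the other side, rank at least 2 settles the matter. *)
Lemma three_connected_simple : three_connected M -> 2 <= rk M ->
  (forall e, e \in ground M -> r [set e] = 1) /\
  (forall e f, e \in ground M -> f \in ground M -> e != f -> r [set e; f] = 2).
Proof.
move=> tc; rewrite (rk_setT hM) => R2; have vc := three_connected_vconn tc.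
pose E := ground M.
have rE : r E = r setT by rewrite -[r setT](rank_ground hM) setTI.
have sep := three_connected_sep tc; rewrite -/E in sep.
have split (A : {set T}) : A \subset E -> r setT <= r A + r (E :\: A).
  by move=> sA; rewrite -rE; apply: subadd; clear; sets.
have one e : e \in E -> r [set e] = 1.
  move=> eE; have sA : [set e] \subset E by rewrite sub1set.
  have h1 := rank1_le r e; have h2 := split _ sA.
  have h3 := rf_card r (E :\: [set e]); have h4 := leT r (E :\: [set e]).
  have c1 : 1 <= #|[set e]| by rewrite cards1.
  have c2 : 1 <= #|E :\: [set e]| by rlia.
  by have := sep _ 1 sA isT c1 c2; rlia.
split=> // e f eE fE ef.
have sA : [set e; f] \subset E by rewrite subUset !sub1set eE.
have h0 := rf_card r [set e; f]; rewrite cards2 ef in h0.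
have h2 := split _ sA; have h4 := leT r (E :\: [set e; f]).
have h3 := rf_card r (E :\: [set e; f]).
have cA : #|[set e; f]| = 2 by rewrite cards2 ef.
have [c2|c2] := leqP 2 #|E :\: [set e; f]|.
  have c1 : 2 <= #|[set e; f]| by rewrite cA.
  by have := sep _ 2 sA isT c1 c2; rlia.
have [c0|c0] := leqP 1 #|E :\: [set e; f]|; last by rlia.
have c1 : 1 <= #|[set e; f]| by rewrite cA.
by have := sep _ 1 sA isT c1 c0; rlia.
Qed.

Section Simplification.
Variable X : {set T}.
Local Notation M1 := (si (contract M X)).
Local Notation S := [set e | least_rep r X e].
Local Notation r1 := (contr_rf r X).

Lemma simp_setE : simp_set (contract M X) = S.
Proof. by apply/setP => e; rewrite (simp_set_contract hM) inE. Qed.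

Lemma ground_si : ground M1 = S.
Proof.
rewrite /= simp_setE; apply/setIidPr; rewrite -simp_setE.
by apply/subsetP => e; rewrite inE => /andP[].
Qed.

Lemma rank_si Y : rank M1 Y = r1 (val @^-1: Y).
Proof.
rewrite rank_restrict (rank_contract hM) simp_setE /contr_rf /= val_preim.
by rewrite [X :|: _]setUC.
Qed.

Lemma rank_si_val (A : {set {e | least_rep r X e}}) : rank M1 (val @: A) = r1 A.
Proof.
rewrite rank_si; congr (r1 _); apply/setP => x; rewrite inE mem_imset //.
exact: val_inj.
Qed.

Lemma vconn_three_connected : vconn r X -> three_connected M1.
Proof.
move=> vc Y; rewrite ground_si => sY k hk [c1 c2].
have vc1 : vconn r1 set0 by apply: (VC_down (contr_reduction r X)); rewrite up0.
have simp1 := contr_simple r X.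
rewrite /rk ground_si !rank_si; pose A := (fun x : {e | least_rep r X e} => val x) @^-1: Y.
have -> : (fun x : {e | least_rep r X e} => val x) @^-1: S = setT.
  by apply/setP => x; rewrite !inE; apply: valP.
have -> : (fun x : {e | least_rep r X e} => val x) @^-1: (S :\: Y) = ~: A.
  by apply/setP => x; rewrite !inE (valP x) andbT.
have cA : #|A| = #|Y|.
  by rewrite -(card_imset _ val_inj) val_preim; congr #|pred_of_set _|; apply/setIidPl.
have cC : #|~: A| = #|S :\: Y|.
  have e : ~: A = (fun x : {e | least_rep r X e} => val x) @^-1: (S :\: Y).
    by apply/setP => x; rewrite !inE (valP x) andbT.
  rewrite e -(card_imset _ val_inj) val_preim; congr #|pred_of_set _|.
  by apply/setIidPl; apply: subsetDl.
rewrite -/A => le; case/andP: hk => k1 k2.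
have d1 : k - 1 <= 1 by lia.
have := vc1 A (~: A) (k - 1) d1 (setUCr A) (sub0set _) (sub0set _).
rewrite rank0 addn0 !add0n addnBA // => /(_ le)[] /(simple_card simp1 d1).
  by rewrite cA; lia.
by rewrite cC; lia.
Qed.

End Simplification.

End Geometry.

(** * Minors of matroids and embeddings of N *)

Section Minors.
Variables (T T' : finType) (M : matroid T) (N : matroid T').
Variables (hM : is_matroid M) (hN : is_matroid N).
Local Notation r := (matroid_rf hM).
Local Notation U := {u | least_rep (matroid_rf hN) set0 u}.
Local Notation rN := (geometry hN).
Hypothesis repN : forall u, least_rep (matroid_rf hN) set0 u = (u \in ground N).

Lemma val_setT : val @: [set: U] = ground N.
Proof.
apply/setP => u; apply/imsetP/idP => [[x _ ->]|uN]; first by rewrite -repN; apply: valP.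
by rewrite -repN in uN; exists (Sub u uN); rewrite ?SubK.
Qed.

Lemma has_minor_ncontr : has_minor M N -> ncontr rN r set0.
Proof.
move=> [C [D [CE DE dCD [f [finj fE fI]]]]].
set E2 := ground (delete (contract M C) D) in finj fE fI.
have E2E : E2 = (ground M :\: C) :\: D by apply/setIidPr; apply: subsetDl.
have indE (I : {set T}) : I \subset E2 ->
    indep N (f @: I) = (r (I :|: C) == #|I| + r C).
  move=> IE; rewrite -fI //.
  change (((I \subset ground M :\: C) && (r (I :|: C) == #|I| + r C)) &&
    (I \subset (ground M :\: C) :\: D) = (r (I :|: C) == #|I| + r C)).
  rewrite -E2E IE andbT (subset_trans IE) //.
  by rewrite E2E; apply: subsetDl.
have cardf (I : {set T}) : I \subset E2 -> #|f @: I| = #|I|.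
  by move=> IE; apply: card_in_imset => x y /(subsetP IE) xE /(subsetP IE); apply: finj.
have rankN (Y : {set T}) : Y \subset E2 -> rank N (f @: Y) + r C = r (Y :|: C).
  move=> YE; have rCY : r C <= r (Y :|: C) by apply: rf_mono; apply: subsetUr.
  apply/eqP; rewrite eqn_leq; apply/andP; split.
    rewrite addnC -leq_subRL //; apply: rank_le => J iJ sJ.
    pose I := Y :&: f @^-1: J.
    have IE : I \subset E2 by apply: subset_trans YE; apply: subsetIl.
    have fIJ : f @: I = J.
      apply/setP => w; apply/imsetP/idP; first by case=> x; rewrite !inE => /andP[_ ?] ->.
      move=> wJ; have /imsetP[x xY wx] := subsetP sJ w wJ.
      by exists x => //; rewrite !inE xY -wx.
    rewrite -fIJ cardf // leq_subRL // addnC.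
    move: iJ; rewrite -fIJ indE // => /eqP <-.
    by apply: rf_mono; apply: setSU; apply: subsetIl.
  have [I sI [rI <-]] := relative_basis r C Y.
  have IE := subset_trans sI YE.
  rewrite rI leq_add2r -(cardf _ IE); apply: rank_ge; last exact: imsetS.
  by rewrite indE // rI.
have pick (u : U) : exists e, e \in E2 /\ f e = val u.
  have : val u \in f @: E2 by rewrite fE -repN; apply: valP.
  by case/imsetP => e eE ->; exists e.
have [g gP] := fin_all_exists pick.
have gE (I : {set U}) : g @: I \subset E2.
  by apply/subsetP => e /imsetP[u _ ->]; case: (gP u).
have fg (I : {set U}) : f @: (g @: I) = val @: I.
  by rewrite -imset_comp; apply: eq_imset => u; apply: (gP u).2.
(* Deleting [D] may lower the rank, whereas [embeds] wants a spanning copy. A set [B] completing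
   [E2 :|: C] to full rank is contracted instead, which leaves the ranks on [E2] unchanged. *)
have [B _ [rB RB]] := relative_basis r (E2 :|: C) setT.
rewrite setTU rB in RB.
have addB (Y : {set T}) : Y \subset E2 -> r (Y :|: (B :|: C)) = r (Y :|: C) + #|B|.
  move=> YE; apply/eqP; rewrite eqn_leq; apply/andP; split.
    have := rf_card r B.
    have : r (Y :|: (B :|: C)) <= r (Y :|: C) + r B.
      by apply: subadd; clear; sets.
    by rlia.
  have : r (B :|: (E2 :|: C)) + r (Y :|: C) <= r (Y :|: (B :|: C)) + r (E2 :|: C).
    by apply: submod; clear - YE; sets.
  by rewrite rB; rlia.
have rC0 := addB set0 (sub0set _); rewrite !set0U in rC0.
exists (B :|: C); first exact: sub0set.
split.
  have := rankN E2 (subxx _); rewrite fE -val_setT.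
  rewrite -[rank N _]/(matroid_rf hN _) -geometryE => h.
  by rewrite rC0 -RB -h; lia.
exists g => I; rewrite addB // rC0 -rankN // fg geometryE.
by rewrite -[rank N _]/(matroid_rf hN _); lia.
Qed.

Lemma ncontr_has_minor X : (T -> T') -> ncontr rN r X -> has_minor (si (contract M X)) N.
Proof.
move=> f0 ncX.
have nc1 : ncontr rN (contr_rf r X) set0.
  apply: (NM_down _ (contr_reduction r X)); last by rewrite up0.
  exact: (contr_simple (matroid_rf hN) set0).1.
case: nc1 => K1 _ [rK [g gE]].
set r1 := contr_rf r X in K1 rK g gE *.
have g1 u : g u \notin K1.
  apply/negP => gu; have := gE [set u]; rewrite imset_set1.
  have -> : g u |: K1 = K1 by apply/setUidPr; rewrite sub1set.
  by rewrite (contr_simple (matroid_rf hN) set0).1; lia.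
have ginj : injective g.
  move=> u w e; apply/eqP/negPn/negP => uw.
  have h1 := gE [set u; w]; have h2 := gE [set u].
  rewrite imset_set1 in h2; rewrite imsetU !imset_set1 -e setUid h2 in h1.
  have := (contr_simple (matroid_rf hN) set0).2 _ _ uw.
  have := (contr_simple (matroid_rf hN) set0).1 u.
  by move: h1; rewrite /geometry; lia.
pose S := [set e | least_rep r X e].
have gS : ground (si (contract M X)) = S by apply: ground_si.
pose C := val @: K1; pose E2 := val @: (g @: setT).
have CS : C \subset S by apply/subsetP => e /imsetP[x _ ->]; rewrite inE; apply: valP.
have ES : E2 \subset S by apply/subsetP => e /imsetP[x _ ->]; rewrite inE; apply: valP.
have CE : [disjoint C & E2].
  rewrite disjoint_subset; apply/subsetP => e /imsetP[x xK ->]; rewrite inE.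
  apply/negP => /imsetP[y /imsetP[u _ ->]] /val_inj xu.
  by move: (g1 u); rewrite -xu xK.
exists C, (S :\: (C :|: E2)); rewrite gS; split=> //.
- exact: subsetDl.
- by rewrite disjoint_subset; apply/subsetP => e eC; rewrite !inE eC.
(* The inverse of [g] on the copy of [N]; [f0] supplies the default value elsewhere. *)
pose f e := if [pick u | val (g u) == e] is Some u then val u else f0 e.
have fE u : f (val (g u)) = val u.
  rewrite /f; case: pickP => [w /eqP/val_inj/ginj ->//|/(_ u)].
  by rewrite eqxx.
have E2E : ground (delete (contract (si (contract M X)) C) (S :\: (C :|: E2))) = E2.
  change ((ground (si (contract M X)) :\: C) :&:
    ((ground (si (contract M X)) :\: C) :\: (S :\: (C :|: E2))) = E2).
  rewrite gS; apply/setP => e; rewrite !inE.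
  have := subsetP ES e; rewrite inE; have [eE|eE] := boolP (e \in E2).
    move/(_ isT) => ->; rewrite orbT /= !andbT andbb.
    by apply/negP => eC; move/pred0P/(_ e): CE; rewrite /= eC eE.
  by move=> _; rewrite orbF; case: (e \in C); case: (least_rep _ _ _).
exists f; rewrite E2E; split.
- move=> e e' /imsetP[x /imsetP[u _ ->] ->] /imsetP[x' /imsetP[u' _ ->] ->].
  by rewrite !fE => /val_inj ->.
- rewrite -val_setT; apply/setP => w; apply/imsetP/imsetP.
    by case=> e /imsetP[x /imsetP[u _ ->] ->] ->; exists u.
  by case=> u _ ->; exists (val (g u)); rewrite ?fE // !imset_f.
move=> I IE; pose J := (fun u => val (g u)) @^-1: I.
have IJ : I = val @: (g @: J).
  apply/setP => e; apply/idP/imsetP.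
    move=> eI; have /imsetP[x /imsetP[u _ ux] xe] := subsetP IE e eI.
    by exists x => //; apply/imsetP; exists u => //; rewrite inE -ux -xe.
  by case=> x /imsetP[u uJ ->] ->; rewrite inE in uJ.
have fIJ : f @: I = val @: J.
  rewrite IJ; apply/setP => w; apply/imsetP/imsetP.
    by case=> e /imsetP[x /imsetP[u uJ ->] ->] ->; exists u.
  by case=> u uJ ->; exists (val (g u)); rewrite ?fE // !imset_f.
have cI : #|I| = #|J| by rewrite IJ !card_imset //; apply: val_inj.
have cfI : #|f @: I| = #|J| by rewrite fIJ card_imset //; apply: val_inj.
have rI : rank (si (contract M X)) (I :|: C) = rN J + r1 K1.
  by rewrite IJ /C -imsetU rank_si_val -/r1 gE.
have rC : rank (si (contract M X)) C = r1 K1 by rewrite /C rank_si_val.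
rewrite (indep_rank hN) cfI fIJ -geometryE.
change (indep (delete (contract (si (contract M X)) C) (S :\: (C :|: E2))) I) with
  (((I \subset ground (si (contract M X)) :\: C) &&
   (rank (si (contract M X)) (I :|: C) == #|I| + rank (si (contract M X)) C)) &&
   (I \subset (ground (si (contract M X)) :\: C) :\: (S :\: (C :|: E2)))).
have h1 : I \subset ground (si (contract M X)) :\: C.
  rewrite gS; apply/subsetP => e eI; have eE := subsetP IE e eI.
  rewrite inE (subsetP ES) // andbT.
  by apply/negP => eC; move/pred0P/(_ e): CE; rewrite /= eC eE.
have h2 : I \subset (ground (si (contract M X)) :\: C) :\: (S :\: (C :|: E2)).
  apply/subsetP => e eI; have eE := subsetP IE e eI.
  by rewrite inE (subsetP h1) // !inE eE orbT.
by rewrite h1 h2 rI rC cI andbT /= eqn_add2r.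
Qed.

End Minors.

(** * Free families *)

Section FreeFamily.
Variables (T : finType) (r : rfun T).
Hypothesis simp : simple_rf r.
Implicit Types (X Y : {set T}) (s : seq {set T}).

Lemma skew_cons X s : skew r (X :: s) -> skew r s /\ X :&: \bigcup_(Y <- s) Y = set0.
Proof.
rewrite /skew !big_cons; set W := \bigcup_(Y <- s) Y => e.
have hW := rank_bigcup_le r set0 s; rewrite set0U rank0 add0n -/W in hW.
have h : r (X :|: W) + r (X :&: W) <= r X + r W by apply: rf_subm.
split.
  by apply/eqP; rewrite eqn_leq hW /=; have := @subadd _ r X W _ (subxx _); slia.
apply/setP => x; rewrite inE [RHS]inE; apply/negP => xXW.
have : 0 < r (X :&: W) by apply: (rank_gt0 simp (e := x)); rewrite inE.
by slia.
Qed.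

Lemma in_bigcup s (F : {set T} -> {set T}) x :
  (x \in \bigcup_(Y <- s) F Y) = has (fun Y => x \in F Y) s.
Proof. by elim: s => [|Y s IH]; rewrite ?big_nil ?big_cons inE //= IH. Qed.

Lemma mem_bigcup s X x : X \in s -> x \in X -> x \in \bigcup_(Y <- s) Y.
Proof. by move=> Xs xX; rewrite (in_bigcup s id); apply/hasP; exists X. Qed.

Lemma skew_uniq s : skew r s -> set0 \notin s -> uniq s.
Proof.
elim: s => //= X s IH /skew_cons[sk dis]; rewrite inE negb_or => /andP[X0 /(IH sk)->].
rewrite andbT; apply/negP => Xs; have /set0Pn[x xX] : X != set0 by rewrite eq_sym.
by move/setP/(_ x): dis; rewrite !inE xX (mem_bigcup Xs xX).
Qed.

Lemma skew_disjoint s X Y : skew r s -> X \in s -> Y \in s -> X != Y -> [disjoint X & Y].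
Proof.
move=> + + + XY; elim: s => //= Z s IH /skew_cons[sk dis].
have dZ W : W \in s -> [disjoint Z & W].
  move=> Ws; rewrite -setI_eq0 -subset0 -dis; apply: setIS.
  by apply/subsetP => x; apply: mem_bigcup.
rewrite !inE => /predU1P[XZ|Xs] /predU1P[YZ|Ys].
- by rewrite XZ YZ eqxx in XY.
- by rewrite XZ; apply: dZ.
- by rewrite YZ disjoint_sym; apply: dZ.
exact: IH.
Qed.

(** Submodularity is used twice, to cut first [X] and then the union [W] of the others down to their
    traces. *)
Lemma skew_trace s I : skew r s ->
  r (\bigcup_(X <- s) (I :&: X)) = \sum_(X <- s) r (I :&: X).
Proof.
elim: s => [|X s IH]; first by rewrite !big_nil rank0.
move=> sk; have [/IH e dis] := skew_cons sk.
rewrite !big_cons -e; set W := \bigcup_(Y <- s) Y in dis.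
set W' := \bigcup_(Y <- s) (I :&: Y).
have sW : W' \subset W.
  apply/subsetP => x; rewrite in_bigcup => /hasP[Y Ys]; rewrite inE => /andP[_].
  exact: mem_bigcup.
have rXW : r (X :|: W) = r X + r W.
  have := sk; have := (skew_cons sk).1; rewrite /skew !big_cons -/W => ->.
  by [].
have h1 : r (X :|: W) + r (I :&: X) <= r X + r ((I :&: X) :|: W).
  by apply: submod; clear; sets.
have h2 : r ((I :&: X) :|: W) + r W' <= r W + r ((I :&: X) :|: W').
  by apply: submod; clear - sW; sets.
have h3 : r ((I :&: X) :|: W') <= r (I :&: X) + r W' by apply: subadd.
by apply/eqP; rewrite eqn_leq h3 /=; rlia.
Qed.

End FreeFamily.

Section MatroidFamily.
Variables (T T' : finType) (M : matroid T) (N : matroid T').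
Variables (hM : is_matroid M) (hN : is_matroid N).
Local Notation r := (matroid_rf hM).
Local Notation T1 := {e | least_rep r set0 e}.
Local Notation r1 := (geometry hM).
Local Notation rN := (geometry hN).
Hypothesis repM : forall e, least_rep r set0 e = (e \in ground M).
Hypothesis repN : forall u, least_rep (matroid_rf hN) set0 u = (u \in ground N).
Implicit Types (A B : {set T1}).

Definition lift_set A : {set T} := val @: A.

Lemma lift_ground A : lift_set A \subset ground M.
Proof. by apply/subsetP => e /imsetP[x _ ->]; rewrite -repM; apply: valP. Qed.

Lemma mem_lift A x : (val x \in lift_set A) = (x \in A).
Proof. by rewrite mem_imset //; apply: val_inj. Qed.

Lemma lift_inj : injective lift_set.
Proof. exact: imset_inj val_inj. Qed.

Lemma card_lift A : #|lift_set A| = #|A|.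
Proof. exact: card_imset val_inj. Qed.

Lemma rank_lift A : r (lift_set A) = r1 A. Proof. by rewrite geometryE. Qed.

Lemma ground_lift (I : {set T}) : I \subset ground M -> exists A, I = lift_set A.
Proof.
move=> IM; exists ((fun x : T1 => val x) @^-1: I); rewrite /lift_set val_preim.
by apply/esym/setIidPl/subsetP => e /(subsetP IM); rewrite inE repM.
Qed.

Lemma good_vert A : (T -> T') -> vcontr rN r1 A -> vert_contractible M N (lift_set A).
Proof.
move=> f0 gA; have := good_up (contr_reduction r set0) gA.
rewrite /up_set set0U -/(lift_set A) => -[vc nc]; split; first exact: lift_ground.
by split; [apply: vconn_three_connected vc|apply: (ncontr_has_minor repN f0 nc)].
Qed.

(** The points of [A] are enumerated, and the top of the spike at each of them is its partner in the
    carambole. Minimality of the cocircuit holds because adding any point to the flat [H i] gives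
    full rank. *)
Lemma gfil_filament A : vconn r1 set0 -> (T -> T') -> gfil rN r1 A ->
  filament M N (lift_set A).
Proof.
move=> vc1 f0 [fA rA gA no].
have simp1 : simple_rf r1 := contr_simple r set0.
have N1 u : rN [set u] = 1 by apply: (contr_simple (matroid_rf hN) set0).1.
have [_ [a [b [c [[aA bA cA] ab ac bc]]]] _ sp] := no_good_thin N1 simp1 vc1 fA rA gA no.
pose y (i : 'I_#|A|) := val (enum_val i).
have yA : [set y i | i : 'I_#|A|] = lift_set A.
  apply/setP => e; apply/imsetP/imsetP => [[i _ ->]|[x xA ->]].
    by exists (enum_val i) => //; apply: enum_valP.
  by exists (enum_rank_in xA x) => //; rewrite /y enum_rankK_in.
have sp' (i : 'I_#|A|) : exists z, exists H, line_spike r1 A (enum_val i) z H.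
  by have [z [H [_ h]]] := sp _ (enum_valP i) (no _ (enum_valP i)); exists z, H.
have [z zE] := fin_all_exists sp'.
have [H HE] := fin_all_exists zE.
exists #|A|, (fun i => val (z i)), y; split; last by rewrite yA.
split.
- have c3 : #|[set a; b; c]| = 3.
    by rewrite setUC cardsU1 !inE cards2 ab negb_or ![c == _]eq_sym ac bc.
  rewrite -c3; apply: subset_leq_card.
  by rewrite !subUset !sub1set aA bA cA.
- by move=> i j /val_inj /enum_val_inj.
- rewrite yA; split; last exact: good_vert.
  by rewrite /line lift_ground -[rank M _]/(r _) rank_lift rA.
- by move=> i; rewrite -repM; apply: valP.
move=> i; rewrite yA; have [_ _ fH rH E] := HE i.
have DE : (lift_set A :\ y i) :|: [set val (z i)] = lift_set (~: H i).
  rewrite E /lift_set imsetU imset_set1 [RHS]setUC; congr (_ :|: _).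
  apply/setP => e; rewrite !inE; apply/andP/imsetP.
    case=> ey /imsetP[x xA ex]; exists x => //; rewrite !inE xA andbT.
    by apply: contra ey => /eqP xi; rewrite ex xi.
  case=> x; rewrite !inE => /andP[xi xA] ->; split; last by apply: imset_f.
  by apply: contra xi => /eqP/val_inj ->.
have cE B : ground M :\: lift_set B = lift_set (~: B).
  apply/setP => e; rewrite inE; apply/andP/imsetP.
    case=> eB; rewrite -repM => eM; exists (Sub e eM); rewrite ?SubK //.
    by rewrite inE -mem_lift SubK.
  by case=> x; rewrite inE => xB ->; rewrite mem_lift xB -repM; split=> //; apply: valP.
have rT : rk M = r1 setT.
  by rewrite (rk_setT hM) (rankT (contr_reduction r set0)) rank0 addn0.
have {}rH : (r1 (H i)).+1 = rk M by rewrite rT.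
rewrite /cocircuit DE lift_ground cE setCK -[rank M _]/(r _) rank_lift -rH.
apply/and3P; split=> //.
apply/forallP => D; apply/implyP => /properP[sD [e eH eD]].
have [B DB] := ground_lift (subset_trans sD (lift_ground _)).
rewrite DB cE -[rank M _]/(r _) rank_lift eqn_leq {1}rH rT leT andTb.
case/imsetP: eH => x xH ex; rewrite inE in xH.
rewrite -(flatU1 fH xH); apply: rf_mono; rewrite subUset sub1set inE.
rewrite -mem_lift -DB -ex eD /=; apply/subsetP => w wH; rewrite inE.
apply/negP => wB; have := subsetP sD (val w); rewrite DB !mem_lift wB inE wH.
by move/(_ isT).
Qed.

(** When all traces of [I] are independent, their ranks add up by [skew_trace] and equal their
    sizes, so [I] has full rank. Excluding the empty set keeps the members distinct. *)
Lemma skew_free (s : seq {set T1}) : skew r1 s -> set0 \notin s ->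
  #|[set:: map lift_set s]| = size s /\ free_family M [set:: map lift_set s].
Proof.
have simp1 : simple_rf r1 := contr_simple r set0.
move=> sk s0; have us := skew_uniq simp1 sk s0.
split.
  have /card_uniqP c : uniq (map lift_set s) by rewrite (map_inj_uniq lift_inj).
  by rewrite cardsE c size_map.
split.
- by move=> X; rewrite inE => /mapP[A _ ->]; apply: lift_ground.
- apply/trivIsetP => X Y; rewrite !inE => /mapP[A As ->] /mapP[B Bs ->] nAB.
  have AB : A != B by apply: contraNneq nAB => ->.
  rewrite disjoint_subset; apply/subsetP => e /imsetP[x xA ->]; rewrite inE mem_lift.
  by rewrite (disjointFr (skew_disjoint simp1 sk As Bs AB) xA).
move=> I sI.
have IM : I \subset ground M.
  apply: subset_trans sI _; apply/bigcupsP => X; rewrite inE => /mapP[A _ ->].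
  exact: lift_ground.
have [J IJ] := ground_lift IM.
have indE A : indep M (lift_set A) = (r1 A == #|A|).
  by rewrite (indep_rank hM) rank_lift card_lift.
have JA A : I :&: lift_set A = lift_set (J :&: A).
  by rewrite IJ /lift_set imsetI // => ? ? _ _; apply: val_inj.
apply/idP/forall_inP.
  move=> iI X _; have [_ _ down _] := hM; apply: (down _ I) => //; apply: subsetIl.
move=> h; rewrite IJ indE eqn_leq rf_card andTb.
have JE : J = \bigcup_(A <- s) (J :&: A).
  apply/setP => x; rewrite in_bigcup; apply/idP/hasP; last first.
    by case=> A _; rewrite inE => /andP[].
  move=> xJ; have : val x \in cover [set:: map lift_set s].
    by apply: (subsetP sI); rewrite IJ mem_lift.
  case/bigcupP => X; rewrite inE => /mapP[A As ->]; rewrite mem_lift => xA.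
  by exists A => //; rewrite inE xJ.
rewrite {2}JE (skew_trace simp1) //.
have -> : \sum_(A <- s) r1 (J :&: A) = \sum_(A <- s) #|J :&: A|.
  rewrite big_seq [RHS]big_seq; apply: eq_bigr => A As; apply/eqP.
  by rewrite -indE -JA; apply: h; rewrite inE map_f.
rewrite {1}JE; elim: (s) => [|A s' IH]; first by rewrite !big_nil cards0.
by rewrite !big_cons; apply: leq_trans (leq_card_setU _ _) _; rewrite leq_add2l.
Qed.

End MatroidFamily.

Theorem theorem1p4 (T T' : finType) (M : matroid T) (N : matroid T') :
  is_matroid M -> is_matroid N ->
  three_connected M -> three_connected N -> simple N -> has_minor M N ->
  2 <= rk M - rk N ->
  exists F : {set {set T}},
    [/\ #|F| = uphalf (rk M - rk N) + 1,
        free_family M F &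
        forall X, X \in F ->
          (exists x, X = [set x] /\ vert_contractible M N [set x])
          \/ filament M N X].
Proof.
move=> hM hN cM cN sN mMN k2.
have [_ [_ [_ _ _ [f0 _]]]] := mMN.
pose r := matroid_rf hM; pose rN := geometry hN; pose r1 := geometry hM.
have [m1 m2] := three_connected_simple hM cM (leq_trans k2 (leq_subr _ _)).
have repM := ground_rep m1 m2.
have repN : forall u, least_rep (matroid_rf hN) set0 u = (u \in ground N).
  case/andP: sN => /forallP nl /forallP np.
  have n1 e : e \in ground N -> matroid_rf hN [set e] = 1.
    move=> eN; have := nl e; rewrite /loop eN /= -[rank N _]/(matroid_rf hN _).
    by have := rank1_le (matroid_rf hN) e; lia.
  apply: ground_rep => // e f eN fN ef.
  have := np e; move/forallP/(_ f); rewrite /parallel eN fN ef !nl /=.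
  rewrite -[rank N _]/(matroid_rf hN _).
  have := rf_card (matroid_rf hN) [set e; f]; rewrite cards2 ef.
  have : matroid_rf hN [set e] <= matroid_rf hN [set e; f].
    by apply: rf_mono; rewrite sub1set !inE eqxx.
  by rewrite n1 //; lia.
have simpN : simple_rf rN := contr_simple (matroid_rf hN) set0.
have vcN : vconn rN set0 by apply/vconn_geometry/three_connected_vconn.
have N3 (I : {set {u | least_rep (matroid_rf hN) set0 u}}) d : d <= 1 ->
    rN I + rN (~: I) <= rN setT + d -> #|I| <= d \/ #|~: I| <= d.
  move=> d1 le; have := vcN I (~: I) d d1 (setUCr I) (sub0set _) (sub0set _).
  by rewrite rank0 addn0 !add0n => /(_ le)[] /(simple_card simpN d1); [left|right].
have simpM : simple_rf r1 := contr_simple r set0.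
have vcM : vconn r1 set0 by apply/vconn_geometry/three_connected_vconn.
have ncM : ncontr rN r1 set0.
  apply: (NM_down simpN.1 (contr_reduction r set0)); rewrite up0.
  exact: has_minor_ncontr.
have rkM : rk M = r1 setT.
  by rewrite (rk_setT hM) (rankT (contr_reduction r set0)) rank0 addn0.
have rkN : rk N = rN setT.
  by rewrite (rk_setT hN) (rankT (contr_reduction (matroid_rf hN) set0)) rank0 addn0.
have rk_eq : rN setT + (rk M - rk N) = r1 setT by rewrite -rkN -rkM; lia.
have [s [sz ms sk]] := members_exist simpN.1 N3 simpM vcM ncM (ltnW k2) rk_eq.
have s0 : set0 \notin s.
  apply/negP => /ms[[x [/setP/(_ x)]]|[_]]; first by rewrite !inE eqxx.
  by rewrite rank0.
have [cF fF] := skew_free repM sk s0.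
exists [set:: map (@lift_set _ _ hM) s]; split=> //.
  (* The hypothesis [2 <= rk M - rk N] rules out the exceptional value 1. *)
  by rewrite cF sz /ceil_half_succ; case: eqP k2 => // ->.
move=> X; rewrite inE => /mapP[A /ms mA ->]; case: mA => [[x [-> gx]]|fA].
  left; exists (val x); rewrite /lift_set imset_set1; split=> //.
  by have := good_vert repM repN f0 gx; rewrite /lift_set imset_set1.
by right; apply: (gfil_filament repM repN vcM f0 fA).
Qed.
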